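(* Let $N\ge2$ be an integer, $0<s<1$ and $1<p<\infty$. If $N\le ps$ and $u$ is a non-negative lower semi-continuous weak solution of $$(-\Delta_p)^s u\ge 0\quad\text{in }\mathbb{R}^N,$$ then $u$ is constant.
   Context: Write $\Psi_p(t)=|t|^{p-2}t$ (with $\Psi_p(0)=0$). The fractional $p$-Laplacian, with its normalization constant omitted, is $$(-\Delta_p)^su(x)=2\lim_{\varepsilon\to0^+}\int_{\mathbb{R}^N\setminus B_\varepsilon(x)}\frac{\Psi_p(u(x)-u(y))}{|x-y|^{N+sp}}\,dy.$$ For an open set $U\subseteq\mathbb{R}^N$, $W^{s,p}(U)$ is the set of $u\in L^p(U)$ with $\int_{U}\int_U\frac{|u(x)-u(y)|^p}{|x-y|^{N+sp}}\,dx\,dy<\infty$, and $W^{s,p}_{loc}(U)$ is the corresponding local space. Also $$L^{p-1}_s(\mathbb{R}^N)=\left\{u\in L^{p-1}_{loc}(\mathbb{R}^N):\int_{\mathbb{R}^N}\frac{|u(x)|^{p-1}}{(1+|x|)^{N+sp}}\,dx<\infty\right\}.$$ A weak solution of $(-\Delta_p)^su\ge0$ in an open set $\Omega\subseteq\mathbb{R}^N$ (i.e. a weak super-solution of $(-\Delta_p)^su=0$ in $\Omega$) is a function $u\in L_s^{p-1}(\mathbb{R}^N)$ such that for every bounded open $U\subseteq\Omega$ one has $u\in W^{s,p}_{loc}(U)$ and $$\int_{\mathbb{R}^{2N}}\frac{\Psi_p(u(x)-u(y))(\varphi(x)-\varphi(y))}{|x-y|^{N+sp}}\,dx\,dy\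 \ge\ 0$$ for every non-negative $\varphi\in C_c^\infty(U)$.
   Formalization: ''u is constant'' is read as ''u is constant almost everywhere'': changing a constant to a smaller value at one point keeps it non-negative, lower semi-continuous and a weak solution, so the everywhere version fails. *)

(* Defs.v *)
From HB Require Import structures.
From mathcomp Require Import all_boot all_order all_algebra.
From mathcomp Require Import all_classical all_reals all_analysis.

Set Implicit Arguments.
Unset Strict Implicit.
Unset Printing Implicit Defensive.

Import Order.TTheory GRing.Theory Num.Theory.
Import numFieldNormedType.Exports.

Local Open Scope classical_set_scope.
Local Open Scope ring_scope.

(* R^n is 'rV[R]_n. Its sigma-algebra is generated by the coordinate maps, as
   the library does for tuples; it is the Borel sigma-algebra. *)

Definition rV_display : measure_display -> measure_display.
Proof. exact. Qed.

Section measurable_rV.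
Context {R : realType} (n : nat).

Let coors : 'I_n -> 'rV[R]_n -> R := fun i x => x ord0 i.

Let rV_set0 : g_sigma_preimage coors set0.
Proof. exact: sigma_algebra0. Qed.

Let rV_setC A : g_sigma_preimage coors A -> g_sigma_preimage coors (~` A).
Proof. exact: sigma_algebraC. Qed.

Let rV_bigcup (F : _^nat) : (forall i, g_sigma_preimage coors (F i)) ->
  g_sigma_preimage coors (\bigcup_i (F i)).
Proof. exact: sigma_algebra_bigcup. Qed.

HB.instance Definition _ := @isMeasurable.Build
  (rV_display default_measure_display) 'rV[R]_n
  (g_sigma_preimage coors) rV_set0 rV_setC rV_bigcup.

End measurable_rV.

Lemma measurable_coord_rV (R : realType) n (i : 'I_n) :
  measurable_fun [set: 'rV[R]_n] (fun x : 'rV[R]_n => x ord0 i).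
Proof.
move=> _ Y mY; rewrite setTI; apply: sub_sigma_algebra => /=.
rewrite -bigcup_seq/=; exists i => /=; first by rewrite mem_index_enum.
by exists Y => //; rewrite setTI.
Qed.

Lemma measurable_fun_rVP d (T : measurableType d) (R : realType) n
    (f : T -> 'rV[R]_n) :
  (forall i, measurable_fun [set: T] (fun x => f x ord0 i)) ->
  measurable_fun [set: T] f.
Proof.
move=> mf _ A mA; rewrite setTI.
pose G : set (set 'rV[R]_n) := [set B | measurable (f @^-1` B)].
suff : measurable `<=` G by exact.
apply: smallest_sub.
  split=> [|B GB|F GF]; rewrite /G/=.
  - by rewrite preimage_set0.
  - by rewrite setTD preimage_setC; exact: measurableC.
  - by rewrite preimage_bigcup; exact: bigcupT_measurable.
rewrite -bigcup_seq => B [i _ [C mC <-]].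
by rewrite /G/= setTI -[X in measurable X]setTI; exact: mf.
Qed.

Definition rVcons {R : realType} n (z : R * 'rV[R]_n) : 'rV[R]_n.+1 :=
  row_mx z.1%:M z.2 : 'rV[R]_(1 + n).

Lemma rVcons0 (R : realType) n (z : R * 'rV[R]_n) : rVcons z ord0 ord0 = z.1.
Proof.
have -> : ord0 = lshift n ord0 :> 'I_(1 + n) by exact/val_inj.
by apply: etrans (row_mxEl z.1%:M z.2 ord0 ord0) _; rewrite mxE.
Qed.

Lemma rVconsS (R : realType) n (z : R * 'rV[R]_n) (j : 'I_n) :
  rVcons z ord0 (lift ord0 j) = z.2 ord0 j.
Proof.
have -> : lift ord0 j = rshift 1 j :> 'I_(1 + n) by exact/val_inj.
exact: (row_mxEr z.1%:M z.2 ord0 j).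
Qed.

Lemma measurable_rVcons (R : realType) n :
  measurable_fun [set: R * 'rV[R]_n] (@rVcons R n).
Proof.
apply: measurable_fun_rVP => i; have [j ->|->] := unliftP ord0 i.
  under eq_fun do rewrite rVconsS.
  exact: (measurableT_comp (measurable_coord_rV j)).
under eq_fun do rewrite rVcons0; exact: measurable_fst.
Qed.

(* Lebesgue measure on R^n, by slicing along the first coordinate:
   |A| = \int_R |{x in R^(n-1) | (t, x) in A}| dt. *)
Fixpoint lebesgue_rV {R : realType} (n : nat) : set 'rV[R]_n -> \bar R :=
  match n with
  | 0 => \d_(0 : 'rV[R]_0)
  | n'.+1 => fun A => (\int[lebesgue_measure]_t
               lebesgue_rV [set x : 'rV[R]_n' | A (rVcons (t, x))])%E
  end.
Arguments lebesgue_rV {R} n.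

Section lebesgue_rV_measure.
Context {R : realType}.

Lemma lebesgue_rV_sigma_finite_measure n :
  exists m : {sigma_finite_measure set 'rV[R]_n -> \bar R},
    lebesgue_rV n = m :> (set 'rV[R]_n -> \bar R).
Proof.
elim: n => [|n [m mE]].
  by exists (\d_(0 : 'rV[R]_0) : {sigma_finite_measure set 'rV[R]_0 -> \bar R}).
pose p : {measure set (measurableTypeR R * 'rV[R]_n)%type -> \bar R} :=
  ((@lebesgue_measure R) \x m)%E.
have sp : sigma_finite setT p.
  have /sigma_finiteP[F [TF ndF Foo]] := sigma_finiteT (@lebesgue_measure R).
  have /sigma_finiteP[G [TG ndG Goo]] := sigma_finiteT m.
  exists (fun n => F n `*` G n).
    rewrite -setXTT TF TG predeqE => -[x y]; split.
      move=> [/= [i _ Fix] [k _ Gky]]; exists (maxn i k) => //; split.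
      - by move: x Fix; exact/subsetPset/ndF/leq_maxl.
      - by move: y Gky; exact/subsetPset/ndG/leq_maxr.
    by move=> [i _ []/= ? ?]; split; exists i.
  move=> k; have [? ?] := Foo k; have [? ?] := Goo k.
  split; first exact: measurableX.
  by rewrite /p/= product_measure1E// lte_mul_pinfty// ge0_fin_numE.
have mc : measurable_fun [set: measurableTypeR R * 'rV[R]_n] (@rVcons R n).
  exact: measurable_rVcons.
pose q := pushforward p (@rVcons R n).
have qE : lebesgue_rV n.+1 = q :> (set 'rV[R]_n.+1 -> \bar R).
  apply/funext => A /=; rewrite /q /p /pushforward /product_measure1/= mE.
  apply: eq_integral => t _ /=; congr (m _).
  by apply/seteqP; split => x /=; rewrite xsectionE.
pose qm : {measure set 'rV[R]_n.+1 -> \bar R} :=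
  measure_function_pushforward__canonical__measure_function_Measure p mc.
have sq : sigma_finite setT q.
  have [F FT mF] := sp.
  pose h (x : 'rV[R]_n.+1) : measurableTypeR R * 'rV[R]_n :=
    (x ord0 ord0, \row_j x ord0 (lift ord0 j)).
  have hK : cancel h (@rVcons R n).
    move=> x; apply/rowP => i; have [j ->|->] := unliftP ord0 i.
      by rewrite rVconsS mxE.
    by rewrite rVcons0.
  have cK : cancel (@rVcons R n) h.
    case=> t x; rewrite /h rVcons0; congr pair.
    by apply/rowP => j; rewrite mxE rVconsS.
  have mh : measurable_fun setT h.
    apply/measurable_fun_pair => /=; first exact: measurable_coord_rV.
    apply: measurable_fun_rVP => j; under eq_fun do rewrite mxE.
    exact: measurable_coord_rV.
  exists (fun k => h @^-1` F k); first by rewrite -preimage_bigcup -FT.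
  move=> k; have [mFk Fk] := mF k; split.
    by rewrite -[X in measurable X]setTI; exact: mh.
  rewrite /q /pushforward -comp_preimage (_ : h \o _ = id)//.
  by apply/funext => z; exact: cK.
have sq' : sigma_finite setT qm by [].
pose i1 := @isSFinite.Build _ _ _ q (sfinite_measure_sigma_finite (mu := qm) sq').
pose i2 := @isSigmaFinite.Build _ _ _ q sq.
pose Q : {sigma_finite_measure set 'rV[R]_n.+1 -> \bar R} :=
  HB.pack_for {sigma_finite_measure set 'rV[R]_n.+1 -> \bar R} q (Measure.class qm) i1 i2.
by exists (Q mc); rewrite qE.
Qed.

Variable n : nat.

Let lebesgue_rV0 : lebesgue_rV n set0 = 0%E :> \bar R.
Proof. by have [m ->] := lebesgue_rV_sigma_finite_measure n. Qed.

Let lebesgue_rV_ge0 (A : set 'rV[R]_n) : (0 <= lebesgue_rV n A)%E.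
Proof. by have [m ->] := lebesgue_rV_sigma_finite_measure n. Qed.

Let lebesgue_rV_semi_sigma_additive :
  semi_sigma_additive (lebesgue_rV n : set 'rV[R]_n -> \bar R).
Proof.
have [m ->] := lebesgue_rV_sigma_finite_measure n.
exact: measure_semi_sigma_additive.
Qed.

HB.instance Definition _ := isMeasure.Build _ _ _
  (lebesgue_rV n : set 'rV[R]_n -> \bar R)
  lebesgue_rV0 lebesgue_rV_ge0 lebesgue_rV_semi_sigma_additive.

Let lebesgue_rV_sigma_finite :
  sigma_finite setT (lebesgue_rV n : set 'rV[R]_n -> \bar R).
Proof.
by have [m ->] := lebesgue_rV_sigma_finite_measure n; exact: sigma_finiteT.
Qed.

HB.instance Definition _ := Measure_isSigmaFinite.Build _ _ _
  (lebesgue_rV n : set 'rV[R]_n -> \bar R) lebesgue_rV_sigma_finite.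

End lebesgue_rV_measure.

(* The norm `|x| that the library puts on 'rV[R]_n is the sup norm; it serves
   here only through its topology and its bounded sets. *)
Definition enorm {R : realType} {n} (x : 'rV[R]_n) : R :=
  Num.sqrt (\sum_(i < n) x ord0 i ^+ 2).

Section function_spaces.
Context {R : realType} {N : nat}.
Local Notation V := 'rV[R]_N.
Local Notation leb := (@lebesgue_rV R N).
Implicit Types (p q s : R) (U W : set V) (u f : V -> R).

Definition Lp q U u :=
  measurable_fun U u /\ (\int[leb]_(x in U) (`|u x| `^ q)%:E < +oo)%E.

Definition Lp_loc q u := forall K, compact K -> Lp q K u.

Definition Wsp s p U u :=
  Lp p U u /\
  (\int[leb \x leb]_(z in U `*` U)
     (`|u z.1 - u z.2| `^ p / enorm (z.1 - z.2) `^ (N%:R + s * p))%:E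
   < +oo)%E.

Definition Wsp_loc s p U u := forall W, open W ->
  compact (closure W) -> closure W `<=` U -> Wsp s p W u.

(* The space written L^{p-1}_s(R^N). *)
Definition tail_space s p u :=
  Lp_loc (p - 1) u /\
  (\int[leb]_x (`|u x| `^ (p - 1) / (1 + enorm x) `^ (N%:R + s * p))%:E
   < +oo)%E.

Fixpoint partials (l : seq 'I_N) f : V -> R :=
  if l is i :: l' then 'D_(delta_mx ord0 i) (partials l' f) else f.

Definition smooth f := forall l : seq 'I_N,
  continuous (partials l f) /\
  forall (i : 'I_N) (x : V), derivable (partials l f) x (delta_mx ord0 i).

Definition tsupport f : set V := closure [set x | f x != 0].

Definition Cc_infty U f :=
  [/\ smooth f, compact (tsupport f) & tsupport f `<=` U].

Definition Psi p (t : R) : R := `|t| `^ (p - 2) * t.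

(* u is a weak solution of (-Delta_p)^s u >= 0 in Om. Under the first two
   requirements the integrand below is Lebesgue integrable. *)
Definition weak_supersolution s p (Om : set V) u :=
  tail_space s p u /\
  forall U, open U -> bounded_set U -> U `<=` Om ->
    Wsp_loc s p U u /\
    forall phi, Cc_infty U phi -> (forall x, 0 <= phi x) ->
      (0 <= \int[leb \x leb]_z
              (Psi p (u z.1 - u z.2) * (phi z.1 - phi z.2)
               / enorm (z.1 - z.2) `^ (N%:R + s * p))%:E)%E.

End function_spaces.

(* Main.v *)
(** Let w = (M phi - u)_+ with a cutoff phi. It is upper semicontinuous with
    compact support and finite energy, and it is an admissible test function:
    mollifying it and using Fubini's theorem, the weak form is nonnegative for
    translates of w by vectors h_k -> 0; semicontinuity gives
    w(. + h_k) -> w in L^1, and Fatou's lemma passes to the limit.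
    Convexity then bounds the energy of w by that of M phi. When N <= sp, the
    rescaled cutoffs phi(./k) have bounded energy, so (M - u)_+ has finite
    energy E on R^N. Testing once more, and splitting the cross term with a
    weight A, gives E <= C A^(1-p) for every A > 0: hence E = 0, and
    (M - u)_+ is constant for every M. *)
From HB Require Import structures.
Require Import Defs.
From mathcomp Require Import all_boot all_order all_algebra.
From mathcomp Require Import all_classical all_reals all_analysis.
From mathcomp Require Import measurable_realfun.
From mathcomp Require Import ring lra.

Set Implicit Arguments.
Unset Strict Implicit.
Unset Printing Implicit Defensive.

Import Order.TTheory GRing.Theory Num.Theory.
Import numFieldNormedType.Exports.

Local Open Scope classical_set_scope.
Local Open Scope ring_scope.

(** * Lebesgue measure on R^n *)

(** The obstacle is that w inherits no regularity from u beyond semicontinuity, so its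
    mollifications are not easily controlled in the fractional energy. Only the sign of the weak
    form matters, however. The average of the weak form over small translates of w is a
    superposition, with weights w(y) >= 0, of weak forms tested with translated bumps, so it cannot
    be negative for all of them. All translates have the same energy, and apart from the energy
    density the bound on their flux is common to them, so almost everywhere convergence suffices.
    The cutoff energy scales as k^(N - sp). In the borderline case N = sp it stays bounded without
    tending to 0; hence one test bounds the energy and another one annihilates it. In the latter, E
    appears with coefficient 2A + 1 on one side and 2A on the other: the difference is 1 whatever A
    is, and the remainder is a multiple of A^(1 - p), where A can be taken arbitrarily large because
    p > 1. *)

Lemma measurable_rV_add (R : realType) n (h : 'rV[R]_n) :
  measurable_fun [set: 'rV[R]_n] (fun x => x + h).
Proof.
apply: measurable_fun_rVP => i; under eq_fun do rewrite mxE.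
by apply: measurable_funD; [exact: measurable_coord_rV|exact: measurable_cst].
Qed.

Section integral_invariance.
Context d (T : measurableType d) (R : realType).
Local Open Scope ereal_scope.

Lemma ge0_integral_invariant (mu : {measure set T -> \bar R}) (phi : T -> T)
    (f : T -> \bar R) : measurable_fun [set: T] phi ->
  (forall A, measurable A -> mu (phi @^-1` A) = mu A) ->
  measurable_fun [set: T] f -> (forall x, 0 <= f x) ->
  \int[mu]_x f (phi x) = \int[mu]_x f x.
Proof.
move=> mphi inv mf f0.
have := @ge0_integral_pushforward _ _ _ _ R phi mphi mu setT f measurableT mf.
rewrite preimage_setT => <-; last by move=> y _; exact: f0.
by apply: eq_measure_integral => A mA _; rewrite /= /pushforward inv.
Qed.

End integral_invariance.

Lemma lebesgue_measure_shift (R : realType) (h : R)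
    (A : set (measurableTypeR R)) : measurable A ->
  lebesgue_measure ((fun t : measurableTypeR R => t + h : measurableTypeR R) @^-1` A)
  = lebesgue_measure A.
Proof.
move=> mA.
have mh : measurable_fun [set: measurableTypeR R]
    (fun t : measurableTypeR R => t + h : measurableTypeR R).
  by apply: measurable_funD => //; exact: measurable_cst.
apply/esym; apply: (@lebesgue_measure_unique R
  (measure_function_pushforward__canonical__measure_function_Measure _ mh)) => //.
move=> _ [[a b]] _ <-; rewrite /= /pushforward.
rewrite [X in lebesgue_measure X = _](_ : _ = `]a, b]%classic)//.
rewrite [X in _ = lebesgue_measure X](_ : _ = `]a - h, b - h]%classic); last first.
  apply/seteqP; split => t /=; rewrite !in_itv/= => /andP[? ?].
    by rewrite ltrBlDr lerBrDr; apply/andP; split.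
  by rewrite -ltrBlDr -lerBrDr; apply/andP; split.
rewrite !lebesgue_measure_itv/= !lte_fin ltrD2r.
by case: ifP => // _; rewrite -!EFinB; congr EFin; ring.
Qed.

Section lebesgue_rV_theory.
Context {R : realType}.
Local Open Scope ereal_scope.

Lemma lebesgue_rVS n (A : set 'rV[R]_n.+1) : lebesgue_rV n.+1 A =
  \int[lebesgue_measure]_t lebesgue_rV n [set x | A (rVcons (t, x))].
Proof. by []. Qed.

Lemma measurable_rVcons_section n (A : set 'rV[R]_n.+1) (t : R) :
  measurable A -> measurable [set x : 'rV[R]_n | A (rVcons (t, x))].
Proof.
move=> mA.
have mB : measurable ((@rVcons R n : measurableTypeR R * _ -> _) @^-1` A).
  by rewrite -[X in measurable X]setTI; exact: measurable_rVcons.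
have := measurable_xsection (t : measurableTypeR R) mB.
by congr measurable; apply/seteqP; split => x /=; rewrite xsectionE.
Qed.

Lemma measurable_lebesgue_rV_section n (A : set 'rV[R]_n.+1) : measurable A ->
  measurable_fun [set: measurableTypeR R]
    (fun t => lebesgue_rV n [set x | A (rVcons (t, x))]).
Proof.
move=> mA.
have mB : measurable ((@rVcons R n : measurableTypeR R * _ -> _) @^-1` A).
  by rewrite -[X in measurable X]setTI; exact: measurable_rVcons.
have := measurable_fun_xsection (@lebesgue_rV R n) mB.
apply: eq_measurable_fun => t _ /=; congr (lebesgue_rV n _).
by apply/seteqP; split => x /=; rewrite xsectionE.
Qed.

Lemma lebesgue_rV_shift n (h : 'rV[R]_n) (A : set 'rV[R]_n) : measurable A ->
  lebesgue_rV n ((fun x => x + h)%R @^-1` A) = lebesgue_rV n A.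
Proof.
elim: n h A => [|n IH] h A mA.
  by have -> : (fun x => x + h)%R = id by apply/funext => x; rewrite [h]thinmx0 addr0.
pose h' := (\row_j h ord0 (lift ord0 j))%R.
have hE t (x : 'rV[R]_n) :
    (rVcons (t, x) + h = rVcons (t + h ord0 ord0, x + h'))%R.
  apply/rowP => i; have [j ->|->] := unliftP ord0 i.
    by rewrite mxE !rVconsS !mxE.
  by rewrite mxE !rVcons0.
rewrite !lebesgue_rVS.
pose g (t : measurableTypeR R) := lebesgue_rV n [set x | A (rVcons (t, x))].
transitivity (\int[lebesgue_measure]_(t in [set: measurableTypeR R])
    g (t + h ord0 ord0)%R).
  apply: eq_integral => t _ /=.
  rewrite /g -(IH h' _ (measurable_rVcons_section (t + h ord0 ord0)%R mA)).
  by apply: (congr1 (lebesgue_rV n)); apply/seteqP; split => x /=; rewrite hE.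
apply: (@ge0_integral_invariant _ (measurableTypeR R) R lebesgue_measure
  (fun t => t + h ord0 ord0)%R g).
- by apply: measurable_funD => //; exact: measurable_cst.
- by move=> B mB; exact: lebesgue_measure_shift.
- exact: measurable_lebesgue_rV_section.
- by move=> t; exact: measure_ge0.
Qed.

Lemma ge0_integral_rV_shift n (h : 'rV[R]_n) (f : 'rV[R]_n -> \bar R) :
  measurable_fun [set: 'rV[R]_n] f -> (forall x, 0 <= f x) ->
  \int[lebesgue_rV n]_x f (x + h)%R = \int[lebesgue_rV n]_x f x.
Proof.
move=> mf f0; apply: (ge0_integral_invariant (mu := lebesgue_rV n)) => //.
  exact: measurable_rV_add.
by move=> A mA; exact: lebesgue_rV_shift.
Qed.

Lemma ge0_integral_rV2_shift n (h : 'rV[R]_n)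
    (f : 'rV[R]_n * 'rV[R]_n -> \bar R) :
  measurable_fun [set: 'rV[R]_n * 'rV[R]_n] f -> (forall z, 0 <= f z) ->
  \int[lebesgue_rV n \x lebesgue_rV n]_z f (z.1 + h, z.2 + h)%R =
  \int[lebesgue_rV n \x lebesgue_rV n]_z f z.
Proof.
move=> mf f0.
have mh : measurable_fun [set: 'rV[R]_n * 'rV[R]_n]
    (fun z : 'rV[R]_n * 'rV[R]_n => (z.1 + h, z.2 + h)%R).
  apply/measurable_fun_pair => /=; apply: (measurableT_comp (measurable_rV_add h)).
    exact: measurable_fst.
  exact: measurable_snd.
rewrite fubini_tonelli1//; last exact: (measurableT_comp mf mh).
rewrite fubini_tonelli1// /fubini_F /=.
rewrite -(ge0_integral_rV_shift h (f := fun x => \int[lebesgue_rV n]_y f (x, y))).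
- apply: eq_integral => x _.
  rewrite (ge0_integral_rV_shift h (f := fun y => f (x + h, y)%R))//.
  exact: measurable_fun_pair2.
- exact: measurable_fun_fubini_tonelli_F.
- by move=> x; exact: integral_ge0.
Qed.

End lebesgue_rV_theory.

(** * Sup norm, Euclidean norm and the measure of cubes *)

Section rV_norms.
Context {R : realType}.

Lemma ler_norm_rVP n (x : 'rV[R]_n) (r : R) : 0 <= r ->
  reflect (forall i, `|x ord0 i| <= r) (`|x| <= r).
Proof.
move=> r0; rewrite -[`|x|]/(mx_norm x) mx_normrE; apply: (iffP idP).
  move=> /bigmax_leP[_ xr] i; exact: (xr (ord0, i)).
move=> xr; apply/bigmax_leP; split => // -[i j] _ /=.
by rewrite (ord1 i); exact: xr.
Qed.

Lemma coord_norm_le n (x : 'rV[R]_n) i : `|x ord0 i| <= `|x|.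
Proof. by have /(ler_norm_rVP _ (normr_ge0 x)) := lexx `|x|; exact. Qed.

Lemma measurable_norm_rV n : measurable_fun [set: 'rV[R]_n] (fun x => `|x|).
Proof.
rewrite (_ : (fun _ => _) = fun x : 'rV[R]_n =>
    \big[Num.max/0]_(i <- index_enum 'I_n) `|x ord0 i|); last first.
  apply/funext => x; apply/eqP; rewrite eq_le.
  have -> : `|x| = \big[Num.max/0]_ij `|x ij.1 ij.2| by rewrite -[`|x|]/(mx_norm x) mx_normrE.
  apply/andP; split.
    apply/bigmax_leP; split; first exact: bigmax_ge_id.
    by move=> [i j] _ /=; rewrite (ord1 i); exact: le_bigmax.
  apply/bigmax_leP; split; first exact: bigmax_ge_id.
  by move=> i _ ; exact: (le_bigmax _ (fun ij : 'I_1 * 'I_n => `|x ij.1 ij.2|) (ord0, i)).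
elim: (index_enum _) => [|i s IH].
  by under eq_fun do rewrite big_nil; exact: measurable_cst.
under eq_fun do rewrite big_cons.
apply: measurable_maxr => //.
by apply: measurableT_comp => //; exact: measurable_coord_rV.
Qed.

Lemma measurable_cube n (r : R) : measurable [set x : 'rV[R]_n | `|x| <= r].
Proof.
have := measurable_norm_rV (n := n) measurableT (measurable_itv `]-oo, r]).
by rewrite setTI; congr measurable; apply/seteqP; split => x /=; rewrite in_itv.
Qed.

Lemma norm_rVcons_le n (t : R) (x : 'rV[R]_n) (r : R) : 0 <= r ->
  (`|rVcons (t, x)| <= r) = (`|t| <= r) && (`|x| <= r).
Proof.
move=> r0; apply/(ler_norm_rVP _ r0)/andP => [H|[tr xr] i].
  split; first by have := H ord0; rewrite rVcons0.
  by apply/(ler_norm_rVP _ r0) => i; have := H (lift ord0 i); rewrite rVconsS.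
have [j ->|->] := unliftP ord0 i; last by rewrite rVcons0.
by rewrite rVconsS; exact: (le_trans (coord_norm_le _ _)).
Qed.

(** Slices of a sup-norm ball are sup-norm balls of the same radius or empty, so the induction along
    coordinates is explicit. This is why cutoffs and shells are built on the sup norm, while the
    Euclidean norm stays in the kernel. *)
Lemma lebesgue_rV_cube n (r : R) : 0 <= r ->
  lebesgue_rV n [set x | `|x| <= r] = ((2 * r) ^+ n)%:E.
Proof.
move=> r0; elim: n => [|n IH].
  rewrite expr0 /= diracE mem_set//=.
  by apply/(ler_norm_rVP _ r0) => -[].
rewrite lebesgue_rVS.
transitivity (\int[lebesgue_measure]_(t in `[(- r)%R, r]%classic) (cst ((2 * r) ^+ n)%:E) t)%E.
  rewrite [in RHS]integral_mkcond; apply: eq_integral => t _ /=.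
  rewrite patchE; case: ifPn => [|/negP].
    rewrite inE/= in_itv/= => tr; rewrite -IH; apply: (congr1 (lebesgue_rV n)).
    apply/seteqP; split => x /=; rewrite norm_rVcons_le//; first by move=> /andP[].
    by move=> ->; rewrite ler_norml tr.
  rewrite inE/= in_itv/= -ler_norml => tr.
  rewrite (_ : [set x | _] = set0) ?measure0//.
  by apply/seteqP; split => x //=; rewrite norm_rVcons_le// => /andP[].
rewrite integral_cst//= lebesgue_measure_itv/= lte_fin.
case: ifPn => [|rr].
  by move=> _; rewrite -EFinB -EFinM exprS; congr EFin; ring.
(* The length formula returns 0 unless [- r < r]; the remaining case is the degenerate cube. *)
have -> : r = 0 by apply/eqP; rewrite eq_le r0 andbT; move: rr; rewrite -leNgt; lra.
by rewrite mule0 mulr0 exprS mul0r.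
Qed.

Lemma measurable_enorm n : measurable_fun [set: 'rV[R]_n] (@enorm R n).
Proof.
rewrite /enorm; apply: measurableT_comp.
  exact: continuous_measurable_fun (@sqrt_continuous R).
rewrite (_ : (fun _ => _) = fun x : 'rV[R]_n =>
    \sum_(i <- index_enum 'I_n) x ord0 i ^+ 2)//.
apply: measurable_sum => i; apply: measurable_funX; exact: measurable_coord_rV.
Qed.

Lemma enorm_ge0 n (x : 'rV[R]_n) : 0 <= enorm x.
Proof. exact: sqrtr_ge0. Qed.

Lemma norm_le_enorm n (x : 'rV[R]_n) : `|x| <= enorm x.
Proof.
apply/(ler_norm_rVP _ (enorm_ge0 x)) => i.
rewrite -sqrtr_sqr ler_wsqrtr// (bigD1 i)//= lerDl.
by apply: sumr_ge0 => j _; exact: sqr_ge0.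
Qed.

Lemma enorm_le_norm n (x : 'rV[R]_n) : enorm x <= n%:R * `|x|.
Proof.
have H : \sum_(i < n) x ord0 i ^+ 2 <= (n%:R * `|x|) ^+ 2.
  apply: (@le_trans _ _ (\sum_(i < n) `|x| ^+ 2)).
    by apply: ler_sum => i _; rewrite -real_normK ?num_real// lerXn2r ?nnegrE// coord_norm_le.
  rewrite sumr_const card_ord exprMn -[X in X <= _]mulr_natl ler_wpM2r ?sqr_ge0//.
  by rewrite expr2 -natrM ler_nat; case: (posnP n) => [->//|]; exact: leq_pmulr.
by rewrite (le_trans (ler_wsqrtr H))// sqrtr_sqr ger0_norm// mulr_ge0.
Qed.

Lemma enormN n (x : 'rV[R]_n) : enorm (- x) = enorm x.
Proof. by rewrite /enorm; congr Num.sqrt; apply: eq_bigr => i _; rewrite mxE sqrrN. Qed.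

Lemma enorm0 n : enorm (0 : 'rV[R]_n) = 0.
Proof. by apply/le_anti; rewrite enorm_ge0 andbT (le_trans (enorm_le_norm _))// normr0 mulr0. Qed.

Lemma indic_cubeE n (r : R) (x : 'rV[R]_n) : \1_[set y : 'rV[R]_n | `|y| <= r] x = (`|x| <= r)%R%:R :> R.
Proof. by rewrite indicE; congr (_%:R); congr nat_of_bool; apply/idP/idP; rewrite inE. Qed.

End rV_norms.

(** * Integrals of the kernel *)

Section real_integrals.
Context d (T : measurableType d) (R : realType) (mu : {measure set T -> \bar R}).
Implicit Types f g : T -> R.

Lemma ge0_le_integral_EFin f g :
  measurable_fun [set: T] f -> measurable_fun [set: T] g ->
  (forall x, 0 <= f x) -> (forall x, f x <= g x) ->
  (\int[mu]_x (f x)%:E <= \int[mu]_x (g x)%:E)%E.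
Proof.
move=> mf mg f0 fg; apply: ge0_le_integral => //.
- by move=> x _; rewrite lee_fin.
- exact/measurable_EFinP.
- exact/measurable_EFinP.
- by move=> x _; rewrite lee_fin.
Qed.

Lemma ge0_integralD_EFin f g :
  measurable_fun [set: T] f -> measurable_fun [set: T] g ->
  (forall x, 0 <= f x) -> (forall x, 0 <= g x) ->
  (\int[mu]_x (f x + g x)%:E = \int[mu]_x (f x)%:E + \int[mu]_x (g x)%:E)%E.
Proof.
move=> mf mg f0 g0; under eq_integral do rewrite EFinD.
by rewrite ge0_integralD//; [move=> x _; rewrite lee_fin|exact/measurable_EFinP|
  move=> x _; rewrite lee_fin|exact/measurable_EFinP].
Qed.

Lemma ge0_integral_cstM (c : R) f : measurable_fun [set: T] f ->
  0 <= c -> (forall x, 0 <= f x) ->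
  (\int[mu]_x (c * f x)%:E = c%:E * \int[mu]_x (f x)%:E)%E.
Proof.
move=> mf c0 f0; under eq_integral do rewrite EFinM.
by rewrite ge0_integralZl//; [exact/measurable_EFinP|move=> x _; rewrite lee_fin].
Qed.

Lemma integral_indicZ (c : R) (A : set T) : measurable A -> 0 <= c ->
  (\int[mu]_x (c * \1_A x)%:E = c%:E * mu A)%E.
Proof.
move=> mA c0; rewrite ge0_integral_cstM// ?integral_indic ?setIT//.
Qed.

End real_integrals.

Lemma geometric_nneseries_le (R : realType) (A q : R) : 0 <= A -> 0 < q < 1 ->
  (\sum_(k <oo) (A * q ^+ k)%:E <= (A / (1 - q))%:E)%E.
Proof.
move=> A0 /andP[q0 q1]; apply: lime_le.
  by apply: is_cvg_nneseries => n _ _; rewrite lee_fin mulr_ge0// exprn_ge0// ltW.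
apply: nearW => n; rewrite sumEFin lee_fin big_mkord.
have := @geometric_le_lim R n A q A0 q0.
by rewrite ger0_norm ?(ltW q0)// q1 => /(_ isT); rewrite /series/= big_mkord.
Qed.

Section shells.
Context {R : realType} {n : nat}.
Local Notation V := 'rV[R]_n.
Local Notation leb := (@lebesgue_rV R n).
Local Open Scope ereal_scope.

(** The function is dominated by the sum of [c k] times the indicator of the full cube of radius
    [rho k]. The cubes overlap, but only the measure of cubes is needed and the geometric decay
    absorbs the loss. *)
Lemma shell_integral_le (f : V -> R) (c rho : nat -> R) (A q : R) :
  measurable_fun [set: V] f -> (forall x, 0 <= f x)%R ->
  (forall k, 0 <= c k)%R -> (forall k, 0 <= rho k)%R ->
  (0 <= A)%R -> (0 < q < 1)%R ->
  (forall k, c k * (2 * rho k) ^+ n <= A * q ^+ k)%R ->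
  (forall x, f x = 0 \/ exists2 k, `|x| <= rho k & f x <= c k)%R ->
  \int[leb]_x (f x)%:E <= (A / (1 - q))%:E.
Proof.
move=> mf f0 c0 r0 A0 q01 cr fc.
pose g k (x : V) := (c k * \1_[set y : V | (`|y| <= rho k)%R] x)%R.
have g0 k x : (0 <= g k x)%R by rewrite mulr_ge0.
have mg k : measurable_fun [set: V] (g k).
  by apply: measurable_funM => //; apply: measurable_indic; exact: measurable_cube.
apply: (@le_trans _ _ (\int[leb]_x \sum_(k <oo) (g k x)%:E)).
  apply: ge0_le_integral => //.
  - by move=> x _; rewrite lee_fin.
  - exact/measurable_EFinP.
  - apply: ge0_emeasurable_sum => // [k x _ _|k _]; first by rewrite lee_fin.
    exact/measurable_EFinP.
  - move=> x _; have [->|[k xk fk]] := fc x.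
      by apply: nneseries_ge0 => k _ _; rewrite lee_fin.
    apply: (@le_trans _ _ (g k x)%:E); first by rewrite lee_fin /g indicE mem_set// mulr1.
    apply: le_trans (nneseries_lim_ge k.+1 _).
      rewrite big_mkord big_ord_recr/= leeDr//; apply: sume_ge0 => i _; by rewrite lee_fin.
    by move=> i _; rewrite lee_fin.
rewrite integral_nneseries//.
- apply: le_trans (geometric_nneseries_le A0 q01).
  apply: lee_nneseries => [k _ _|k _].
    by apply: integral_ge0 => x _; rewrite lee_fin.
  rewrite integral_indicZ//; last exact: measurable_cube.
  by have /= -> := lebesgue_rV_cube n (r0 k); rewrite -EFinM lee_fin.
- by move=> k; exact/measurable_EFinP.
- by move=> k x _; rewrite lee_fin.
Qed.

End shells.

Lemma powRXn (R : realType) (b x : R) k : 0 <= b -> (b ^+ k) `^ x = (b `^ x) ^+ k.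
Proof. by move=> b0; rewrite -(powR_mulrn k b0) -(powR_mulrn k (powR_ge0 b x)) powRAC. Qed.

Lemma powR2N_lt1 (R : realType) (b : R) : 0 < b -> (2 : R) `^ (- b) < 1.
Proof.
move=> b0; rewrite powRN invf_lt1 ?powR_gt0//.
by have := @gt0_ltr_powR R b b0 1 2; rewrite powR1 => -> //; rewrite ?nnegrE// ltr1n.
Qed.

Lemma dyadic_scale (R : realType) (y : R) : 1 <= y ->
  exists k, 2 ^+ k <= y < 2 ^+ k.+1.
Proof.
move=> y1; have [k _ kP] : exists2 k, true & y < 2 ^+ k.
  by exists (Num.bound y) => //; apply: upper_nthrootP; exact: leqnn.
have ex : exists k, y < 2 ^+ k by exists k.
case: (ex_minnP ex) => -[|m] ym mmin.
  by move: ym; rewrite expr0 ltNge y1.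
by exists m; rewrite ym andbT leNgt; apply/negP => /mmin; rewrite ltnn.
Qed.

Section kernel.
Context {R : realType} {n : nat}.
Local Notation V := 'rV[R]_n.
Local Notation leb := (@lebesgue_rV R n).
Implicit Types (a p r : R) (x : V).

(** The singular kernel; it is used with [a = n + b], where [b] stands for sp. For a nonzero
    exponent the conventions for powers and inverses give it the value 0 at the origin, so the
    diagonal contributes nothing. *)
Definition kern a x : R := (enorm x `^ a)^-1.

Lemma kern_ge0 a x : 0 <= kern a x.
Proof. by rewrite invr_ge0 powR_ge0. Qed.

Lemma kern0 a : a != 0 -> kern a 0 = 0.
Proof. by move=> a0; rewrite /kern enorm0 powR0// invr0. Qed.

Lemma kern_gt0 a x : x != 0 -> 0 < kern a x.
Proof.
move=> x0; rewrite invr_gt0 powR_gt0// (lt_le_trans _ (norm_le_enorm x))//.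
by rewrite normr_gt0.
Qed.

Lemma kernN a x : kern a (- x) = kern a x.
Proof. by rewrite /kern enormN. Qed.

Lemma measurable_kern a : measurable_fun [set: V] (kern a).
Proof.
rewrite (_ : kern a = fun x : V => enorm x `^ (- a)); last first.
  by apply/funext => x; rewrite powRN.
apply: (measurableT_comp (measurable_powR _)); exact: measurable_enorm.
Qed.

Lemma kern_le a r x : 0 <= a -> 0 < r -> r <= `|x| -> kern a x <= (r `^ a)^-1.
Proof.
move=> a0 r0 rx; rewrite lef_pV2 ?posrE ?powR_gt0//; last first.
  by rewrite (lt_le_trans r0)// (le_trans rx)// norm_le_enorm.
apply: ge0_ler_powR => //; rewrite ?nnegrE ?enorm_ge0 ?(ltW r0)//.
by rewrite (le_trans rx)// norm_le_enorm.
Qed.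

Lemma measurable_far r : measurable [set x : V | r <= `|x|].
Proof.
have := @measurable_norm_rV R n measurableT _ (measurable_itv `[r, +oo[).
by rewrite setTI; congr measurable; apply/seteqP; split => x /=; rewrite in_itv/= andbT.
Qed.

Lemma kern_far_integral_le (b r : R) : 0 < b -> 0 < r ->
  (\int[leb]_x (\1_[set x : V | (r <= `|x|)%R] x * kern (n%:R + b) x)%:E
    <= (4 ^+ n * r `^ (- b) / (1 - 2 `^ (- b)))%:E)%E.
Proof.
move=> b0 r0.
have a0 : 0 <= n%:R + b by rewrite addr_ge0// ltW.
(* Dyadic shells from radius [2^k r] to [2^(k+1) r]: the kernel is bounded by its value at the inner
   radius. The cube of the outer radius has side [4 * 2^k r], which produces the factor [4^n]. *)
apply: (@shell_integral_le _ _ _ (fun k => ((2 ^+ k * r) `^ (n%:R + b))^-1)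
  (fun k => 2 ^+ k.+1 * r)).
- apply: measurable_funM; last exact: measurable_kern.
  by apply: measurable_indic; exact: measurable_far.
- by move=> x; rewrite mulr_ge0// kern_ge0.
- by move=> k; rewrite invr_ge0 powR_ge0.
- by move=> k; rewrite mulr_ge0// ltW.
- by rewrite mulr_ge0// powR_ge0.
- by rewrite powR_gt0//= powR2N_lt1.
- move=> k; have kr : 0 < 2 ^+ k * r by rewrite mulr_gt0// exprn_gt0.
  rewrite -powRN opprD powRD; last by rewrite (gt_eqF kr) implybT.
  rewrite powR_invn ?(ltW kr)//.
  have -> : 2 * (2 ^+ k.+1 * r) = 4 * (2 ^+ k * r) by rewrite exprS; ring.
  have -> : (2 ^+ k * r) `^ (- b) = (2 `^ (- b)) ^+ k * r `^ (- b).
    by rewrite powRM ?exprn_ge0 ?(ltW r0)// powRXn.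
  rewrite [(4 * _) ^+ n]exprMn; set y := _ ^+ k * r in kr *.
  have yn : y ^+ n != 0 by rewrite expf_neq0// gt_eqF.
  by rewrite le_eqVlt; apply/orP; left; apply/eqP; field.
- move=> x; rewrite indicE; case: (leP r `|x|) => rx; last first.
    by left; rewrite memNset ?mul0r//= => /(lt_le_trans rx); rewrite ltxx.
  right; have y1 : 1 <= `|x| / r by rewrite ler_pdivlMr// mul1r.
  have [k /andP[k1 k2]] := dyadic_scale y1; exists k.
    by rewrite -ler_pdivrMr// ltW.
  rewrite mem_set// mul1r; apply: kern_le => //.
    by rewrite mulr_gt0// exprn_gt0.
  by rewrite -ler_pdivlMr.
Qed.

Lemma measurable_near r : measurable [set x : V | `|x| < r].
Proof.
have := @measurable_norm_rV R n measurableT _ (measurable_itv `]-oo, r[).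
by rewrite setTI; congr measurable; apply/seteqP; split => x /=; rewrite in_itv/=.
Qed.

(** On the shell between [2^-(k+1) r] and [2^-k r] the p-th power gains [2^(-kp)] and the kernel,
    integrated, loses [2^(kb)]; the series converges because [b < p], that is s < 1. *)
Lemma kern_near_integral_le (b p r : R) : 0 < b -> b < p -> 0 < r ->
  (\int[leb]_x (\1_[set x : V | (`|x| < r)%R] x * ((`|x| / r) `^ p * kern (n%:R + b) x))%:E
    <= (4 ^+ n * (r / 2) `^ (- b) / (1 - 2 `^ (- (p - b))))%:E)%E.
Proof.
move=> b0 bp r0.
have a0 : 0 <= n%:R + b by rewrite addr_ge0// ltW.
apply: (@shell_integral_le _ _ _
  (fun k => (2 ^- k) `^ p * ((2 ^- k * (r / 2)) `^ (n%:R + b))^-1)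
  (fun k => 2 ^- k * r)).
- apply: measurable_funM; first by apply: measurable_indic; exact: measurable_near.
  apply: measurable_funM; last exact: measurable_kern.
  apply: (measurableT_comp (measurable_powR _)).
  by apply: measurable_funM; [exact: measurable_norm_rV|exact: measurable_cst].
- by move=> x; rewrite mulr_ge0// mulr_ge0// ?kern_ge0 ?powR_ge0.
- by move=> k; rewrite mulr_ge0// ?invr_ge0 powR_ge0.
- by move=> k; rewrite mulr_ge0// ?invr_ge0 ?exprn_ge0// ltW.
- by rewrite mulr_ge0// powR_ge0.
- by rewrite powR_gt0//= powR2N_lt1// subr_gt0.
- move=> k; set t : R := 2 ^- k.
  have t0 : 0 < t by rewrite invr_gt0 exprn_gt0.
  have r20 : 0 < r / 2 by rewrite divr_gt0.
  have kr : 0 < t * (r / 2) by rewrite mulr_gt0.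
  rewrite -powRN opprD powRD; last by rewrite (gt_eqF kr) implybT.
  rewrite powR_invn ?(ltW kr)//.
  have -> : 2 * (t * r) = 4 * (t * (r / 2)) by field.
  have -> : (t * (r / 2)) `^ (- b) = t `^ (- b) * (r / 2) `^ (- b).
    by rewrite powRM// ltW.
  have -> : (2 `^ (- (p - b))) ^+ k = t `^ p * t `^ (- b).
    rewrite -powRD; last by rewrite (gt_eqF t0) implybT.
    by rewrite /t -exprVn powRXn// -[2^-1]powR_inv1// -powRrM mulN1r.
  rewrite [(4 * _) ^+ n]exprMn; set y := t * (r / 2) in kr *.
  have yn : y ^+ n != 0 by rewrite expf_neq0// gt_eqF.
  by rewrite le_eqVlt; apply/orP; left; apply/eqP; field.
- move=> x; rewrite indicE; case: (ltP `|x| r) => rx; last first.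
    by left; rewrite memNset ?mul0r//= => /(le_lt_trans rx); rewrite ltxx.
  (* The origin belongs to no dyadic shell, but there the kernel has the value 0. *)
  have [->|x0] := eqVneq x 0.
    by left; rewrite kern0 ?mulr0// gt_eqF// ltr_wpDl.
  have xg0 : 0 < `|x| by rewrite normr_gt0.
  right; have y1 : 1 <= r / `|x| by rewrite ler_pdivlMr// mul1r ltW.
  have [k /andP[k1 k2]] := dyadic_scale y1; exists k.
    by rewrite mulrC ler_pdivlMr ?exprn_gt0// mulrC -ler_pdivlMr.
  rewrite mem_set// mul1r; apply: ler_pM; rewrite ?powR_ge0 ?kern_ge0//.
    apply: ge0_ler_powR; rewrite ?nnegrE ?divr_ge0 ?invr_ge0 ?exprn_ge0// ?(ltW r0)//.
      by rewrite ltW// (lt_trans b0).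
    by rewrite ler_pdivrMr// mulrC ler_pdivlMr ?exprn_gt0// mulrC -ler_pdivlMr.
  apply: kern_le => //; first by rewrite mulr_gt0 ?invr_gt0 ?exprn_gt0// divr_gt0.
  rewrite mulrC -mulrA -invfM -exprS ler_pdivrMr ?exprn_gt0// mulrC.
  by rewrite -ler_pdivrMr// ltW.
Qed.

(** The p-th power of the modulus of continuity of a bounded function that is Lipschitz at scale
    [r]. It tames the kernel at the origin and leaves it unchanged far away. *)
Definition profile r p x : R := Num.min 1 (`|x| / r) `^ p.

Lemma profile_ge0 r p x : 0 <= profile r p x.
Proof. exact: powR_ge0. Qed.

Lemma measurable_profile r p : measurable_fun [set: V] (profile r p).
Proof.
apply: (measurableT_comp (measurable_powR _)).
apply: measurable_minr; first exact: measurable_cst.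
by apply: measurable_funM; [exact: measurable_norm_rV|exact: measurable_cst].
Qed.

(** The constant must not depend on [r]: the scale later tends to infinity, and the exact power
    [r^(-b)] is what competes with the volume of the cutoff. *)
Lemma profile_integral_le (b p : R) : 0 < b -> b < p ->
  exists2 C : R, 0 <= C & forall r, 0 < r ->
  (\int[leb]_x (profile r p x * kern (n%:R + b) x)%:E <= (C * r `^ (- b))%:E)%E.
Proof.
move=> b0 bp.
exists (4 ^+ n / (1 - 2 `^ (- b)) + 4 ^+ n * 2^-1 `^ (- b) / (1 - 2 `^ (- (p - b)))).
  by rewrite addr_ge0// !mulr_ge0// ?powR_ge0// invr_ge0 subr_ge0 ltW// powR2N_lt1// subr_gt0.
move=> r r0.
have mfar : measurable_fun [set: V]
    (fun x => \1_[set x : V | (r <= `|x|)%R] x * kern (n%:R + b) x).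
  apply: measurable_funM; last exact: measurable_kern.
  by apply: measurable_indic; exact: measurable_far.
have mnear : measurable_fun [set: V]
    (fun x => \1_[set x : V | (`|x| < r)%R] x * ((`|x| / r) `^ p * kern (n%:R + b) x)).
  apply: measurable_funM; first by apply: measurable_indic; exact: measurable_near.
  apply: measurable_funM; last exact: measurable_kern.
  apply: (measurableT_comp (measurable_powR _)).
  by apply: measurable_funM; [exact: measurable_norm_rV|exact: measurable_cst].
apply: (@le_trans _ _ (\int[leb]_x (\1_[set x : V | (r <= `|x|)%R] x * kern (n%:R + b) x +
    \1_[set x : V | (`|x| < r)%R] x * ((`|x| / r) `^ p * kern (n%:R + b) x))%:E)%E).
  apply: ge0_le_integral_EFin.
  - by apply: measurable_funM; [exact: measurable_profile|exact: measurable_kern].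
  - exact: measurable_funD.
  - by move=> x; rewrite mulr_ge0// ?profile_ge0// kern_ge0.
  - move=> x; rewrite !indicE /profile; case: (leP r `|x|) => rx.
      rewrite mem_set// memNset/= ?ltNge ?rx// mul1r mul0r addr0.
      by rewrite min_l ?powR1 ?mul1r// ler_pdivlMr// mul1r.
    rewrite memNset/=; last by rewrite leNgt rx.
    rewrite mem_set//= mul0r add0r mul1r min_r//.
    by rewrite ler_pdivrMr// mul1r ltW.
rewrite ge0_integralD_EFin//; last 2 first.
- by move=> x; rewrite mulr_ge0// kern_ge0.
- by move=> x; rewrite !mulr_ge0// ?powR_ge0 ?kern_ge0.
apply: le_trans (leeD (kern_far_integral_le b0 r0) (kern_near_integral_le b0 bp r0)) _.
rewrite -EFinD lee_fin powRM ?invr_ge0 ?(ltW r0)//.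
by rewrite le_eqVlt; apply/orP; left; apply/eqP; ring.
Qed.

End kernel.

(** * Tonelli formulas for products and convolutions *)

Section double_integrals.
Context {R : realType} {n : nat}.
Local Notation V := 'rV[R]_n.
Local Notation leb := (@lebesgue_rV R n).
Implicit Types (f : V * V -> R) (g h : V -> R).

Lemma measurable_rV_sub_pair : measurable_fun [set: V * V] (fun z : V * V => z.1 - z.2).
Proof.
apply: measurable_fun_rVP => i; under eq_fun do rewrite !mxE.
apply: measurable_funB.
  exact: (measurableT_comp (measurable_coord_rV i) measurable_fst).
exact: (measurableT_comp (measurable_coord_rV i) measurable_snd).
Qed.

Lemma measurable_fun_diff g : measurable_fun [set: V] g ->
  measurable_fun [set: V * V] (fun z : V * V => g z.1 - g z.2).
Proof.
move=> mg; apply: measurable_funB.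
  exact: (measurableT_comp mg measurable_fst).
exact: (measurableT_comp mg measurable_snd).
Qed.

Lemma ge0_integral_swap f : measurable_fun [set: V * V] f -> (forall z, 0 <= f z) ->
  (\int[leb \x leb]_z (f (z.2, z.1))%:E = \int[leb \x leb]_z (f z)%:E)%E.
Proof.
move=> mf f0; have ms : measurable_fun [set: V * V] (fun z : V * V => (z.2, z.1)).
  by apply/measurable_fun_pair => /=; [exact: measurable_snd|exact: measurable_fst].
rewrite fubini_tonelli1//=; last 2 first.
- by apply/measurable_EFinP; exact: (measurableT_comp mf ms).
- by move=> z; rewrite lee_fin.
by rewrite fubini_tonelli2//=; exact/measurable_EFinP.
Qed.

Lemma ge0_integral_prod g h :
  measurable_fun [set: V] g -> measurable_fun [set: V] h ->
  (forall x, 0 <= g x) -> (forall x, 0 <= h x) ->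
  (\int[leb \x leb]_z (g z.1 * h z.2)%:E =
   \int[leb]_x (g x)%:E * \int[leb]_x (h x)%:E)%E.
Proof.
move=> mg mh g0 h0; rewrite fubini_tonelli1//=; last 2 first.
- apply/measurable_EFinP; apply: measurable_funM.
    exact: (measurableT_comp mg measurable_fst).
  exact: (measurableT_comp mh measurable_snd).
- by move=> z; rewrite lee_fin mulr_ge0.
transitivity (\int[leb]_x ((g x)%:E * \int[leb]_y (h y)%:E))%E.
  by apply: eq_integral => x _; rewrite /fubini_F/= ge0_integral_cstM.
rewrite ge0_integralZr//; [exact/measurable_EFinP|
  by move=> x _; rewrite lee_fin|
  by apply: integral_ge0 => x _; rewrite lee_fin].
Qed.

(** Evenness of [h] turns the inner integrand into a translate of [h] in the second variable, and
    translation invariance removes the dependence on the first. *)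
Lemma ge0_integral_conv g h :
  measurable_fun [set: V] g -> measurable_fun [set: V] h ->
  (forall x, 0 <= g x) -> (forall x, 0 <= h x) -> (forall x, h (- x) = h x) ->
  (\int[leb \x leb]_z (g z.1 * h (z.1 - z.2))%:E =
   \int[leb]_x (g x)%:E * \int[leb]_x (h x)%:E)%E.
Proof.
move=> mg mh g0 h0 hN; rewrite fubini_tonelli1//=; last 2 first.
- apply/measurable_EFinP; apply: measurable_funM.
    exact: (measurableT_comp mg measurable_fst).
  exact: (measurableT_comp mh measurable_rV_sub_pair).
- by move=> z; rewrite lee_fin mulr_ge0.
transitivity (\int[leb]_x ((g x)%:E * \int[leb]_y (h y)%:E))%E.
  apply: eq_integral => x _; rewrite /fubini_F/=.
  under eq_integral do rewrite -hN opprB.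
  rewrite ge0_integral_cstM//.
    rewrite (ge0_integral_rV_shift (- x) (f := fun y => (h y)%:E))//.
    exact/measurable_EFinP.
  exact: (measurableT_comp mh (measurable_rV_add _)).
rewrite ge0_integralZr//; [exact/measurable_EFinP|
  by move=> x _; rewrite lee_fin|
  by apply: integral_ge0 => x _; rewrite lee_fin].
Qed.

Lemma ge0_integral_conv2 g h :
  measurable_fun [set: V] g -> measurable_fun [set: V] h ->
  (forall x, 0 <= g x) -> (forall x, 0 <= h x) -> (forall x, h (- x) = h x) ->
  (\int[leb \x leb]_z (g z.2 * h (z.1 - z.2))%:E =
   \int[leb]_x (g x)%:E * \int[leb]_x (h x)%:E)%E.
Proof.
move=> mg mh g0 h0 hN; rewrite -(ge0_integral_conv mg mh)//.
rewrite -ge0_integral_swap/=; last 2 first.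
- apply: measurable_funM.
    exact: (measurableT_comp mg measurable_snd).
  exact: (measurableT_comp mh measurable_rV_sub_pair).
- by move=> z; rewrite mulr_ge0.
by apply: eq_integral => z _; rewrite -(hN (z.1 - z.2)) opprB.
Qed.

End double_integrals.

(** * Gagliardo energy *)

Section energy.
Context {R : realType} {n : nat}.
Local Notation V := 'rV[R]_n.
Local Notation leb := (@lebesgue_rV R n).
Implicit Types (f : V -> R) (p a r : R).

(** For [a = n + sp] its double integral is the p-th power of the Gagliardo seminorm on the whole
    space. *)
Definition energy_density p a f (z : V * V) : R :=
  `|f z.1 - f z.2| `^ p * kern a (z.1 - z.2).

Definition energy p a f : \bar R :=
  (\int[leb \x leb]_z (energy_density p a f z)%:E)%E.

Lemma energy_density_ge0 p a f z : 0 <= energy_density p a f z.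
Proof. by rewrite mulr_ge0 ?powR_ge0 ?kern_ge0. Qed.

Lemma measurable_kern_pair a :
  measurable_fun [set: V * V] (fun z : V * V => kern a (z.1 - z.2)).
Proof. exact: (measurableT_comp (measurable_kern a) measurable_rV_sub_pair). Qed.

Lemma measurable_energy_density p a f : measurable_fun [set: V] f ->
  measurable_fun [set: V * V] (energy_density p a f).
Proof.
move=> mf; apply: measurable_funM; last exact: measurable_kern_pair.
apply: (measurableT_comp (measurable_powR _)); apply: measurableT_comp => //.
exact: measurable_fun_diff.
Qed.

(** A diagonal translation fixes the difference of the two points, hence the kernel. In the passage
    to the limit along translates this invariance takes the place of strong convergence. *)
Lemma energy_shift p a f (h : V) : measurable_fun [set: V] f ->
  energy p a (fun x => f (x + h)) = energy p a f.
Proof.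
move=> mf; rewrite /energy.
rewrite -(ge0_integral_rV2_shift h (f := fun z => (energy_density p a f z)%:E)).
- apply: eq_integral => z _; congr EFin; rewrite /energy_density/=.
  by congr (_ * kern _ _); rewrite opprD addrACA subrr addr0.
- by apply/measurable_EFinP; exact: measurable_energy_density.
- by move=> z; rewrite lee_fin energy_density_ge0.
Qed.

(** A pair contributes only if one of its points lies in the cube of radius [rho], which leaves a
    volume times the integral of the profile. With [rho] and [r] both of order k the bound has order
    k^(n - b). *)
Lemma lipschitz_energy_le (p b : R) : 0 < b -> b < p ->
  exists2 C : R, 0 <= C & forall (f : V -> R) (A r rho : R), 0 < r -> 0 <= rho -> 0 <= A ->
  measurable_fun [set: V] f -> (forall x, rho < `|x| -> f x = 0) ->
  (forall x y, `|f x - f y| <= A * Num.min 1 (`|x - y| / r)) ->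
  (energy p (n%:R + b) f <= (C * (A `^ p * rho ^+ n * r `^ (- b)))%:E)%E.
Proof.
move=> b0 bp; have [C C0 HC] := @profile_integral_le R n b p b0 bp.
exists (2 * 2 ^+ n * C); first by rewrite !mulr_ge0.
move=> f A r rho r0 rho0 A0 mf fs fl.
pose B := [set x : V | `|x| <= rho].
have mB : measurable B by exact: measurable_cube.
pose g (x : V) := profile r p x * kern (n%:R + b) x.
have mg : measurable_fun [set: V] g.
  by apply: measurable_funM; [exact: measurable_profile|exact: measurable_kern].
have g0 x : 0 <= g x by rewrite mulr_ge0 ?profile_ge0 ?kern_ge0.
have gN x : g (- x) = g x by rewrite /g /profile normrN kernN.
have mA : measurable_fun [set: V] (fun x => A `^ p * \1_B x).
  by apply: measurable_funM => //; exact: measurable_indic.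
have A0' x : 0 <= A `^ p * \1_B x by rewrite mulr_ge0 ?powR_ge0.
apply: (@le_trans _ _ (\int[leb \x leb]_z
    (A `^ p * \1_B z.1 * g (z.1 - z.2) + A `^ p * \1_B z.2 * g (z.1 - z.2))%:E)%E).
  apply: ge0_le_integral_EFin.
  - exact: measurable_energy_density.
  - apply: measurable_funD; apply: measurable_funM.
    + exact: (measurableT_comp mA measurable_fst).
    + exact: (measurableT_comp mg measurable_rV_sub_pair).
    + exact: (measurableT_comp mA measurable_snd).
    + exact: (measurableT_comp mg measurable_rV_sub_pair).
  - by move=> z; exact: energy_density_ge0.
  - move=> -[x y]/=; rewrite /energy_density/= /g.
    set m := Num.min 1 (`|x - y| / r).
    have m0 : 0 <= m by rewrite le_min ler01 divr_ge0// ltW.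
    have key : `|f x - f y| `^ p <= A `^ p * profile r p (x - y).
      rewrite /profile -powRM//; apply: ge0_ler_powR; rewrite ?nnegrE ?mulr_ge0//.
      by rewrite ltW// (lt_trans b0).
    have p0 : p != 0 by rewrite gt_eqF// (lt_trans b0).
    rewrite -mulrDl -mulrDr mulrA ler_wpM2r ?kern_ge0// !indicE.
    have [xB|xB] := leP `|x| rho.
      rewrite (@mem_set _ B x)//=; apply: (le_trans key).
      rewrite ler_wpM2r ?profile_ge0// ler_peMr ?powR_ge0//.
      by rewrite lerDl.
    have [yB|yB] := leP `|y| rho.
      rewrite (@mem_set _ B y)//=; apply: (le_trans key).
      rewrite ler_wpM2r ?profile_ge0// ler_peMr ?powR_ge0//.
      by rewrite lerDr.
    rewrite fs// fs// subrr normr0 powR0//.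
    by rewrite mulr_ge0 ?profile_ge0// mulr_ge0 ?powR_ge0// addr_ge0.
rewrite ge0_integralD_EFin; last 4 first.
- apply: measurable_funM; first exact: (measurableT_comp mA measurable_fst).
  exact: (measurableT_comp mg measurable_rV_sub_pair).
- apply: measurable_funM; first exact: (measurableT_comp mA measurable_snd).
  exact: (measurableT_comp mg measurable_rV_sub_pair).
- by move=> z; rewrite mulr_ge0.
- by move=> z; rewrite mulr_ge0.
rewrite (@ge0_integral_conv _ _ (fun x => A `^ p * \1_B x) g)//.
rewrite (@ge0_integral_conv2 _ _ (fun x => A `^ p * \1_B x) g)//.
rewrite integral_indicZ ?powR_ge0//.
have /= -> := lebesgue_rV_cube n rho0.
have := HC r r0; rewrite -/g => Hg.
have k0 : (0 <= (A `^ p)%:E * ((2 * rho) ^+ n)%:E)%E.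
  by rewrite -EFinM lee_fin mulr_ge0 ?powR_ge0// exprn_ge0// mulr_ge0.
apply: le_trans (leeD (lee_wpmul2l k0 Hg) (lee_wpmul2l k0 Hg)) _.
rewrite -!EFinM -EFinD lee_fin exprMn.
by rewrite le_eqVlt; apply/orP; left; apply/eqP; ring.
Qed.

End energy.

(** * A smooth bump function *)

Section bump1.
Context {R : realType}.
Implicit Types (q : {poly R}) (m : nat) (t : R).

(** The functions q(t) (1 - t^2)^(-m) exp(-1 / (1 - t^2)), extended by 0, form a family closed under
    differentiation; smoothness of the standard bump follows by iteration. *)
Definition bump1 q m t : R :=
  if `|t| < 1 then q.[t] * (1 - t ^+ 2)^-1 ^+ m * expR (- (1 - t ^+ 2)^-1) else 0.

(** The numerator of the derivative over the common denominator (1 - t^2)^(m + 2). *)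
Definition bump1_dpoly q m : {poly R} :=
  q^`() * (1 - 'X^2) ^+ 2 + (m%:R *: 'X *+ 2) * q * (1 - 'X^2) - 'X *+ 2 * q.

Lemma onem_sqr_gt0 t : `|t| < 1 -> 0 < 1 - t ^+ 2.
Proof.
by move=> t1; rewrite subr_gt0 -real_normK ?num_real// expr_lt1.
Qed.

Lemma horner_bounded q : exists2 C : R, 0 <= C & forall t, `|t| < 1 -> `|q.[t]| <= C.
Proof.
exists (\sum_(i < size q) `|q`_i|); first exact: sumr_ge0.
move=> t t1; rewrite horner_coef; apply: le_trans (ler_norm_sum _ _ _) _.
apply: ler_sum => i _; rewrite normrM normrX ler_piMr// exprn_ile1// ltW//.
Qed.

Lemma expRN_inv_le m (y : R) : 0 < y -> expR (- y^-1) <= m.+1`!%:R * y ^+ m.+1.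
Proof.
move=> y0; have yV : 0 <= y^-1 by rewrite invr_ge0 ltW.
rewrite expRN -[leRHS]invrK lef_pV2 ?posrE ?expR_gt0//; last first.
  by rewrite invr_gt0 mulr_gt0 ?exprn_gt0// ltr0n fact_gt0.
apply: le_trans (expR_ge1Dxn m yV); rewrite invfM -exprVn mulrC.
by rewrite lerDr.
Qed.

(** The exponential beats the pole, so the function is flat to every order at the end points. Order
    2 serves for differentiability there, order 0 for a bound on the derivative. *)
Lemma bump1_le q m k : exists2 C : R, 0 <= C & forall t,
  `|t| < 1 -> `|bump1 q m t| <= C * (1 - t ^+ 2) ^+ k.
Proof.
have [C C0 qC] := horner_bounded q.
exists (C * (k + m).+1`!%:R); first by rewrite mulr_ge0.
move=> t t1; rewrite /bump1 t1; have y0 := onem_sqr_gt0 t1.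
have y1 : 1 - t ^+ 2 <= 1 by rewrite gerBl sqr_ge0.
move: y0 y1 (qC t t1); set y := 1 - t ^+ 2 => y0 y1 qt.
rewrite !normrM normrX (ger0_norm (expR_ge0 _)).
have yV : 0 < y^-1 by rewrite invr_gt0.
rewrite (gtr0_norm yV) -!mulrA.
apply: ler_pM => //; first by rewrite mulr_ge0 ?expR_ge0// exprn_ge0// invr_ge0 ltW.
rewrite exprVn mulrC ler_pdivrMr ?exprn_gt0//.
(* The exponential supplies [k + m + 1] powers of [y]: [m] of them cancel the pole, and the extra
   one may be dropped because [y <= 1]. *)
apply: le_trans (expRN_inv_le (k + m) y0) _.
rewrite -!mulrA ler_wpM2l// -exprD ler_wiXn2l// ltW//.
Qed.

Lemma is_derive0_sqr (f : R -> R) (t0 C : R) :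
  (forall t, `|f t| <= C * (t - t0) ^+ 2) -> is_derive t0 1 f 0.
Proof.
move=> fC; have f0 : f t0 = 0.
  by apply/eqP; rewrite -normr_le0 (le_trans (fC t0))// subrr expr0n mulr0.
have C0 : 0 <= C.
  by have := fC (t0 + 1); rewrite addrAC subrr add0r expr1n mulr1; exact: le_trans.
suff H : h^-1 *: ((f \o shift t0) (h *: 1) - f t0) @[h --> 0^'] --> (0 : R).
  by apply: DeriveDef; [apply/cvg_ex; exists 0|exact/cvg_lim].
rewrite f0; apply/cvgr0Pnorm_lt => e e0.
have eC : 0 < e / (C + 1) by rewrite divr_gt0// ltr_wpDl.
near=> h.
have h0 : h != 0 by near: h; exact: nbhs_dnbhs_neq.
rewrite /= subr0 normrM normfV ltr_pdivrMl ?normr_gt0//.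
apply: le_lt_trans (fC _) _; rewrite addrK [h *: 1]mulr1 -real_normK ?num_real//.
rewrite expr2 mulrA [ltRHS]mulrC ltr_pM2r ?normr_gt0//.
apply: (@le_lt_trans _ _ ((C + 1) * `|h|)); first by rewrite ler_wpM2r// lerDl.
rewrite mulrC -ltr_pdivlMr ?ltr_wpDl//.
by near: h; exact: dnbhs0_lt.
Unshelve. all: by end_near. Qed.

Lemma is_derive_bump1 q m t : is_derive t 1 (bump1 q m) (bump1 (bump1_dpoly q m) m.+2 t).
Proof.
have [t1|t1|t1] := ltgtP `|t| 1.
- have y0 := onem_sqr_gt0 t1.
  have -> : bump1 (bump1_dpoly q m) m.+2 t =
    (q^`().[t] + q.[t] * (m%:R * (1 - t ^+ 2)^-1 - (1 - t ^+ 2)^-1 ^+ 2) * (2 * t))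
      * ((1 - t ^+ 2)^-1 ^+ m * expR (- (1 - t ^+ 2)^-1)).
    rewrite /bump1 t1 /bump1_dpoly !(hornerD, hornerN, hornerM, hornerMn, hornerZ,
      horner_exp, hornerX, hornerC).
    have := y0; set y := 1 - t ^+ 2; move=> /lt0r_neq0 yn.
    rewrite -[m.+2]/(2 + m)%N exprD; set e := expR _; set z := y^-1 ^+ m.
    by field.
  (* Near [t] the function is a polynomial times [G] composed with [1 / P], to which the calculus
     rules apply. *)
  pose P : {poly R} := 1 - 'X^2.
  have PE x : P.[x] = 1 - x ^+ 2 by rewrite /P !hornerE.
  pose G (y : R) := y ^+ m * expR (- y).
  pose iv (x : R) := P.[x]^-1.
  have dG (y : R) : is_derive y (1 : R) G ((m%:R * y ^+ m.-1 - y ^+ m) * expR (- y)).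
    have -> : G = id ^+ m * (expR \o -%R).
      by apply/funext => x; rewrite /G mulrfctE/= exprfctE.
    apply: is_derive_eq; rewrite exprfctE/= /GRing.scale/=; ring.
  apply: (@near_eq_is_derive _ _ _ (horner q * (G \o iv))).
    near=> x; rewrite /bump1 (_ : `|x| < 1).
      by rewrite mulrfctE/= /G /iv PE mulrA.
    rewrite -(subKr t x) (le_lt_trans (ler_normB _ _))// -ltrBrDl.
    by near: x; apply: (nbhsx_ballx t (1 - `|t|)); rewrite subr_gt0.
  have Pn : P.[t] != 0 by rewrite PE gt_eqF.
  have dP := is_derive_poly P t.
  have dV := is_deriveV Pn dP.
  apply: is_derive_eq.
  rewrite /G /iv/= PE /GRing.scale/=.
  have -> : P^`().[t] = - (2 * t).
    by rewrite /P derivB derivXn -[1]/(1%:P) derivC !hornerE/= ; ring.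
  have := y0; set y := 1 - t ^+ 2; move=> /lt0r_neq0 yn.
  clearbody P; clear dG G iv dP dV Pn PE P; case: m => [|m'] /=.
    by rewrite !expr0; field.
  rewrite exprSr; set z := y^-1 ^+ m'; set e := expR _.
  by field.
- apply: (@near_eq_is_derive _ _ _ (cst 0)).
    near=> x; rewrite /bump1 ltNge ltW//.
    have : `|t| - `|t - x| <= `|x|.
      by rewrite lerBlDl -{1}(subrK x t) ler_normD.
    apply: lt_le_trans; rewrite ltrBrDl -ltrBrDr.
    by near: x; apply: (nbhsx_ballx t (`|t| - 1)); rewrite subr_gt0.
  rewrite /bump1 ltNge (ltW t1)/=; exact: is_derive_cst.
- rewrite {2}/bump1 t1 ltxx.
  have [C C0 qC] := bump1_le q m 2.
  (* Since [|t| = 1], [1 - |x| <= |x - t|]; the 4 is the square of the bound 2 for the other factor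
     of [1 - x^2 = (1 - |x|) (1 + |x|)]. *)
  apply: (@is_derive0_sqr _ _ (C * 4)) => x.
  have [x1|x1] := ltP `|x| 1; last first.
    by rewrite /bump1 ltNge x1/= normr0 mulr_ge0 ?sqr_ge0// mulr_ge0.
  apply: le_trans (qC x x1) _; rewrite -mulrA ler_wpM2l//.
  have xt : 0 <= 1 - `|x| <= `|x - t|.
    by rewrite subr_ge0 ltW//= -t1 -(distrC t) lerB_dist.
  have -> : 1 - x ^+ 2 = (1 - `|x|) * (1 + `|x|).
    by rewrite -[x ^+ 2]real_normK ?num_real//; ring.
  rewrite exprMn [leRHS]mulrC; apply: ler_pM; rewrite ?sqr_ge0//.
    by rewrite -[leRHS]real_normK ?num_real// lerXn2r ?nnegrE//; case/andP: xt.
  have -> : 4 = 2 ^+ 2 :> R by rewrite expr2; ring.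
  by rewrite lerXn2r ?nnegrE// ?addr_ge0//; lra.
Unshelve. all: by end_near. Qed.

End bump1.

Section tensor_smooth.
Context {R : realType} {n : nat}.
Local Notation V := 'rV[R]_n.
Implicit Types (B : 'I_n -> nat -> R -> R) (g : 'I_n -> nat).

(** [B i k] plays the role of the k-th derivative of the i-th factor and [g] that of a multi-index
    of differentiation orders. *)
Definition tensor B g (x : V) : R := \prod_i B i (g i) (x ord0 i).

Definition incr g (i : 'I_n) : 'I_n -> nat := fun j => (g j + (j == i))%N.

Lemma is_derive_tensor B g (x : V) i :
  (forall i k (t : R), is_derive t (1 : R) (B i k) (B i k.+1 t)) ->
  is_derive x (delta_mx ord0 i) (tensor B g) (tensor B (incr g i) x).
Proof.
move=> dB; have [dBi dBiE] := dB i (g i) (x ord0 i).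
pose c := \prod_(j | j != i) B j (g j) (x ord0 j).
have -> : tensor B (incr g i) x = c * B i (g i).+1 (x ord0 i).
  rewrite /tensor (bigD1 i)//= mulrC /incr eqxx addn1; congr (_ * _).
  by apply: eq_bigr => j /negPf ->; rewrite addn0.
have E : (fun h : R => h^-1 *: ((tensor B g \o shift x) (h *: delta_mx ord0 i) - tensor B g x)) =
    (fun h => c * (h^-1 *: ((B i (g i) \o shift (x ord0 i)) (h *: 1) - B i (g i) (x ord0 i)))).
  apply/funext => h; rewrite /= /tensor (bigD1 i)//= [in X in _ *: (_ - X)](bigD1 i)//=.
  have co j : (h *: delta_mx ord0 i + x) ord0 j = h * (j == i)%:R + x ord0 j.
    by rewrite !mxE eqxx.
  rewrite co eqxx mulr1 [h *: 1]mulr1.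
  rewrite [in X in _ * X - _](eq_bigr (fun j => B j (g j) (x ord0 j))); last first.
    by move=> j /negPf ji; rewrite co ji mulr0 add0r.
  by rewrite -/c /GRing.scale/=; ring.
have H : (h^-1 *: ((tensor B g \o shift x) (h *: delta_mx ord0 i) - tensor B g x))
    @[h --> 0^'] --> c * B i (g i).+1 (x ord0 i).
  by rewrite E; apply: cvgMl_tmp; rewrite -dBiE.
by apply: DeriveDef; [apply/cvg_ex; eexists; exact: H|exact/cvg_lim].
Qed.

Lemma continuous_tensor B g : (forall i, continuous (B i (g i))) ->
  continuous (tensor B g).
Proof.
move=> cB x; rewrite /tensor.
elim: (index_enum _) => [|i s IH].
  by under eq_fun do rewrite big_nil; exact: cst_continuous.
under eq_fun do rewrite big_cons; apply: continuousM => //.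
by apply: continuous_comp; [exact: coord_continuous|exact: cB].
Qed.

(** Each partial derivative only raises one entry of the multi-index, so every iterated partial is
    again a tensor, hence continuous and differentiable along the axes. *)
Lemma smooth_tensor B g :
  (forall i k (t : R), is_derive t (1 : R) (B i k) (B i k.+1 t)) -> smooth (tensor B g).
Proof.
move=> dB l; have [g' ->] : exists g', partials l (tensor B g) = tensor B g'.
  elim: l => [|i l [g' IH]] /=; first by exists g.
  exists (incr g' i); rewrite IH; apply/funext => x.
  by have [_ ->] := is_derive_tensor g' x i dB.
split; last by move=> i x; have [] := is_derive_tensor g' x i dB.
apply: continuous_tensor => i t.
have [d _] := dB i (g' i) t.
exact/differentiable_continuous/derivable1_diffP.
Qed.

End tensor_smooth.

Section bump.
Context {R : realType}.

(** Polynomial and pole order of the k-th derivative of exp(-1 / (1 - t^2)). *)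
Fixpoint bump1_data (k : nat) : {poly R} * nat :=
  if k is k'.+1 then let qm := bump1_data k' in (bump1_dpoly qm.1 qm.2, qm.2.+2)
  else (1, 0%N).

Definition bump1n k : R -> R := bump1 (bump1_data k).1 (bump1_data k).2.

Lemma is_derive_bump1n k (t : R) : is_derive t (1 : R) (bump1n k) (bump1n k.+1 t).
Proof. exact: is_derive_bump1. Qed.

Lemma bump1nE (t : R) :
  bump1n 0 t = if `|t| < 1 then expR (- (1 - t ^+ 2)^-1) else 0.
Proof. by rewrite /bump1n /bump1/=; case: ifP => // _; rewrite hornerC !mul1r. Qed.

Lemma bump1n_gt0 (t : R) : `|t| < 1 -> 0 < bump1n 0 t.
Proof. by move=> t1; rewrite bump1nE t1 expR_gt0. Qed.

Lemma bump1n_eq0 (t : R) : 1 <= `|t| -> bump1n 0 t = 0.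
Proof. by move=> t1; rewrite bump1nE ltNge t1. Qed.

Lemma bump1n_ge0 (t : R) : 0 <= bump1n 0 t.
Proof. by rewrite bump1nE; case: ifP => // _; rewrite expR_ge0. Qed.

Lemma bump1n_le1 (t : R) : bump1n 0 t <= 1.
Proof.
rewrite bump1nE; case: ifPn => // t1; rewrite -[leRHS]expR0 ler_expR oppr_le0 invr_ge0.
by rewrite ltW// onem_sqr_gt0.
Qed.

Lemma bump1nN (t : R) : bump1n 0 (- t) = bump1n 0 t.
Proof. by rewrite !bump1nE normrN sqrrN. Qed.

Lemma bump1n_lipschitz : exists2 L : R, 0 <= L &
  forall t t', `|bump1n 0 t - bump1n 0 t'| <= L * `|t - t'|.
Proof.
have [C C0 HC] := bump1_le (bump1_data 1).1 (bump1_data 1).2 0.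
exists C => //.
have H t : `|bump1n 1 t| <= C.
  have [t1|t1] := ltP `|t| 1; first by have := HC _ t1; rewrite expr0 mulr1.
  by rewrite /bump1n /bump1 ltNge t1/= normr0.
move=> t t'; wlog tt : t t' / t < t'.
  move=> W; have [tt|tt|->] := ltgtP t t'; first exact: W.
    by rewrite distrC (distrC t); exact: W.
  by rewrite !subrr normr0 mulr0.
have := @MVT R (bump1n 0) (bump1n 1) t t' tt.
case=> [x _||c _ cE]; first exact: is_derive_bump1n.
  apply: continuous_subspaceT => x.
  have [d _] := is_derive_bump1n 0 x.
  exact/differentiable_continuous/derivable1_diffP.
by rewrite distrC cE normrM (distrC t) ler_wpM2r.
Qed.

Context {n : nat}.
Local Notation V := 'rV[R]_n.
Implicit Types (e : R) (c x : V).

(** A product, so that it lives on a sup-norm cube. It is not normalized to unit mass, since only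
    the sign of averages against it is used. *)
Definition bump e x : R := \prod_i bump1n 0 (x ord0 i / e).

Lemma bump_ge0 e x : 0 <= bump e x.
Proof. by apply: prodr_ge0 => i _; exact: bump1n_ge0. Qed.

Lemma bump_le1 e x : bump e x <= 1.
Proof. by apply: prodr_ile1 => i _; rewrite bump1n_ge0 bump1n_le1. Qed.

Lemma bump_gt0 e x : `|x| < e -> 0 < bump e x.
Proof.
move=> xe; have e0 : 0 < e by exact: le_lt_trans xe.
apply: prodr_gt0 => i _; apply: bump1n_gt0.
rewrite normrM normfV (gtr0_norm e0) ltr_pdivrMr// mul1r.
exact: le_lt_trans (coord_norm_le _ _) xe.
Qed.

Lemma bump_eq0 e x : 0 < e -> e < `|x| -> bump e x = 0.
Proof.
move=> e0; rewrite ltNge; apply: contraNeq => b0.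
apply/(ler_norm_rVP _ (ltW e0)) => i; rewrite leNgt; apply: contraNN b0 => xi.
rewrite /bump (bigD1 i)//= bump1n_eq0 ?mul0r//.
by rewrite normrM normfV (gtr0_norm e0) ler_pdivlMr// mul1r ltW.
Qed.

Lemma bumpN e x : bump e (- x) = bump e x.
Proof. by apply: eq_bigr => i _; rewrite mxE mulNr bump1nN. Qed.

Lemma prod_lipschitz (I : Type) (s : seq I) (a b : I -> R) :
  (forall i, 0 <= a i <= 1) -> (forall i, 0 <= b i <= 1) ->
  `|\prod_(i <- s) a i - \prod_(i <- s) b i| <= \sum_(i <- s) `|a i - b i|.
Proof.
move=> a01 b01; elim: s => [|i s IH]; first by rewrite !big_nil subrr normr0.
rewrite !big_cons.
have -> : a i * \prod_(j <- s) a j - b i * \prod_(j <- s) b j =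
  (a i - b i) * \prod_(j <- s) a j + b i * (\prod_(j <- s) a j - \prod_(j <- s) b j).
  by ring.
apply: le_trans (ler_normD _ _) _; rewrite !normrM; apply: lerD.
  rewrite ler_piMr// ger0_norm ?prodr_ge0 ?prodr_ile1// => j _.
  by case/andP: (a01 j).
apply: le_trans IH; rewrite ler_piMl//.
by case/andP: (b01 i) => ? ?; rewrite ger0_norm.
Qed.

(** The quotient by 1 is the form required by [lipschitz_energy_le] at scale 1; the bump thereby has
    finite energy. *)
Lemma bump_lipschitz e : 0 < e -> exists2 A : R, 0 <= A & forall x y,
  `|bump e x - bump e y| <= A * Num.min 1 (`|x - y| / 1).
Proof.
move=> e0; have [L L0 HL] := bump1n_lipschitz.
exists (1 + n%:R * (L / e)); first by rewrite addr_ge0// !mulr_ge0// invr_ge0 ltW.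
move=> x y; rewrite divr1 minr_pMr//; last by rewrite addr_ge0// !mulr_ge0// invr_ge0 ltW.
rewrite le_min; apply/andP; split.
  apply: (@le_trans _ _ 1); last by rewrite mulr1 lerDl !mulr_ge0// invr_ge0 ltW.
  have := bump_ge0 e x; have := bump_ge0 e y; have := bump_le1 e x; have := bump_le1 e y.
  by move=> *; rewrite ler_norml; apply/andP; split; lra.
apply: le_trans (prod_lipschitz _ _ _) _ => [i|i|].
- by rewrite bump1n_ge0 bump1n_le1.
- by rewrite bump1n_ge0 bump1n_le1.
- apply: (@le_trans _ _ (\sum_(i < n) (L / e) * `|x - y|)).
    apply: ler_sum => i _; apply: le_trans (HL _ _) _.
    rewrite -mulrBl normrM normfV (gtr0_norm e0) -mulrA (mulrC e^-1) ler_wpM2l//.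
    rewrite ler_wpM2r ?invr_ge0 ?(ltW e0)//.
    by have := coord_norm_le (x - y) i; rewrite !mxE.
  rewrite sumr_const card_ord -[leLHS]mulr_natl mulrA ler_wpM2r//.
  by rewrite lerDr.
Qed.

Lemma measurable_bump e : measurable_fun [set: V] (bump e).
Proof.
rewrite /bump; elim: (index_enum _) => [|i s IH].
  by under eq_fun do rewrite big_nil; exact: measurable_cst.
under eq_fun do rewrite big_cons; apply: measurable_funM => //.
apply: measurableT_comp.
  apply: continuous_measurable_fun => t.
  have [d _] := is_derive_bump1n 0 t.
  exact/differentiable_continuous/derivable1_diffP.
by apply: measurable_funM; [exact: measurable_coord_rV|exact: measurable_cst].
Qed.

Lemma bump_Cc_infty e c (U : set V) : 0 < e -> [set x | `|x - c| <= e] `<=` U ->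
  Cc_infty U (fun x => bump e (x - c)).
Proof.
move=> e0 cU.
have sub : tsupport (fun x => bump e (x - c)) `<=` [set x | `|x - c| <= e].
  have cl : closed [set x : V | `|x - c| <= e].
    rewrite (_ : [set x | _] = closed_ball c e); first exact: closed_ball_closed.
    by rewrite closed_ballE//; apply/seteqP; split => x; rewrite /closed_ball_/= distrC.
  rewrite [X in _ `<=` X](closure_id _).1//; apply: closure_subset => x /=.
  by apply: contraNT; rewrite -ltNge => /(bump_eq0 e0) ->.
split; last exact: subset_trans sub cU.
  (* The power of [e^-1] is the chain rule applied k times. *)
  pose B (i : 'I_n) k (t : R) := e^-1 ^+ k * bump1n k ((t - c ord0 i) / e).
  rewrite (_ : (fun x => _) = tensor B (fun=> 0)); last first.
    apply/funext => x; apply: eq_bigr => i _.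
    by rewrite /B expr0 mul1r !mxE.
  apply: smooth_tensor => i k t.
  have db := is_derive_bump1n k ((t - c ord0 i) / e).
  have da : is_derive t (1 : R) (fun y : R => (y - c ord0 i) / e) e^-1.
    have -> : (fun y : R => (y - c ord0 i) / e) = e^-1 *: (id - cst (c ord0 i)).
      by apply/funext => y; rewrite /= mulrC.
    by apply: is_derive_eq; rewrite subr0 /GRing.scale/= mulr1.
  have dc := @is_derive1_comp R (bump1n k) (fun y : R => (y - c ord0 i) / e) t _ _ db da.
  rewrite (_ : B i k = e^-1 ^+ k *: (bump1n k \o (fun y : R => (y - c ord0 i) / e)))//.
  by apply: is_derive_eq; rewrite /B /GRing.scale/= exprSr; ring.
apply: bounded_closed_compact; last exact: closed_closure.
exists (`|c| + e); split; first by rewrite num_real.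
move=> M Mc x /sub/= xe; apply: le_trans (ltW Mc).
by rewrite -lerBlDl (le_trans _ xe)// lerB_dist.
Qed.

End bump.

(** * Pointwise inequalities *)

Lemma Psi_norm (R : realType) (p t : R) : 1 < p -> `|Psi p t| = `|t| `^ (p - 1).
Proof.
move=> p1; rewrite /Psi normrM (ger0_norm (powR_ge0 _ _)) mulrC.
have -> : p - 2 = p - 1 - 1 by ring.
by rewrite mulr_powRB1// subr_gt0.
Qed.

Lemma powR_young_max (R : realType) (p d t : R) : 1 < p -> 0 <= d -> 0 <= t ->
  d `^ (p - 1) * t <= d `^ p + t `^ p.
Proof.
move=> p1 d0 t0; have p0 : 0 < p by rewrite (lt_trans _ p1).
have p10 : 0 < p - 1 by rewrite subr_gt0.
have [td|dt] := leP t d.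
  apply: (@le_trans _ _ (d `^ p)); last by rewrite lerDl powR_ge0.
  by rewrite -(mulr_powRB1 d0 p0) mulrC ler_wpM2r ?powR_ge0.
apply: (@le_trans _ _ (t `^ p)); last by rewrite lerDr powR_ge0.
rewrite -(mulr_powRB1 t0 p0) mulrC ler_wpM2l//.
by apply: ge0_ler_powR; rewrite ?nnegrE ?(ltW p10)// ltW.
Qed.

(** For non-negative numbers the distance is at most the larger one, so no convexity constant
    appears and exponents below 1 are allowed, as needed for [p - 1] when p < 2. *)
Lemma powR_dist_le (R : realType) (q x y : R) : 0 <= q -> 0 <= x -> 0 <= y ->
  `|x - y| `^ q <= x `^ q + y `^ q.
Proof.
move=> q0 x0 y0; have [xy|yx] := leP x y.
  apply: (@le_trans _ _ (y `^ q)); last by rewrite lerDr powR_ge0.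
  apply: ge0_ler_powR; rewrite ?nnegrE//.
  by rewrite distrC ger0_norm ?subr_ge0// gerBl.
apply: (@le_trans _ _ (x `^ q)); last by rewrite lerDl powR_ge0.
apply: ge0_ler_powR; rewrite ?nnegrE//.
by rewrite ger0_norm ?subr_ge0 ?gerBl// ltW.
Qed.

Lemma powR_add_le (R : realType) (p x y : R) : 0 < p -> 0 <= x -> 0 <= y ->
  (x + y) `^ p <= 2 `^ p * (x `^ p + y `^ p).
Proof.
move=> p0 x0 y0; wlog xy : x y x0 y0 / x <= y.
  move=> W; have [xy|yx] := leP x y; first exact: W.
  by rewrite addrC [X in _ * X]addrC; apply: W => //; rewrite ltW.
apply: (@le_trans _ _ ((2 * y) `^ p)).
  apply: ge0_ler_powR; rewrite ?nnegrE ?(ltW p0) ?addr_ge0 ?mulr_ge0//; lra.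
by rewrite powRM// ler_wpM2l ?powR_ge0// lerDr powR_ge0.
Qed.

Section integrable_bound.
Context d (T : measurableType d) (R : realType) (mu : {measure set T -> \bar R}).

Lemma integrable_le_EFin (f g : T -> R) :
  measurable_fun [set: T] f -> measurable_fun [set: T] g ->
  (forall x, `|f x| <= g x) -> (\int[mu]_x (g x)%:E < +oo)%E ->
  mu.-integrable [set: T] (EFin \o f).
Proof.
move=> mf mg fg goo; apply/integrableP; split; first exact/measurable_EFinP.
apply: le_lt_trans goo.
apply: (@ge0_le_integral_EFin _ _ _ mu (fun x => `|f x|) g) => //.
exact: measurableT_comp.
Qed.

End integrable_bound.

Section pointwise.
Context {R : realType}.
Implicit Types (p d t x y A : R).

Lemma Psi_ge0E p d : 1 < p -> 0 <= d -> Psi p d = d `^ (p - 1).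
Proof.
move=> p1 d0; rewrite -[in RHS](ger0_norm d0) -Psi_norm// ger0_norm//.
by rewrite mulr_ge0// powR_ge0.
Qed.

Lemma PsiN p d : Psi p (- d) = - Psi p d.
Proof. by rewrite /Psi normrN mulrN. Qed.

Lemma Psi_mul p d : 1 < p -> Psi p d * d = `|d| `^ p.
Proof.
move=> p1; have [d0|d0] := leP 0 d.
  by rewrite Psi_ge0E// ger0_norm// mulrC mulr_powRB1// (lt_trans _ p1).
rewrite -[d]opprK PsiN mulrNN normrN Psi_ge0E// ?oppr_ge0 ?(ltW d0)//.
by rewrite ger0_norm ?oppr_ge0 ?(ltW d0)// mulrC mulr_powRB1 ?oppr_ge0 ?(ltW d0)// (lt_trans _ p1).
Qed.

(** Here [Psi p d * (t - d)] equals [Psi p d * t - |d|^p]. If [2|t| <= |d|], the cross term and the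
    coercive term each take at most half of [|d|^p]. Otherwise the cross term is at most
    [2^p |t|^p], and [|t - d| <= 4|t|] gives the other constant. *)
Lemma Psi_sub_le p d t : 1 < p ->
  Psi p d * (t - d) + (2 * 2 `^ p)^-1 * `|t - d| `^ p <= (2 `^ p + 4 `^ p) * `|t| `^ p.
Proof.
move=> p1; have p0 : 0 < p by rewrite (lt_trans _ p1).
have P2 : 0 < (2 : R) `^ p by rewrite powR_gt0.
have d0 := normr_ge0 d; have t0 := normr_ge0 t.
have Pt : Psi p d * t <= `|d| `^ (p - 1) * `|t|.
  by rewrite (le_trans (ler_norm _))// normrM Psi_norm.
rewrite mulrBr Psi_mul//.
have [td|dt] := leP (2 * `|t|) `|d|.
  have H1 : `|d| `^ (p - 1) * `|t| <= `|d| `^ p / 2.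
    rewrite -(mulr_powRB1 d0 p0) mulrAC mulrC ler_wpM2r ?powR_ge0//; lra.
  have H2 : `|t - d| `^ p <= 2 `^ p * `|d| `^ p.
    rewrite -powRM//; apply: ge0_ler_powR; rewrite ?nnegrE ?mulr_ge0 ?(ltW p0)//.
    by rewrite (le_trans (ler_normB _ _))//; lra.
  have H3 : (2 * 2 `^ p)^-1 * `|t - d| `^ p <= `|d| `^ p / 2.
    rewrite ler_pdivrMl ?mulr_gt0// (le_trans H2)// le_eqVlt; apply/orP; left; apply/eqP.
    by field.
  have H4 : 0 <= (2 `^ p + 4 `^ p) * `|t| `^ p by rewrite mulr_ge0 ?addr_ge0 ?powR_ge0.
  lra.
have H1 : `|d| `^ (p - 1) * `|t| <= 2 `^ p * `|t| `^ p.
  apply: (@le_trans _ _ ((2 * `|t|) `^ (p - 1) * (2 * `|t|))).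
    apply: ler_pM; rewrite ?powR_ge0//; last lra.
    by apply: ge0_ler_powR; rewrite ?nnegrE ?subr_ge0 ?mulr_ge0 ?(ltW p1) ?(ltW dt).
  by rewrite mulrC mulr_powRB1 ?mulr_ge0// powRM.
have H2 : `|t - d| `^ p <= 4 `^ p * `|t| `^ p.
  rewrite -powRM//; apply: ge0_ler_powR; rewrite ?nnegrE ?mulr_ge0 ?(ltW p0)//.
  by rewrite (le_trans (ler_normB _ _))//; lra.
have H3 : (2 * 2 `^ p)^-1 * `|t - d| `^ p <= `|t - d| `^ p.
  rewrite ler_piMl ?powR_ge0// invf_le1 ?mulr_gt0//.
  have : 1 <= (2 : R) `^ p by rewrite -[leLHS](powRr0 2) ler_powR ?ler1n// ltW.
  by move=> ?; lra.
have H4 : 0 <= `|d| `^ p by exact: powR_ge0.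
lra.
Qed.

Lemma max0_sub_theta x y : exists2 th : R, 0 <= th <= 1 &
  Num.max 0 x - Num.max 0 y = th * (x - y).
Proof.
have [->|xy] := eqVneq x y.
  by exists 0; rewrite ?lexx ?ler01// !subrr mulr0.
exists ((Num.max 0 x - Num.max 0 y) / (x - y)); last by rewrite divfK// subr_eq0.
wlog lxy : x y xy / x < y.
  move=> W; have [lxy|lyx|e] := ltgtP x y; first exact: W.
    rewrite -(opprB y x) invrN mulrN -mulNr opprB; apply: W => //; by rewrite eq_sym.
  by rewrite e eqxx in xy.
have yx : 0 < y - x by rewrite subr_gt0.
rewrite -(opprB y x) invrN mulrN -mulNr opprB ler_pdivlMr// ler_pdivrMr// mul0r mul1r.
by case: (leP 0 y) => ?; case: (leP 0 x) => ?; apply/andP; split; lra.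
Qed.

(** Taking positive parts multiplies the difference by some [th] in [0, 1]. As [th^p <= th], the
    previous inequality with [t = g1 - g2] and [d = x - y], multiplied by [th], survives the
    truncation. *)
Lemma Psi_truncation_energy p x y (g1 g2 : R) : 1 < p ->
  Psi p (x - y) * (Num.max 0 (g1 - x) - Num.max 0 (g2 - y)) +
    (2 * 2 `^ p)^-1 * `|Num.max 0 (g1 - x) - Num.max 0 (g2 - y)| `^ p
  <= (2 `^ p + 4 `^ p) * `|g1 - g2| `^ p.
Proof.
move=> p1; have p0 : 0 < p by rewrite (lt_trans _ p1).
have [th /andP[th0 th1] ->] := max0_sub_theta (g1 - x) (g2 - y).
have -> : g1 - x - (g2 - y) = (g1 - g2) - (x - y) by ring.
set t := g1 - g2; set d := x - y.
have c0 : 0 <= (2 * 2 `^ p : R)^-1 by rewrite invr_ge0 mulr_ge0// powR_ge0.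
have H := Psi_sub_le d t p1.
have thp : th `^ p <= th.
  move: th0; rewrite le_eqVlt => /orP[/eqP<-|th0]; first by rewrite powR0// gt_eqF.
  by apply: ge1r_powR; rewrite ?th0// ltW.
rewrite normrM (ger0_norm th0) powRM//.
apply: (@le_trans _ _ (th * (Psi p d * (t - d) + (2 * 2 `^ p)^-1 * `|t - d| `^ p))).
  rewrite [leRHS]mulrDr; apply: lerD; first by rewrite mulrCA.
  by rewrite mulrCA ler_wpM2r// mulr_ge0// powR_ge0.
apply: (le_trans (ler_wpM2l th0 H)).
by rewrite ler_piMl// mulr_ge0 ?addr_ge0 ?powR_ge0.
Qed.

(** The point is to replace the increment of u, which is only locally controlled, by that of (M -
    u)_+. By antisymmetry let [y <= x]. A nonpositive increment [W] only needs [|V| <= x - y]. If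
    [W > 0], then [x < g1 <= M], so [V] is exactly the increment of u, and [W <= |g1 - g2|] gives
    [W <= 2 |g1 - g2| - W]; this is the origin of the 2. *)
Lemma Psi_truncation_le p x y (g1 g2 M : R) : 1 < p -> g1 <= M -> g2 <= M ->
  Psi p (x - y) * (Num.max 0 (g1 - x) - Num.max 0 (g2 - y)) <=
  `|Num.max 0 (M - x) - Num.max 0 (M - y)| `^ (p - 1) *
    (2 * `|g1 - g2| - `|Num.max 0 (g1 - x) - Num.max 0 (g2 - y)|).
Proof.
move=> p1; wlog xy : x y g1 g2 / y <= x.
  move=> W g1M g2M; have [xy|yx] := leP y x; first exact: W.
  rewrite -(opprB y x) PsiN mulNr -mulrN opprB.
  rewrite (distrC g1) (distrC (Num.max 0 (g1 - x))) (distrC (Num.max 0 (M - x))).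
  by apply: W => //; exact: ltW.
move=> g1M g2M; have p10 : 0 <= p - 1 by rewrite subr_ge0 ltW.
rewrite Psi_ge0E ?subr_ge0//.
set W := _ - Num.max 0 (g2 - y); set V := Num.max 0 (M - x) - _.
have Vxy : `|V| <= x - y.
  by rewrite /V; case: (leP 0 (M - x)) => ?; case: (leP 0 (M - y)) => ?;
    rewrite ler_norml; apply/andP; split; lra.
have t0 := normr_ge0 (g1 - g2); have V0 := powR_ge0 `|V| (p - 1).
have [W0|W0] := leP W 0.
  apply: (@le_trans _ _ (- (`|V| `^ (p - 1) * `|W|))).
    rewrite (ler0_norm W0) mulrN opprK ler_wnM2r//.
    by apply: ge0_ler_powR; rewrite ?nnegrE ?subr_ge0 ?(ltW p1).
  have H : 0 <= `|V| `^ (p - 1) * (2 * `|g1 - g2|) by rewrite !mulr_ge0.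
  by rewrite mulrBr; lra.
have g1x : x < g1.
  rewrite ltNge; apply/negP => xg; move: W0; rewrite /W.
  by case: (leP 0 (g1 - x)) => ?; case: (leP 0 (g2 - y)) => ?; lra.
have VE : `|V| = x - y.
  rewrite /V !max_r ?subr_ge0; [|lra|lra].
  by rewrite ler0_norm; lra.
rewrite VE ler_wpM2l ?powR_ge0// (gtr0_norm W0).
have : W <= `|g1 - g2|.
  apply: le_trans (ler_norm _); rewrite /W max_r; last lra.
  by case: (leP 0 (g2 - y)) => ?; lra.
lra.
Qed.

(** Young's inequality with a free weight, obtained by comparing [t] with [A * d]: each side of the
    threshold needs only one of the two terms. *)
Lemma powR_young_scaled p d t A : 1 < p -> 0 < A -> 0 <= d -> 0 <= t ->
  d `^ (p - 1) * t <= A * d `^ p + A `^ (1 - p) * t `^ p.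
Proof.
move=> p1 A0 d0 t0; have p0 : 0 < p by rewrite (lt_trans _ p1).
have [td|dt] := leP t (A * d).
  apply: (@le_trans _ _ (A * d `^ p)); last by rewrite lerDl mulr_ge0 ?powR_ge0.
  by rewrite -(mulr_powRB1 d0 p0) mulrA [leRHS]mulrC ler_wpM2l ?powR_ge0.
apply: (@le_trans _ _ (A `^ (1 - p) * t `^ p)); last first.
  by rewrite lerDr mulr_ge0 ?powR_ge0// ltW.
rewrite -(mulr_powRB1 t0 p0) mulrCA [leLHS]mulrC ler_wpM2l//.
have -> : 1 - p = - (p - 1) by ring.
rewrite powRN -ler_pdivrMl ?invr_gt0 ?powR_gt0// invrK -powRM ?(ltW A0)//.
apply: ge0_ler_powR; rewrite ?nnegrE ?mulr_ge0 ?subr_ge0 ?(ltW A0) ?(ltW p1)//.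
exact: ltW.
Qed.

End pointwise.

(** * Lipschitz cutoffs *)

Section cutoff.
Context {R : realType} {n : nat}.
Local Notation V := 'rV[R]_n.

Lemma clamp_lipschitz (c d : R) :
  `|Num.max 0 (Num.min 1 c) - Num.max 0 (Num.min 1 d)| <= `|c - d|.
Proof.
wlog cd : c d / c <= d.
  move=> W; have [cd|dc] := leP c d; first exact: W.
  by rewrite distrC (distrC c); apply: W; exact: ltW.
rewrite (ler0_norm (x := c - d)) ?subr_le0// ler_norml.
by case: (leP 1 c) => ?; case: (leP 1 d) => ?;
  rewrite ?(max_r ler01); case: (leP 0 c) => ?; case: (leP 0 d) => ?;
  apply/andP; split; lra.
Qed.

(** A tent of scale [k + 1], merely Lipschitz: the truncations built from it are not smooth
    anyway. *)
Definition cutoff (k : nat) (x : V) : R :=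
  Num.max 0 (Num.min 1 (2 - `|x| / k.+1%:R)).

Lemma cutoff_ge0 k x : 0 <= cutoff k x. Proof. by rewrite le_max lexx. Qed.

Lemma cutoff_le1 k x : cutoff k x <= 1.
Proof. by rewrite ge_max ler01 ge_min lexx. Qed.

Lemma cutoff_eq1 k x : `|x| <= k.+1%:R -> cutoff k x = 1.
Proof.
move=> xk; rewrite /cutoff min_l ?max_r//.
by rewrite lerBrDr -lerBrDl ler_pdivrMr// [X in _ <= X](_ : _ = k.+1%:R)//; ring.
Qed.

Lemma cutoff_eq0 k x : 2 * k.+1%:R < `|x| -> cutoff k x = 0.
Proof.
move=> xk; have H : 2 - `|x| / k.+1%:R < 0 by rewrite subr_lt0 ltr_pdivlMr.
by rewrite /cutoff max_l// ge_min (ltW H) orbT.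
Qed.

Lemma measurable_cutoff k : measurable_fun [set: V] (cutoff k).
Proof.
apply: measurable_maxr; first exact: measurable_cst.
apply: measurable_minr; first exact: measurable_cst.
apply: measurable_funB; first exact: measurable_cst.
by apply: measurable_funM; [exact: measurable_norm_rV|exact: measurable_cst].
Qed.

Lemma cutoff_lipschitz k x y :
  `|cutoff k x - cutoff k y| <= Num.min 1 (`|x - y| / k.+1%:R).
Proof.
rewrite le_min; apply/andP; split.
  have := cutoff_ge0 k x; have := cutoff_le1 k x.
  have := cutoff_ge0 k y; have := cutoff_le1 k y.
  by move=> *; rewrite ler_norml; apply/andP; split; lra.
apply: (@le_trans _ _ `|(2 - `|x| / k.+1%:R) - (2 - `|y| / k.+1%:R)|).
  exact: clamp_lipschitz.
have -> : 2 - `|x| / k.+1%:R - (2 - `|y| / k.+1%:R) = (`|y| - `|x|) / k.+1%:R by ring.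
rewrite normrM (ger0_norm (x := k.+1%:R^-1))// ler_wpM2r//.
by rewrite (distrC x) ler_dist_dist.
Qed.

Lemma continuous_cutoff k : continuous (cutoff k).
Proof.
move=> x.
apply: (@continuous_comp _ _ _ (fun x : V => 2 - `|x| / k.+1%:R)
  (fun c => Num.max 0 (Num.min 1 c))).
  apply: continuousB; first exact: cst_continuous.
  by apply: continuousM; [exact: norm_continuous|exact: cst_continuous].
rewrite /continuous_at; apply/cvgrPdist_lt => e e0; near=> d.
apply: le_lt_trans (clamp_lipschitz _ _) _.
by near: d; exact: (nbhsx_ballx (2 - `|x| / k.+1%:R : R) e e0).
Unshelve. all: by end_near. Qed.

End cutoff.

(** * Convergence of integrals and translations *)

(* For a product of sigma-finite measures, the library's instance of
   sigma-finiteness is shadowed by a later one for subprobabilities. *)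
Section lebesgue_rV2.
Context {R : realType} {n : nat}.

Definition lebesgue_rV2 : set ('rV[R]_n * 'rV[R]_n) -> \bar R :=
  (@lebesgue_rV R n \x @lebesgue_rV R n)%E.

HB.instance Definition _ := Measure.on lebesgue_rV2.

Let lebesgue_rV2_sigma_finite : sigma_finite setT lebesgue_rV2.
Proof.
have /sigma_finiteP[F [TF ndF Foo]] := sigma_finiteT (@lebesgue_rV R n).
exists (fun k => F k `*` F k).
  rewrite -setXTT TF predeqE => -[x y]; split.
    move=> [/= [i _ Fix] [k _ Fky]]; exists (maxn i k) => //; split.
    - by move: x Fix; exact/subsetPset/ndF/leq_maxl.
    - by move: y Fky; exact/subsetPset/ndF/leq_maxr.
  by move=> [i _ []/= ? ?]; split; exists i.
move=> k; have [? ?] := Foo k; split; first exact: measurableX.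
by rewrite /lebesgue_rV2 product_measure1E// lte_mul_pinfty// ge0_fin_numE.
Qed.

HB.instance Definition _ := Measure_isSigmaFinite.Build _ _ _
  lebesgue_rV2 lebesgue_rV2_sigma_finite.

End lebesgue_rV2.

Lemma integrable_bounded_support (R : realType) n (M r : R) (g : 'rV[R]_n -> R) : 0 <= M -> 0 < r ->
  measurable_fun [set: 'rV[R]_n] g -> (forall x, `|g x| <= M) ->
  (forall x, r < `|x| -> g x = 0) -> (@lebesgue_rV R n).-integrable [set: 'rV[R]_n] (EFin \o g).
Proof.
move=> M0 r0 mg gM gr.
apply: (@integrable_le_EFin _ _ _ _ g (fun x => M * \1_[set y | `|y| <= r] x)) => //.
- by apply: measurable_funM => //; apply: measurable_indic; exact: measurable_cube.
- move=> x; rewrite indic_cubeE; have [xr|xr] := leP `|x| r; first by rewrite mulr1.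
  by rewrite gr// normr0 mulr0.
- rewrite integral_indicZ//; last exact: measurable_cube.
  by have /= -> := @lebesgue_rV_cube R n r (ltW r0); rewrite -EFinM ltry.
Qed.

Section convergence_lemmas.
Context d (T : measurableType d) (R : realType) (mu : {measure set T -> \bar R}).

Lemma fatou_ae_le (X : nat -> T -> R) (Y : T -> R) (C : \bar R) :
  (forall k, measurable_fun [set: T] (X k)) -> (forall k x, 0 <= X k x) ->
  measurable_fun [set: T] Y -> (forall x, 0 <= Y x) ->
  {ae mu, forall x, X ^~ x @ \oo --> Y x} ->
  (forall k, \int[mu]_x (X k x)%:E <= C)%E -> (\int[mu]_x (Y x)%:E <= C)%E.
Proof.
move=> mX X0 mY Y0 XY XC.
have mE k : measurable_fun [set: T] (EFin \o X k) by exact/measurable_EFinP.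
have := fatou mu measurableT mE (fun k x _ => X0 k x).
rewrite (_ : (\int[mu]_x limn_einf _ = \int[mu]_x (Y x)%:E)%E).
  move=> /le_trans; apply; rewrite limn_einf_lim; apply: lime_le.
    by apply: is_cvg_einfs.
  apply: nearW => k; apply: ereal_inf_le; exists (\int[mu]_x (X k x)%:E)%E => //.
  by exists k => //=.
have einfE x : limn_einf (fun k => (X k x)%:E) = (- limn_esup (fun k => - (X k x)%:E))%E.
  by rewrite -limn_einfN; congr limn_einf; apply/funext => k; exact: (esym (oppeK _)).
apply: ge0_ae_eq_integral => //.
- rewrite (_ : (fun x => _) = (fun x => - limn_esup (fun k => - (X k x)%:E))%E); last first.
    by apply/funext => x; rewrite -einfE.
  apply: measurableT_comp => //; apply: measurable_fun_limn_esup => k.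
  exact: (measurableT_comp (@oppe_measurable R setT) (mE k)).
- exact/measurable_EFinP.
- move=> x _; rewrite limn_einf_lim; apply: lime_ge; first exact: is_cvg_einfs.
  by apply: nearW => k; apply: le_ereal_inf_tmp => _ [m /= _ <-]; rewrite lee_fin.
- by move=> x _; rewrite lee_fin.
- apply: filterS XY => x /= XYx _.
  have H : (fun k => (X k x)%:E) @ \oo --> (Y x)%:E.
    by apply: cvg_EFin; [exact: nearW|exact: XYx].
  rewrite is_cvg_limn_einfE; first exact/cvg_lim.
  by apply/cvg_ex; eexists; exact: H.
Qed.

(** The sum of the functions has a finite integral, hence is finite almost everywhere, and the terms
    of a convergent series tend to 0. The geometric rate avoids extracting a subsequence. *)
Lemma ae_cvg0_of_integral_le (f : nat -> T -> R) :
  (forall k, measurable_fun [set: T] (f k)) -> (forall k x, 0 <= f k x) ->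
  (forall k, \int[mu]_x (f k x)%:E <= (2^-1 ^+ k)%:E)%E ->
  {ae mu, forall x, f ^~ x @ \oo --> (0 : R)}.
Proof.
move=> mf f0 fle.
have mE k : measurable_fun [set: T] (EFin \o f k) by exact/measurable_EFinP.
have fE0 k x : (0 <= (f k x)%:E)%E by rewrite lee_fin.
have S0 x : (0 <= \sum_(k <oo) (f k x)%:E)%E.
  by apply: nneseries_ge0 => k _ _; exact: fE0.
have I : mu.-integrable [set: T] (fun x => \sum_(k <oo) (f k x)%:E)%E.
  apply/integrableP; split.
    by apply: ge0_emeasurable_sum => [k x _ _|k _]; [exact: fE0|exact: mE].
  rewrite (eq_integral (fun x => \sum_(k <oo) (f k x)%:E)%E); last first.
    by move=> x _; rewrite gee0_abs// S0.
  rewrite integral_nneseries//.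
  apply: (@le_lt_trans _ _ (\sum_(k <oo) (1 * 2^-1 ^+ k)%:E)%E).
    apply: lee_nneseries => [k _ _|k _]; first exact: integral_ge0.
    by rewrite mul1r; exact: fle.
  apply: (@le_lt_trans _ _ (1 / (1 - 2^-1))%:E); last exact: ltry.
  by apply: geometric_nneseries_le => //; apply/andP; split; lra.
have := integrable_ae measurableT I; apply: filterS => x /= /(_ Logic.I) xfin.
have := @nneseries_tail_cvg R (fun k => (f k x)%:E) xpredT.
rewrite -ge0_fin_numE ?S0// => /(_ xfin (fun k _ => fE0 k x)) tail0.
have H : (fun k => (f k x)%:E) @ \oo --> (0 : R)%:E.
  apply: (@squeeze_cvge _ _ _ _ (cst 0%E) _
    (fun N => \sum_(N <= k <oo) (f k x)%:E)%E) => //; last exact: cvg_cst.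
  apply: nearW => k; rewrite fE0/=.
  apply: le_trans (@nneseries_lim_ge R (fun k => (f k x)%:E) xpredT k k.+1 _).
    by rewrite big_nat1.
  by move=> i _ _; exact: fE0.
by move/fine_cvgP : H => [_].
Qed.

End convergence_lemmas.

Lemma continuous_norm_powR (R : realType) (p : R) : 0 < p ->
  continuous (fun x : R => `|x| `^ p).
Proof.
move=> p0 x; have [->|x0] := eqVneq x 0.
  rewrite /continuous_at normr0 powR0 ?gt_eqF//; apply/cvgr0Pnorm_lt => e e0.
  near=> y; rewrite ger0_norm ?powR_ge0//.
  have -> : e = (e `^ p^-1) `^ p by rewrite -powRrM mulVf ?gt_eqF// powRr1// ltW.
  apply: gt0_ltr_powR; rewrite ?nnegrE ?powR_ge0//.
  rewrite -normrN -sub0r.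
  by near: y; apply: (nbhsx_ballx (0 : R) (e `^ p^-1)); rewrite powR_gt0.
apply: (@continuous_comp _ _ _ (fun x : R => `|x|) (fun y => y `^ p)).
  exact: norm_continuous.
apply/differentiable_continuous/derivable1_diffP/derivable_powR.
by rewrite in_itv/= andbT normr_gt0.
Unshelve. all: by end_near. Qed.

(** * Translations of upper semicontinuous functions in L^1 *)

Section usc_translation.
Context {R : realType} {n : nat}.
Local Notation V := 'rV[R]_n.
Local Notation leb := (@lebesgue_rV R n).
Local Notation cube r := [set x : V | `|x| <= r].
Variables (M r : R) (w : V -> R).
Hypotheses (M_ge0 : 0 <= M) (r_gt0 : 0 < r) (mw : measurable_fun [set: V] w).
Hypotheses (w_bnd : forall x, 0 <= w x <= M) (w_supp : forall x, r < `|x| -> w x = 0).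
Hypothesis w_usc : forall x c, w x < c -> \forall y \near x, w y < c.

Let mwh (h : V) : measurable_fun [set: V] (fun x => w (x + h)).
Proof. exact: (measurableT_comp mw (measurable_rV_add h)). Qed.

Let w_shift_supp (h : V) : `|h| <= 1 -> forall x, r + 1 < `|x| -> w (x + h) = 0.
Proof.
move=> he x xr; apply: w_supp; rewrite -(opprK h) (lt_le_trans _ (lerB_dist _ _))//.
by rewrite normrN ltrBrDr (le_lt_trans _ xr)// lerD2l.
Qed.

(* Upper semicontinuity gives the positive part of [w (x + h k) - w x] by
   dominated convergence; both functions have the same integral, so the
   negative part follows. *)
Lemma usc_translation_seq (h : nat -> V) : (forall k, `|h k| <= k.+1%:R^-1) ->
  (\int[leb]_x `|w (x + h k) - w x|%:E)%E @[k --> \oo] --> 0%E.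
Proof.
move=> hk.
have h1 k : `|h k| <= 1 by rewrite (le_trans (hk k))// invf_le1// ler1n.
pose g k x := Num.max 0 (w (x + h k) - w x).
have mg k : measurable_fun [set: V] (g k).
  apply: measurable_maxr; first exact: measurable_cst.
  by apply: measurable_funB => //; exact: mwh.
have r10 : 0 < r + 1 by rewrite addr_gt0.
have Iw : leb.-integrable [set: V] (EFin \o w).
  apply: (integrable_bounded_support M_ge0 r_gt0) => // x.
  by case/andP: (w_bnd x) => ? ?; rewrite ger0_norm.
have gM k x : `|g k x| <= M * \1_(cube (r + 1)) x.
  rewrite indic_cubeE /g ger0_norm ?le_max ?lexx//.
  have /andP[? ?] := w_bnd x; have /andP[? ?] := w_bnd (x + h k).
  have [xr|xr] := leP `|x| (r + 1).
    by rewrite mulr1 ge_max M_ge0/=; lra.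
  by rewrite mulr0 w_shift_supp// w_supp ?subrr ?maxxx// (lt_trans _ xr)// ltrDl.
have Ib : leb.-integrable [set: V] (EFin \o (fun x => M * \1_(cube (r + 1)) x)).
  apply: (integrable_bounded_support M_ge0 r10).
  - by apply: measurable_funM => //; apply: measurable_indic; exact: measurable_cube.
  - by move=> x; rewrite indic_cubeE normrM ger0_norm// ler_piMr// ger0_norm// lern1 leq_b1.
  - by move=> x xr; rewrite indic_cubeE leNgt xr mulr0.
have g0 x : (g k x)%:E @[k --> \oo] --> (0 : R)%:E.
  apply: cvg_EFin; first exact: nearW.
  apply/cvgr0Pnorm_lt => e e0.
  have /nbhs_ballP[d /= d0 wd] : \forall y \near x, w y < w x + e.
    by apply: w_usc; rewrite ltrDl.
  have hk0 : \forall k \near \oo, k.+1%:R^-1 < d by exact: near_infty_natSinv_lt (PosNum d0).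
  apply: filterS hk0 => k kd; rewrite /= /g ger0_norm ?le_max ?lexx//.
  rewrite gt_max e0/= ltrBlDl; apply: wd.
  by rewrite -ball_normE/= opprD addNKr normrN (le_lt_trans (hk k)).
have [_ _ Ig] := @dominated_convergence _ _ _ leb setT measurableT
  (fun k x => (g k x)%:E) (fun=> 0%E) _ (fun k => measurableT_comp (@EFin_measurable R setT) (mg k))
  (measurable_cst _) (aeW _ (fun x _ => g0 x)) Ib
  (aeW _ (fun x k _ => gM k x)).
rewrite integral0 in Ig.
have E k : (\int[leb]_x `|w (x + h k) - w x|%:E = 2%:E * \int[leb]_x (g k x)%:E)%E.
  have Wfin : (\int[leb]_x (w x)%:E)%E \is a fin_num by exact: integrable_fin_num.
  have shiftE : (\int[leb]_x (w (x + h k))%:E = \int[leb]_x (w x)%:E)%E.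
    apply: (ge0_integral_rV_shift (h k) (f := fun x => (w x)%:E)).
      exact/measurable_EFinP.
    by move=> x; rewrite lee_fin; case/andP: (w_bnd x).
  have mabs : measurable_fun [set: V] (fun x => `|w (x + h k) - w x|).
    by apply: measurableT_comp => //; apply: measurable_funB => //; exact: mwh.
  have w0 x : 0 <= w x by case/andP: (w_bnd x).
  have gk0 x : 0 <= g k x by rewrite /g le_max lexx.
  (* Adding the finite integral of [w] to both sides, once in translated form, reduces the claim to
     [|a - c| + a = 2 max(0, a - c) + c], with non-negative terms only. *)
  rewrite -[LHS](addeK _ Wfin) -{1}shiftE -ge0_integralD_EFin//.
  rewrite -ge0_integral_cstM// -[RHS](addeK _ Wfin) -ge0_integralD_EFin//; last 2 first.
  - by apply: measurable_funM.
  - by move=> x; rewrite mulr_ge0.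
  congr (_ - _)%E; apply: eq_integral => x _; congr EFin; rewrite /g.
  by case: leP => ?; [rewrite ger0_norm//; lra|rewrite ltr0_norm//; lra].
under eq_fun do rewrite E.
by rewrite -(mule0 2%:E); apply: cvgeZl.
Qed.

Lemma usc_translation (e : R) : 0 < e -> exists2 d : R, 0 < d <= 1 &
  forall h, `|h| <= d -> (\int[leb]_x `|w (x + h) - w x|%:E <= e%:E)%E.
Proof.
move=> e0; apply: contrapT => /forall2NP H.
have /choice[h hP] : forall k : nat, exists h : V, `|h| <= k.+1%:R^-1 /\
    (e%:E < \int[leb]_x `|w (x + h) - w x|%:E)%E.
  move=> k; have k0 : 0 < (k.+1%:R : R)^-1 <= 1.
    by rewrite invr_gt0 ltr0n/= invf_le1// ler1n.
  have [//|/existsNP[h /not_implyP[hk he]]] := H (k.+1%:R)^-1.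
  by exists h; split => //; rewrite ltNge; exact/negP.
have cv := usc_translation_seq (fun k => (hP k).1).
have : (e%:E <= 0)%E.
  rewrite -(cvg_lim _ cv)//; apply: lime_ge; first by apply/cvg_ex; eexists; exact: cv.
  by apply: nearW => k; exact: ltW (hP k).2.
by rewrite leNgt lte_fin e0.
Qed.

End usc_translation.

(** * Supersolutions *)

Section supersolution.
Context {R : realType} {n : nat}.
Local Notation V := 'rV[R]_n.
Local Notation leb := (@lebesgue_rV R n).
Variables (b p : R) (u : V -> R).
Hypotheses (b_gt0 : 0 < b) (b_lt_p : b < p) (p_gt1 : 1 < p).
Hypotheses (u_meas : measurable_fun [set: V] u) (u_ge0 : forall x, 0 <= u x).
Local Notation a := (n%:R + b).
Local Notation cube r := [set x : V | `|x| <= r].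

Hypothesis u_Wloc : forall r, 0 < r ->
  (\int[leb \x leb]_z (\1_(cube r) z.1 * \1_(cube r) z.2 * energy_density p a u z)%:E < +oo)%E.
Hypothesis u_Lloc : forall r, 0 < r ->
  (\int[leb]_x (\1_(cube r) x * u x `^ (p - 1))%:E < +oo)%E.
Hypothesis u_tail : (\int[leb]_x (u x `^ (p - 1) / (1 + enorm x) `^ a)%:E < +oo)%E.

(** The integrand of the weak formulation tested with [f]. *)
Definition flux (f : V -> R) (z : V * V) : R :=
  Psi p (u z.1 - u z.2) * (f z.1 - f z.2) * kern a (z.1 - z.2).

Let a_ge0 : 0 <= a. Proof. by rewrite addr_ge0// ltW. Qed.
Let p_gt0 : 0 < p. Proof. exact: lt_trans b_gt0 b_lt_p. Qed.
Let p1_gt0 : 0 < p - 1. Proof. by rewrite subr_gt0. Qed.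

Let mcube1 r : measurable_fun [set: V] (\1_(cube r) : V -> R).
Proof. by apply: measurable_indic; exact: measurable_cube. Qed.

Let mfst (g : V -> R) : measurable_fun [set: V] g ->
  measurable_fun [set: V * V] (fun z : V * V => g z.1).
Proof. by move=> mg; exact: (measurableT_comp mg measurable_fst). Qed.

Let msnd (g : V -> R) : measurable_fun [set: V] g ->
  measurable_fun [set: V * V] (fun z : V * V => g z.2).
Proof. by move=> mg; exact: (measurableT_comp mg measurable_snd). Qed.

Let mup : measurable_fun [set: V] (fun x => u x `^ (p - 1)).
Proof. exact: (measurableT_comp (measurable_powR _)). Qed.

Lemma measurable_flux f : measurable_fun [set: V] f ->
  measurable_fun [set: V * V] (flux f).
Proof.
move=> mf; apply: measurable_funM; last exact: measurable_kern_pair.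
apply: measurable_funM; last exact: measurable_fun_diff.
rewrite /Psi; apply: measurable_funM; last exact: measurable_fun_diff.
apply: (measurableT_comp (measurable_powR _)); apply: measurableT_comp => //.
exact: measurable_fun_diff.
Qed.

Definition far_kern (x : V) : R := \1_[set x : V | 1 <= `|x|] x * kern a x.

Lemma measurable_far_kern : measurable_fun [set: V] far_kern.
Proof.
apply: measurable_funM; last exact: measurable_kern.
by apply: measurable_indic; exact: measurable_far.
Qed.

Lemma far_kern_ge0 x : 0 <= far_kern x.
Proof. by rewrite mulr_ge0 ?kern_ge0. Qed.

Lemma far_kernN x : far_kern (- x) = far_kern x.
Proof.
rewrite /far_kern kernN !indicE; congr (_%:R * _); congr nat_of_bool.
by apply/idP/idP; rewrite !inE/= normrN.
Qed.

Lemma far_kern_integral : (\int[leb]_x (far_kern x)%:E < +oo)%E.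
Proof.
by apply: le_lt_trans (@kern_far_integral_le R n b 1 b_gt0 ltr01) _; rewrite ltry.
Qed.

(** The gap between the cubes keeps the points at distance at least 1, away from the singularity.
    The exponent is [p - 1] because at infinity only the tail condition is available. *)
Definition far_flux (r : R) (z : V * V) : R :=
  \1_(cube r) z.1 * (1 - \1_(cube (r + 1)) z.2) *
  (`|u z.1 - u z.2| `^ (p - 1) * kern a (z.1 - z.2)).

Lemma far_flux_ge0 r z : 0 <= far_flux r z.
Proof.
by rewrite mulr_ge0// mulr_ge0 ?powR_ge0 ?kern_ge0.
Qed.

Lemma measurable_far_flux r : measurable_fun [set: V * V] (far_flux r).
Proof.
apply: measurable_funM.
  apply: measurable_funM; first exact: mfst.
  by apply: measurable_funB; [exact: measurable_cst|exact: msnd].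
apply: measurable_funM; last exact: measurable_kern_pair.
apply: (measurableT_comp (measurable_powR _)); apply: measurableT_comp => //.
exact: measurable_fun_diff.
Qed.

Lemma far_flux_integral r : 0 < r -> (\int[leb \x leb]_z (far_flux r z)%:E < +oo)%E.
Proof.
(* [K] is chosen so that [1 + enorm y <= K * enorm (x - y)] when [|x| <= r] and [|y| > r + 1]; this
   exchanges the kernel for the tail weight. The factor [n] compares the two norms. *)
move=> r0; pose K : R := 1 + n%:R * (r + 1).
have K0 : 0 < K by rewrite ltr_pwDl// mulr_ge0// addr_ge0// ltW.
pose g x := \1_(cube r) x * u x `^ (p - 1).
pose h x := K `^ a * (u x `^ (p - 1) / (1 + enorm x) `^ a).
have mg : measurable_fun [set: V] g by apply: measurable_funM.
have mh0 : measurable_fun [set: V] (fun x => u x `^ (p - 1) / (1 + enorm x) `^ a).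
  apply: measurable_funM => //.
  rewrite (_ : (fun _ => _) = fun x : V => (1 + enorm x) `^ (- a)); last first.
    by apply/funext => x; rewrite powRN.
  apply: (measurableT_comp (measurable_powR _)).
  by apply: measurable_funD; [exact: measurable_cst|exact: measurable_enorm].
have mh : measurable_fun [set: V] h by apply: measurable_funM.
have g0 x : 0 <= g x by rewrite mulr_ge0 ?powR_ge0.
have h00 x : 0 <= u x `^ (p - 1) / (1 + enorm x) `^ a by rewrite divr_ge0 ?powR_ge0.
have h0 x : 0 <= h x by rewrite mulr_ge0 ?powR_ge0.
have mfk := measurable_far_kern.
apply: (@le_lt_trans _ _ (\int[leb \x leb]_z
    (g z.1 * far_kern (z.1 - z.2) + \1_(cube r) z.1 * h z.2)%:E)%E).
  apply: ge0_le_integral_EFin => //; first exact: measurable_far_flux.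
  - apply: measurable_funD; apply: measurable_funM.
    + exact: mfst.
    + exact: (measurableT_comp mfk measurable_rV_sub_pair).
    + exact: mfst.
    + exact: msnd.
  - by move=> z; exact: far_flux_ge0.
  - move=> -[x y]; rewrite /far_flux /g/= !indicE.
    have [xr|xr] := leP `|x| r; last first.
      by rewrite memNset/= ?mul0r ?addr0// leNgt xr.
    rewrite (@mem_set _ (cube r))//= !mul1r.
    have [yr|yr] := leP `|y| (r + 1).
      rewrite mem_set//= subrr mul0r addr_ge0// mulr_ge0 ?powR_ge0//.
      exact: far_kern_ge0.
    rewrite memNset/= ?subr0 ?mul1r; last by rewrite leNgt yr.
    have xy : `|y| - r <= `|x - y|.
      by rewrite distrC (le_trans _ (lerB_dist _ _))// lerB.
    have xy1 : 1 <= `|x - y| by rewrite (le_trans _ xy)// lerBrDl ltW.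
    have hy : kern a (x - y) <= K `^ a / (1 + enorm y) `^ a.
      rewrite /kern -[leRHS]invrK invfM invrK mulrC.
      have e0 : 0 < enorm (x - y) by rewrite (lt_le_trans _ (norm_le_enorm _))// (lt_le_trans _ xy1).
      have ey : 0 <= enorm y by exact: enorm_ge0.
      rewrite lef_pV2 ?posrE ?powR_gt0//; last first.
        by rewrite divr_gt0// powR_gt0// ltr_pwDl.
      rewrite ler_pdivrMr ?powR_gt0// -powRM ?(ltW e0) ?(ltW K0)//.
      apply: ge0_ler_powR; rewrite ?nnegrE ?addr_ge0 ?mulr_ge0 ?(ltW e0) ?(ltW K0) ?(ltW b_gt0)//.
      apply: le_trans _ (ler_wpM2r (ltW K0) (norm_le_enorm _)).
      apply: le_trans _ (ler_wpM2r (ltW K0) xy).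
      apply: (@le_trans _ _ (1 + n%:R * `|y|)); first by rewrite lerD2l enorm_le_norm.
      rewrite /K mulrDr mulr1 -subr_ge0.
      have -> : `|y| - r + (`|y| - r) * (n%:R * (r + 1)) - (1 + n%:R * `|y|) =
        (`|y| - (r + 1)) * (1 + n%:R * r) by ring.
      by rewrite mulr_ge0// ?subr_ge0 ?(ltW yr)// addr_ge0// mulr_ge0// ltW.
    apply: (@le_trans _ _ ((u x `^ (p - 1) + u y `^ (p - 1)) * kern a (x - y))).
      by rewrite ler_wpM2r ?kern_ge0// powR_dist_le// ltW.
    rewrite mulrDl /far_kern indicE mem_set//= mul1r lerD2l.
    by rewrite /h mulrCA ler_wpM2l ?powR_ge0.
rewrite ge0_integralD_EFin; last 4 first.
- apply: measurable_funM; first exact: mfst.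
  exact: (measurableT_comp mfk measurable_rV_sub_pair).
- by apply: measurable_funM; [exact: mfst|exact: msnd].
- by move=> z; rewrite mulr_ge0 ?far_kern_ge0.
- by move=> z; rewrite mulr_ge0.
rewrite (ge0_integral_conv mg mfk)//; last exact: far_kernN; last exact: far_kern_ge0.
rewrite (ge0_integral_prod (mcube1 r) mh)//.
rewrite lte_add_pinfty//; apply: lte_mul_pinfty.
- by apply: integral_ge0 => x _; rewrite lee_fin.
- rewrite ge0_fin_numE ?u_Lloc//.
  by apply: integral_ge0 => x _; rewrite lee_fin.
- exact: far_kern_integral.
- by apply: integral_ge0 => x _; rewrite lee_fin.
- rewrite integral_indic ?setIT//; last exact: measurable_cube.
  by have /= -> := @lebesgue_rV_cube R n r (ltW r0).
- rewrite ge0_integral_cstM ?powR_ge0//.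
  by rewrite lte_mul_pinfty// lee_fin powR_ge0.
Qed.

Definition near_energy (r : R) (z : V * V) : R :=
  \1_(cube r) z.1 * \1_(cube r) z.2 * energy_density p a u z.

Lemma near_energy_ge0 r z : 0 <= near_energy r z.
Proof. by rewrite mulr_ge0 ?energy_density_ge0. Qed.

Lemma measurable_near_energy r : measurable_fun [set: V * V] (near_energy r).
Proof.
apply: measurable_funM; last exact: measurable_energy_density.
by apply: measurable_funM; [exact: mfst|exact: msnd].
Qed.

(** It depends on the test function only through its bounds [M] and [r], so that a single integrable
    function serves all small translates. *)
Definition flux_bound (M r : R) (z : V * V) : R :=
  near_energy (r + 1) z + M * (far_flux r z + far_flux r (z.2, z.1)).

Lemma flux_bound_ge0 M r z : 0 <= M -> 0 <= flux_bound M r z.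
Proof.
by move=> M0; rewrite addr_ge0 ?near_energy_ge0// mulr_ge0// addr_ge0 ?far_flux_ge0.
Qed.

Let mswap : measurable_fun [set: V * V] (fun z : V * V => (z.2, z.1)).
Proof.
by apply/measurable_fun_pair => /=; [exact: measurable_snd|exact: measurable_fst].
Qed.

Lemma measurable_flux_bound M r : measurable_fun [set: V * V] (flux_bound M r).
Proof.
apply: measurable_funD; first exact: measurable_near_energy.
apply: measurable_funM; first exact: measurable_cst.
exact: (measurable_funD (measurable_far_flux r)
  (measurableT_comp (measurable_far_flux r) mswap)).
Qed.

Lemma flux_bound_integral M r : 0 <= M -> 0 < r ->
  (\int[leb \x leb]_z (flux_bound M r z)%:E < +oo)%E.
Proof.
move=> M0 r0.
have mfs : measurable_fun [set: V * V] (fun z => far_flux r (z.2, z.1)).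
  exact: (measurableT_comp (measurable_far_flux r) mswap).
have mf := measurable_far_flux r.
rewrite ge0_integralD_EFin.
- rewrite lte_add_pinfty//; first by apply: u_Wloc; rewrite addr_gt0.
  rewrite ge0_integral_cstM//.
  + rewrite lte_mul_pinfty ?lee_fin//.
    have ff0 z : 0 <= far_flux r z by exact: far_flux_ge0.
    have ffs0 z : 0 <= far_flux r (z.2, z.1) by exact: far_flux_ge0.
    rewrite (ge0_integralD_EFin _ mf mfs ff0 ffs0).
    rewrite [X in (_ + X)%E](ge0_integral_swap mf ff0).
    by apply: lte_add_pinfty; exact: far_flux_integral.
  + exact: (measurable_funD mf mfs).
  + by move=> z; rewrite addr_ge0// far_flux_ge0.
- exact: measurable_near_energy.
- exact: (measurable_funM (measurable_cst M) (measurable_funD mf mfs)).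
- exact: near_energy_ge0.
- by move=> z; rewrite mulr_ge0// addr_ge0// far_flux_ge0.
Qed.

(** If one point is in the cube of radius [r] and the other in that of radius [r + 1], Young's
    inequality separates u from [f]. If the other is farther, [f] varies by at most [M]. If both are
    outside the first cube, the flux vanishes. *)
Lemma flux_le_bound M r f z : 0 <= M -> (forall x, 0 <= f x <= M) ->
  (forall x, r < `|x| -> f x = 0) ->
  `|flux f z| <= flux_bound M r z + energy_density p a f z.
Proof.
move=> M0 fM fr; case: z => x y.
rewrite /flux/= 2!normrM Psi_norm// (ger0_norm (kern_ge0 _ _)).
rewrite /flux_bound /near_energy /far_flux /energy_density/= !indic_cubeE.
rewrite -(distrC (u x)) -(kernN _ (y - x)) opprB.
set d := `|u x - u y|; set k := kern a (x - y).
have fn : `|f x - f y| <= M.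
  have /andP[x0 xM] := fM x; have /andP[y0 yM] := fM y.
  by rewrite ler_norml; apply/andP; split; lra.
set w := `|f x - f y| in fn *.
pose X : R := (`|x| <= r)%R%:R; pose Y : R := (`|y| <= r)%R%:R.
pose X1 : R := (`|x| <= r + 1)%R%:R; pose Y1 : R := (`|y| <= r + 1)%R%:R.
suff key : d `^ (p - 1) * w <=
    X1 * Y1 * d `^ p + M * (X * (1 - Y1) + Y * (1 - X1)) * d `^ (p - 1) + w `^ p.
  apply: le_trans (ler_wpM2r (kern_ge0 _ _ : 0 <= k) key) _.
  by rewrite -/X -/Y -/X1 -/Y1 le_eqVlt; apply/orP; left; apply/eqP; ring.
have D0 : 0 <= d `^ (p - 1) by exact: powR_ge0.
have dp0 : 0 <= d `^ p by exact: powR_ge0.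
have wp0 : 0 <= w `^ p by exact: powR_ge0.
have young : d `^ (p - 1) * w <= d `^ p + w `^ p by apply: powR_young_max => //; exact: normr_ge0.
have MD : d `^ (p - 1) * w <= M * d `^ (p - 1) by rewrite [leRHS]mulrC ler_wpM2l.
have w0 : (`|x| <= r) = false -> (`|y| <= r) = false -> w = 0.
  move=> xr yr; rewrite /w !fr ?subrr ?normr0// ltNge.
    by rewrite yr.
  by rewrite xr.
have mono (t : V) : `|t| <= r -> `|t| <= r + 1.
  by move=> tr; rewrite (le_trans tr)// lerDl.
rewrite /X /Y /X1 /Y1.
have [xr|xr] := boolP (`|x| <= r).
  rewrite (mono _ xr); have [yr1|yr1] := boolP (`|y| <= r + 1).
    by apply: le_trans young _; rewrite le_eqVlt; apply/orP; left; apply/eqP; rewrite /=; ring.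
  apply: le_trans MD _; rewrite -[leLHS]addr0; apply: lerD => //.
  by rewrite le_eqVlt; apply/orP; left; apply/eqP; rewrite /=; ring.
have [yr|yr] := boolP (`|y| <= r).
  rewrite (mono _ yr); have [xr1|xr1] := boolP (`|x| <= r + 1).
    by apply: le_trans young _; rewrite le_eqVlt; apply/orP; left; apply/eqP; rewrite /=; ring.
  apply: le_trans MD _; rewrite -[leLHS]addr0; apply: lerD => //.
  by rewrite le_eqVlt; apply/orP; left; apply/eqP; rewrite /=; ring.
rewrite w0 ?(negPf xr) ?(negPf yr)// mulr0 !mul0r addr0 mulr0 mul0r addr0.
by rewrite addr_ge0 ?powR_ge0// mulr_ge0// mulr_ge0.
Qed.

Lemma flux_norm_integral_le (M r : R) (f : V -> R) : 0 <= M -> 0 < r -> measurable_fun [set: V] f ->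
  (forall x, 0 <= f x <= M) -> (forall x, r < `|x| -> f x = 0) ->
  (\int[leb \x leb]_z `|(flux f z)%:E| <=
   \int[leb \x leb]_z (flux_bound M r z)%:E + energy p a f)%E.
Proof.
move=> M0 r0 mf fM fr; rewrite /energy -ge0_integralD_EFin.
- apply: (@ge0_le_integral_EFin _ _ _ _ (fun z => `|flux f z|)).
  + apply: measurableT_comp => //; exact: measurable_flux.
  + apply: measurable_funD; first exact: measurable_flux_bound.
    exact: measurable_energy_density.
  + by move=> z; exact: normr_ge0.
  + by move=> z; exact: flux_le_bound.
- exact: measurable_flux_bound.
- exact: measurable_energy_density.
- by move=> z; exact: flux_bound_ge0.
- by move=> z; exact: energy_density_ge0.
Qed.

Lemma integrable_flux (M r : R) (f : V -> R) : 0 <= M -> 0 < r -> measurable_fun [set: V] f ->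
  (forall x, 0 <= f x <= M) -> (forall x, r < `|x| -> f x = 0) ->
  (energy p a f < +oo)%E ->
  (leb \x leb)%E.-integrable [set: V * V] (EFin \o flux f).
Proof.
move=> M0 r0 mf fM fr ef; apply/integrableP; split.
  by apply/measurable_EFinP; exact: measurable_flux.
apply: le_lt_trans (flux_norm_integral_le M0 r0 mf fM fr) _.
by rewrite lte_add_pinfty//; exact: flux_bound_integral.
Qed.

(** * Semicontinuous test functions *)

Hypothesis u_super : forall e c, 0 < e ->
  (0 <= \int[leb \x leb]_z (flux (fun x => bump e (x - c)) z)%:E)%E.

Let measurable_rV_add_pair :
  measurable_fun [set: V * V] (fun z : V * V => z.1 + z.2).
Proof.
apply: measurable_fun_rVP => i; under eq_fun do rewrite !mxE.
apply: measurable_funD.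
  exact: (measurableT_comp (measurable_coord_rV i) measurable_fst).
exact: (measurableT_comp (measurable_coord_rV i) measurable_snd).
Qed.

Lemma bump_convolution (M r e : R) (w : V -> R) (x : V) : 0 <= M -> 0 < r -> 0 < e ->
  measurable_fun [set: V] w -> (forall x, 0 <= w x <= M) ->
  (\int[leb]_h (bump e h * w (x + h))%:E = \int[leb]_y (w y * bump e (x - y))%:E)%E.
Proof.
move=> M0 r0 e0 mw wM.
pose G y := w y * bump e (x - y).
have mG : measurable_fun [set: V] G.
  apply: measurable_funM => //; rewrite (_ : (fun _ => _) = fun y : V => bump e (y - x)).
    exact: (measurableT_comp (measurable_bump e) (measurable_rV_add _)).
  by apply/funext => y; rewrite -bumpN opprB.
rewrite -(ge0_integral_rV_shift x (f := fun y => (G y)%:E)).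
- apply: eq_integral => h _; rewrite /G mulrC addrC -(bumpN e (x - _)) opprB.
  by rewrite addrK.
- exact/measurable_EFinP.
- by move=> y; rewrite lee_fin mulr_ge0 ?bump_ge0//; case/andP: (wM y).
Qed.

Let mw_shift (w : V -> R) (x : V) : measurable_fun [set: V] w ->
  measurable_fun [set: V] (fun h => w (x + h)).
Proof.
move=> mw; under eq_fun do rewrite addrC.
exact: (measurableT_comp mw (measurable_rV_add x)).
Qed.

Let mbump_sub (e : R) (x : V) : measurable_fun [set: V] (fun y => bump e (x - y)).
Proof.
rewrite (_ : (fun _ => _) = fun y : V => bump e (y - x)).
  exact: (measurableT_comp (measurable_bump e) (measurable_rV_add _)).
by apply/funext => y; rewrite -bumpN opprB.
Qed.

(** At a fixed pair the flux is linear in the test function, so this is the symmetry of the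
    convolution of [w] with the even bump, read at the two points. *)
Lemma flux_convolution (M r e : R) (w : V -> R) (z : V * V) :
  0 <= M -> 0 < r -> 0 < e ->
  measurable_fun [set: V] w -> (forall x, 0 <= w x <= M) ->
  (forall x, r < `|x| -> w x = 0) ->
  (\int[leb]_h (bump e h * flux (fun x => w (x + h)) z)%:E =
   \int[leb]_y (w y * flux (fun x => bump e (x - y)) z)%:E)%E.
Proof.
move=> M0 r0 e0 mw wM wr.
pose c := Psi p (u z.1 - u z.2) * kern a (z.1 - z.2).
have wle x : `|w x| <= M by case/andP: (wM x) => ? ?; rewrite ger0_norm.
have ble x : `|bump e x| <= 1 :> R by rewrite ger0_norm ?bump_ge0 ?bump_le1.
pose F1 x := EFin \o (fun h : V => bump e h * w (x + h)).
pose F2 x := EFin \o (fun y : V => w y * bump e (x - y)).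
have I1 x : leb.-integrable [set: V] (F1 x).
  apply: (@integrable_bounded_support R n M e) => //.
  - by apply: measurable_funM; [exact: measurable_bump|exact: mw_shift].
  - by move=> h; rewrite normrM -[leRHS]mul1r ler_pM.
  - by move=> h eh; rewrite bump_eq0// mul0r.
have I2 x : leb.-integrable [set: V] (F2 x).
  apply: (@integrable_bounded_support R n M r) => //.
  - by apply: measurable_funM => //; exact: mbump_sub.
  - by move=> h; rewrite normrM -[leRHS]mulr1 ler_pM.
  - by move=> h eh; rewrite wr// mul0r.
transitivity (c%:E * \int[leb]_h (F1 z.1 h - F1 z.2 h))%E.
  rewrite -integralZl//; last exact: integrableB.
  apply: eq_integral => h _; rewrite /= -EFinB -EFinM; congr EFin.
  by rewrite /c /flux/=; ring.
transitivity (c%:E * \int[leb]_y (F2 z.1 y - F2 z.2 y))%E; last first.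
  rewrite -integralZl//; last exact: integrableB.
  apply: eq_integral => h _; rewrite /= -EFinB -EFinM; congr EFin.
  by rewrite /c /flux/=; ring.
congr (_ * _)%E; rewrite integralB//; [|exact: I1..].
rewrite integralB//; [|exact: I2..].
by rewrite /F1 /F2/= !(bump_convolution _ M0 r0 e0 mw wM).
Qed.

Let mflux_shift (w : V -> R) : measurable_fun [set: V] w ->
  measurable_fun [set: (V * V) * V] (fun zh => flux (fun x => w (x + zh.2)) zh.1).
Proof.
move=> mw.
have m1 : measurable_fun [set: (V * V) * V] (fun zh : (V * V) * V => zh.1.1 + zh.2).
  apply: (@measurableT_comp _ _ _ _ _ _ (fun z : V * V => z.1 + z.2) _
    (fun zh : (V * V) * V => (zh.1.1, zh.2))) => //.
  apply/measurable_fun_pair => /=; last exact: measurable_snd.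
  exact: (measurableT_comp measurable_fst measurable_fst).
have m2 : measurable_fun [set: (V * V) * V] (fun zh : (V * V) * V => zh.1.2 + zh.2).
  apply: (@measurableT_comp _ _ _ _ _ _ (fun z : V * V => z.1 + z.2) _
    (fun zh : (V * V) * V => (zh.1.2, zh.2))) => //.
  apply/measurable_fun_pair => /=; last exact: measurable_snd.
  exact: (measurableT_comp measurable_snd measurable_fst).
have mPsi : measurable_fun [set: V * V] (fun z : V * V => Psi p (u z.1 - u z.2)).
  rewrite /Psi; apply: measurable_funM; last exact: measurable_fun_diff.
  apply: (measurableT_comp (measurable_powR _)); apply: measurableT_comp => //.
  exact: measurable_fun_diff.
rewrite /flux/=; apply: measurable_funM.
  apply: measurable_funM; first exact: (measurableT_comp mPsi measurable_fst).
  by apply: measurable_funB; [exact: (measurableT_comp mw m1)|exact: (measurableT_comp mw m2)].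
exact: (measurableT_comp (measurable_kern_pair a) measurable_fst).
Qed.

Let mflux_bump (e : R) :
  measurable_fun [set: (V * V) * V] (fun zy => flux (fun x => bump e (x - zy.2)) zy.1).
Proof.
apply: (@measurableT_comp _ _ _ _ _ _
  (fun zh : (V * V) * V => flux (fun x => bump e (x + zh.2)) zh.1) _
  (fun zy : (V * V) * V => (zy.1, - zy.2))).
  exact: (mflux_shift (measurable_bump e)).
apply/measurable_fun_pair => /=; first exact: measurable_fst.
apply: (@measurableT_comp _ _ _ _ _ _ (fun x : V => - x)); last exact: measurable_snd.
apply: measurable_fun_rVP => i; under eq_fun do rewrite mxE.
by apply: measurableT_comp => //; exact: measurable_coord_rV.
Qed.

(** A uniform bound over a bounded set of parameters gives joint integrability, which is what
    Fubini's theorem requires for the signed flux. *)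
Let integrable_slice (C r : R) (Phi : (V * V) * V -> R) : 0 <= C -> 0 < r ->
  measurable_fun [set: (V * V) * V] Phi ->
  (forall y, r < `|y| -> forall z, Phi (z, y) = 0) ->
  (forall y, `|y| <= r -> (\int[leb \x leb]_z `|(Phi (z, y))%:E| <= C%:E)%E) ->
  (lebesgue_rV2 \x leb)%E.-integrable [set: (V * V) * V] (EFin \o Phi).
Proof.
move=> C0 r0 mP P0 PC.
have mE : measurable_fun [set: (V * V) * V] (EFin \o Phi) by exact/measurable_EFinP.
apply: (proj2 (integrable21ltyP lebesgue_rV2 leb mE)).
apply: (@le_lt_trans _ _ (\int[leb]_y (C * \1_(cube r) y)%:E)%E).
  apply: ge0_le_integral => //.
  - by move=> y _; exact: integral_ge0.
  - apply: (measurable_fun_fubini_tonelli_G (m1 := lebesgue_rV2) (fun zy => `|(Phi zy)%:E|%E)) => //.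
    by apply: measurableT_comp => //; exact/measurable_EFinP.
  - by apply/measurable_EFinP; exact: measurable_funM.
  - move=> y _; rewrite indic_cubeE; have [yr|yr] := leP `|y| r.
      by rewrite mulr1; exact: PC.
    rewrite mulr0 integral0_eq// => z _; by rewrite /= P0// normr0.
rewrite integral_indicZ//; last exact: measurable_cube.
by have /= -> := @lebesgue_rV_cube R n r (ltW r0); rewrite -EFinM ltry.
Qed.

(** By contradiction: if every small translate had a negative weak form, so would the average
    against the bump; yet that average integrates [w(y) >= 0] against weak forms tested with
    bumps. *)
Lemma exists_shift_flux_ge0 (M r e : R) (w : V -> R) :
  0 <= M -> 0 < r -> 0 < e -> e <= 1 ->
  measurable_fun [set: V] w -> (forall x, 0 <= w x <= M) ->
  (forall x, r < `|x| -> w x = 0) -> (energy p a w < +oo)%E ->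
  exists2 h : V, `|h| <= e &
    (0 <= \int[leb \x leb]_z (flux (fun x => w (x + h)) z)%:E)%E.
Proof.
move=> M0 r0 e0 e1 mw wM wr ew; apply: contrapT => /forall2NP hN.
have {}hN (h : V) : `|h| <= e -> (\int[leb \x leb]_z (flux (fun x => w (x + h)) z)%:E < 0)%E.
  by move=> he; rewrite ltNge; apply/negP; case: (hN h).
have r10 : 0 < r + 1 by rewrite addr_gt0.
pose Phi (zh : (V * V) * V) := bump e zh.2 * flux (fun x => w (x + zh.2)) zh.1.
pose Psi' (zy : (V * V) * V) := w zy.2 * flux (fun x => bump e (x - zy.2)) zy.1.
have mPhi : measurable_fun [set: (V * V) * V] Phi.
  apply: measurable_funM; last exact: mflux_shift.
  exact: (measurableT_comp (measurable_bump e) measurable_snd).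
have mPsi' : measurable_fun [set: (V * V) * V] Psi'.
  apply: measurable_funM; last exact: mflux_bump.
  exact: (measurableT_comp mw measurable_snd).
have mwh (h : V) : measurable_fun [set: V] (fun x => w (x + h)).
  exact: (measurableT_comp mw (measurable_rV_add h)).
have wh0 (h : V) : `|h| <= e -> forall x, r + 1 < `|x| -> w (x + h) = 0.
  move=> he x xr; apply: wr; rewrite -(opprK h) (lt_le_trans _ (lerB_dist _ _))//.
  by rewrite normrN ltrBrDr (le_lt_trans _ xr)// lerD2l (le_trans he).
have mbh (y : V) : measurable_fun [set: V] (fun x => bump e (x - y)).
  exact: (measurableT_comp (measurable_bump e) (measurable_rV_add _)).
have bh0 (y : V) : `|y| <= r -> forall x, r + 1 < `|x| -> bump e (x - y) = 0.
  move=> yr x xr; apply: bump_eq0 => //.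
  rewrite (lt_le_trans _ (lerB_dist _ _))// ltrBrDr (le_lt_trans _ xr)//.
  by rewrite addrC lerD.
have b01 (x : V) : 0 <= bump e x <= 1 by rewrite bump_ge0 bump_le1.
have eb : (energy p a (@bump R n e) < +oo)%E.
  have [C C0 HC] := @lipschitz_energy_le R n p b b_gt0 b_lt_p.
  have [A A0 HA] := @bump_lipschitz R n e e0.
  apply: le_lt_trans (HC (bump e) A 1 e ltr01 (ltW e0) A0 (measurable_bump e) _ HA) _.
    by move=> x; exact: bump_eq0.
  by rewrite ltry.
have ebh (y : V) : energy p a (fun x => bump e (x - y)) = energy p a (@bump R n e).
  by rewrite (@energy_shift _ _ p a (bump e) (- y))//; exact: measurable_bump.
have fin_bound (M' : R) (f : V -> R) : 0 <= M' -> (energy p a f < +oo)%E ->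
    exists2 C : R, 0 <= C & (\int[leb \x leb]_z (flux_bound M' (r + 1) z)%:E + energy p a f = C%:E)%E.
  move=> M'0 ef; have f1 := flux_bound_integral M'0 r10.
  have g1 : (0 <= \int[leb \x leb]_z (flux_bound M' (r + 1) z)%:E)%E.
    by apply: integral_ge0 => z _; rewrite lee_fin flux_bound_ge0.
  have g2 : (0 <= energy p a f)%E.
    by apply: integral_ge0 => z _; rewrite lee_fin energy_density_ge0.
  exists (fine (\int[leb \x leb]_z (flux_bound M' (r + 1) z)%:E + energy p a f)).
    by rewrite fine_ge0// adde_ge0.
  by rewrite fineK// ge0_fin_numE; [exact: lte_add_pinfty|exact: adde_ge0].
have iPhi : (lebesgue_rV2 \x leb)%E.-integrable setT (EFin \o Phi).
  have [C C0 CE] := fin_bound M w M0 ew.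
  apply: (@integrable_slice C e Phi) => //.
    by move=> y ye z; rewrite /Phi/= bump_eq0// mul0r.
  move=> h he; rewrite -CE.
  have := flux_norm_integral_le M0 r10 (mwh h) (fun x => wM (x + h)) (wh0 h he).
  rewrite energy_shift//; apply: le_trans; apply: ge0_le_integral => //.
  - apply: measurableT_comp => //; apply/measurable_EFinP.
    exact: (measurable_fun_pair1 h mPhi).
  - apply: measurableT_comp => //; apply/measurable_EFinP; exact: measurable_flux.
  - move=> z _; rewrite /Phi/= lee_fin normrM ler_piMl//.
    by case/andP: (b01 h) => ? ?; rewrite ger0_norm.
have iPsi' : (lebesgue_rV2 \x leb)%E.-integrable setT (EFin \o Psi').
  have [C C0 CE] := fin_bound 1 _ ler01 eb.
  apply: (@integrable_slice (M * C) r Psi') => //; first by rewrite mulr_ge0.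
    by move=> y ye z; rewrite /Psi'/= wr// mul0r.
  move=> y yr; rewrite EFinM -CE.
  have := flux_norm_integral_le ler01 r10 (mbh y) (fun x => b01 (x - y)) (bh0 y yr).
  rewrite ebh => H; apply: le_trans (lee_wpmul2l _ H); last by rewrite lee_fin.
  rewrite -ge0_integralZl; last 4 first.
  - exact: measurableT.
  - apply: measurableT_comp => //; apply/measurable_EFinP; exact: measurable_flux.
  - by move=> z _; exact: abse_ge0.
  - by rewrite lee_fin.
  apply: ge0_le_integral => //.
  - apply: measurableT_comp => //; apply/measurable_EFinP.
    exact: (measurable_fun_pair1 y mPsi').
  - apply: measurable_funeM; apply: measurableT_comp => //; apply/measurable_EFinP.
    exact: measurable_flux.
  - move=> z _; rewrite /Psi'/= -EFinM lee_fin normrM ler_wpM2r//.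
    by case/andP: (wM y) => ? ?; rewrite ger0_norm.
pose G (h : V) := (\int[leb \x leb]_z (Phi (z, h))%:E)%E.
have G0 : (0 <= \int[leb]_h G h)%E.
  rewrite /G -(Fubini iPhi).
  (* Between two uses of Fubini, translates of [w] are exchanged for translates of the bump. *)
  have -> : (\int[leb \x leb]_z \int[leb]_h (Phi (z, h))%:E =
      \int[leb \x leb]_z \int[leb]_y (Psi' (z, y))%:E)%E.
    by apply: eq_integral => z _; exact: (flux_convolution z M0 r0 e0 mw wM wr).
  rewrite (Fubini iPsi'); apply: integral_ge0 => y _.
  have [yr|yr] := leP `|y| r; last first.
    by rewrite integral0_eq// => z _; rewrite /Psi'/= wr// mul0r.
  have If := integrable_flux ler01 r10 (mbh y) (fun x => b01 (x - y)) (bh0 y yr).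
  under eq_integral do rewrite /Psi'/= EFinM.
  rewrite integralZl//; last by apply: If; rewrite ebh.
  by rewrite mule_ge0 ?u_super// lee_fin; case/andP: (wM y).
have GE h : `|h| <= e -> G h = ((bump e h)%:E * \int[leb \x leb]_z (flux (fun x => w (x + h)) z)%:E)%E.
  move=> he; rewrite /G; under eq_integral do rewrite /Phi/= EFinM.
  rewrite integralZl//; apply: (integrable_flux M0 r10 (mwh h) (fun x => wM (x + h)) (wh0 h he)).
  by rewrite energy_shift.
have Gle0 h : (G h <= 0)%E.
  have [he|he] := leP `|h| e; last first.
    by rewrite /G integral0_eq// => z _; rewrite /Phi/= bump_eq0// mul0r.
  by rewrite GE// mule_ge0_le0 ?lee_fin ?bump_ge0// ltW// hN.
have mG : measurable_fun [set: V] G by exact: (measurable_fubini_G iPhi).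
(* [G] is nonpositive with nonnegative integral, hence null almost everywhere. This contradicts its
   strict negativity on the cube of radius [e / 2], where the bump is positive. *)
have : ae_eq leb setT G (cst 0%E).
  apply/ae_eq_integral_abs => //; apply/eqP; rewrite eq_le integral_ge0//= andbT.
  under eq_integral => h _ do rewrite lee0_abs//.
  rewrite -oppe_ge0 -integral_ge0N; last by move=> h _; rewrite oppe_ge0.
  by under eq_integral do rewrite oppeK.
move=> [N [mN N0 GN]].
have : (leb (cube (e / 2)%R) <= leb N)%E.
  apply: le_measure; rewrite ?inE//; first exact: measurable_cube.
  move=> h /= he; apply: GN => /= /(_ I); apply/eqP; rewrite lt_eqF//.
  have he' : `|h| < e by rewrite (le_lt_trans he)// ltr_pdivrMr// ltr_pMr// ltr1n.
  rewrite GE ?(ltW he')// mule_gt0_lt0 ?lte_fin ?bump_gt0// hN// ltW//.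
have e20 : 0 < e / 2 by rewrite divr_gt0.
have /= -> := @lebesgue_rV_cube R n (e / 2) (ltW e20).
by rewrite N0 lee_fin leNgt exprn_gt0// mulr_gt0.
Qed.

Let ae_fst (P : V -> Prop) : {ae leb, forall x, P x} -> {ae (leb \x leb)%E, forall z, P z.1}.
Proof.
move=> [N [mN N0 PN]]; exists (N `*` setT); split; first exact: measurableX.
  transitivity (leb N * leb setT)%E; last by rewrite N0 mul0e.
  exact: product_measure1E.
by move=> z /= Pz; split => //; exact: PN.
Qed.

Let ae_snd (P : V -> Prop) : {ae leb, forall x, P x} -> {ae (leb \x leb)%E, forall z, P z.2}.
Proof.
move=> [N [mN N0 PN]]; exists (setT `*` N); split; first exact: measurableX.
  transitivity (leb setT * leb N)%E; last by rewrite N0 mule0.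
  exact: product_measure1E.
by move=> z /= Pz; split => //; exact: PN.
Qed.

(** Fatou's lemma is applied to bound plus energy density minus flux, which is nonnegative. The
    first two terms have the same integral [C] for all translates, so the limit satisfies
    [C - flux <= C]. *)
Lemma usc_flux_ge0 (M r : R) (w : V -> R) :
  0 <= M -> 0 < r -> measurable_fun [set: V] w -> (forall x, 0 <= w x <= M) ->
  (forall x, r < `|x| -> w x = 0) -> (energy p a w < +oo)%E ->
  (forall x c, w x < c -> \forall y \near x, w y < c) ->
  (0 <= \int[leb \x leb]_z (flux w z)%:E)%E.
Proof.
move=> M0 r0 mw wM wr ew usc.
have r10 : 0 < r + 1 by rewrite addr_gt0.
(* The rate [2^-k] makes the L^1 distances summable, which yields almost everywhere convergence of
   the whole sequence. *)
have /choice[h hP] : forall k : nat, exists h : V, [/\ `|h| <= 1,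
    (\int[leb]_x `|w (x + h) - w x|%:E <= (2^-1 ^+ k)%:E)%E &
    (0 <= \int[leb \x leb]_z (flux (fun x => w (x + h)) z)%:E)%E].
  move=> k; have k0 : 0 < (2^-1 ^+ k : R) by rewrite exprn_gt0.
  have [d /andP[d0 d1] dP] := usc_translation M0 r0 mw wM wr usc k0.
  have [h hd hT] := exists_shift_flux_ge0 M0 r0 d0 d1 mw wM wr ew.
  by exists h; split => //; [exact: le_trans hd d1|exact: dP].
pose wk k x := w (x + h k).
have mwk k : measurable_fun [set: V] (wk k).
  exact: (measurableT_comp mw (measurable_rV_add (h k))).
have wkr k x : r + 1 < `|x| -> wk k x = 0.
  move=> xr; have [h1 _ _] := hP k; apply: wr.
  rewrite -(opprK (h k)) (lt_le_trans _ (lerB_dist _ _))//.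
  by rewrite normrN ltrBrDr (le_lt_trans _ xr)// lerD2l.
have wr1 x : r + 1 < `|x| -> w x = 0 by move=> xr; rewrite wr// (lt_trans _ xr)// ltrDl.
have wkM k x : 0 <= wk k x <= M by exact: wM.
have ewk k : energy p a (wk k) = energy p a w by exact: energy_shift.
have cvg_w : {ae leb, forall x, wk ^~ x @ \oo --> w x}.
  have m1 k : measurable_fun [set: V] (fun x => `|wk k x - w x|).
    by apply: measurableT_comp => //; exact: measurable_funB.
  have i1 k : (\int[leb]_x `|wk k x - w x|%:E <= (2^-1 ^+ k)%:E)%E by have [] := hP k.
  have := ae_cvg0_of_integral_le m1 (fun k x => normr_ge0 _) i1.
  by apply: filterS => x /norm_cvg0P /subr_cvg0.
pose FB := flux_bound M (r + 1).
pose X (f : V -> R) z := FB z + energy_density p a f z - flux f z.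
have X0 (f : V -> R) z : (forall x, 0 <= f x <= M) -> (forall x, r + 1 < `|x| -> f x = 0) -> 0 <= X f z.
  move=> fM fr; rewrite subr_ge0 (le_trans (ler_norm _))//.
  exact: flux_le_bound.
have mX (f : V -> R) : measurable_fun [set: V] f -> measurable_fun [set: V * V] (X f).
  move=> mf; apply: measurable_funB; last exact: measurable_flux.
  apply: measurable_funD; first exact: measurable_flux_bound.
  exact: measurable_energy_density.
have IFB : (leb \x leb)%E.-integrable setT (EFin \o FB).
  apply: (@integrable_le_EFin _ _ _ _ FB FB) => //; try exact: measurable_flux_bound.
    by move=> z; rewrite ger0_norm ?flux_bound_ge0.
  exact: flux_bound_integral.
have IE (f : V -> R) : measurable_fun [set: V] f -> energy p a f = energy p a w ->
    (leb \x leb)%E.-integrable setT (EFin \o energy_density p a f).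
  move=> mf fw; apply: (@integrable_le_EFin _ _ _ _ _ (energy_density p a f)).
  - exact: measurable_energy_density.
  - exact: measurable_energy_density.
  - by move=> z; rewrite ger0_norm ?energy_density_ge0.
  - by move: ew; rewrite -fw.
have XE (f : V -> R) : measurable_fun [set: V] f -> (forall x, 0 <= f x <= M) ->
    (forall x, r + 1 < `|x| -> f x = 0) -> energy p a f = energy p a w ->
    (\int[leb \x leb]_z (X f z)%:E = \int[leb \x leb]_z (FB z)%:E + energy p a w -
      \int[leb \x leb]_z (flux f z)%:E)%E.
  move=> mf fM fr fw; rewrite -fw.
  have If : (leb \x leb)%E.-integrable setT (EFin \o flux f).
    by apply: (integrable_flux M0 r10 mf fM fr); rewrite fw.
  have IEf := IE f mf fw.
  rewrite /energy -(integralD measurableT IFB IEf).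
  by rewrite -(integralB measurableT (integrableD measurableT IFB IEf) If).
set C := (\int[leb \x leb]_z (FB z)%:E + energy p a w)%E in XE *.
have Cfin : C \is a fin_num.
  by rewrite fin_numD; apply/andP; split; [exact: integrable_fin_num|exact: (integrable_fin_num _ (IE w mw erefl))].
have : (\int[leb \x leb]_z (X w z)%:E <= C)%E.
  apply: (@fatou_ae_le _ _ _ _ (fun k => X (wk k))).
  - by move=> k; exact: mX.
  - by move=> k z; apply: X0 => //; exact: wkr.
  - exact: mX.
  - by move=> z; exact: X0.
  - apply: filterS2 (ae_fst cvg_w) (ae_snd cvg_w) => z c1 c2.
    rewrite /X; apply: cvgB.
      apply: cvgD; first exact: cvg_cst.
      have H := @continuous_norm_powR R p (lt_trans b_gt0 b_lt_p) (w z.1 - w z.2).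
      by rewrite /energy_density/=; apply: cvgM; [exact: (cvg_comp _ _ (cvgB c1 c2) H)|exact: cvg_cst].
    by rewrite /flux/=; apply: cvgM; [apply: cvgM; [exact: cvg_cst|exact: (cvgB c1 c2)]|exact: cvg_cst].
  - move=> k; rewrite XE//; last exact: wkr.
    by have [_ _ T0] := hP k; rewrite -[leRHS]sube0; exact: leeB.
have If : (leb \x leb)%E.-integrable setT (EFin \o flux w).
  exact: (integrable_flux M0 r0).
have Tfin := integrable_fin_num measurableT If.
rewrite XE// -(fineK Cfin) -(fineK Tfin) -EFinB !lee_fin; lra.
Qed.

(** * Energy of the truncations when N <= sp *)

Hypothesis n_le_b : n%:R <= b.
Hypothesis u_lsc : forall x c, c < u x -> \forall y \near x, c < u y.

Definition trunc (M : R) (g : V -> R) (x : V) : R := Num.max 0 (M * g x - u x).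

Let measurable_trunc M g : measurable_fun [set: V] g -> measurable_fun [set: V] (trunc M g).
Proof.
move=> mg; apply: measurable_maxr; first exact: measurable_cst.
by apply: measurable_funB => //; apply: measurable_funM.
Qed.

Let trunc_bnd M k x : 0 <= M -> 0 <= trunc M (cutoff k) x <= M.
Proof.
move=> M0; rewrite le_max lexx/= ge_max M0/=.
have := u_ge0 x; have : M * cutoff k x <= M by rewrite ler_piMr// cutoff_le1.
lra.
Qed.

Let trunc_supp M k x : 2 * k.+1%:R < `|x| -> trunc M (cutoff k) x = 0.
Proof.
by move=> xk; rewrite /trunc cutoff_eq0// mulr0 max_l// sub0r oppr_le0.
Qed.

Let trunc_usc M k x c : trunc M (cutoff k) x < c ->
  \forall y \near x, trunc M (cutoff k) y < c.
Proof.
rewrite gt_max => /andP[c0 gc].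
pose d := (c - (M * cutoff k x - u x)) / 2.
have d0 : 0 < d by rewrite divr_gt0// subr_gt0.
have cg : continuous_at x (fun y => M * cutoff k y).
  by apply: continuousM; [exact: cst_continuous|exact: continuous_cutoff].
have H1 : \forall y \near x, M * cutoff k y < M * cutoff k x + d.
  by apply: (cvgr_lt _ cg); rewrite ltrDl.
have H2 : \forall y \near x, u x - d < u y by apply: u_lsc; rewrite gtrBl.
apply: filterS2 H1 H2 => y h1 h2; rewrite gt_max c0/=.
by move: h1 h2; rewrite /d; lra.
Qed.

(** Only qualitative finiteness, needed before w can be used as a test function. Pairs inside the
    cube of radius [r + 1] are controlled by the energies of the cutoff and of u; the other relevant
    pairs are at distance at least 1, where boundedness by [M] and the integrable far kernel
    suffice. *)
Let trunc_energy_lty M k : 0 <= M -> (energy p a (trunc M (cutoff k)) < +oo)%E.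
Proof.
move=> M0; set r : R := 2 * k.+1%:R; have r0 : 0 < r by rewrite mulr_gt0.
have [C C0 HC] := @lipschitz_energy_le R n p b b_gt0 b_lt_p.
pose g (x : V) := M * cutoff k x.
have mg : measurable_fun [set: V] g.
  by apply: measurable_funM => //; exact: measurable_cutoff.
have eg : (energy p a g < +oo)%E.
  apply: le_lt_trans (HC g M k.+1%:R r _ (ltW r0) M0 mg _ _) _ => //.
  - by move=> x xr; rewrite /g cutoff_eq0// mulr0.
  - by move=> x y; rewrite /g -mulrBr normrM (ger0_norm M0) ler_wpM2l// cutoff_lipschitz.
  - by rewrite ltry.
set w := trunc M (cutoff k).
have mw : measurable_fun [set: V] w by apply: measurable_trunc; exact: measurable_cutoff.
pose F (x : V) := M `^ p * \1_(cube r) x.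
have mF : measurable_fun [set: V] F.
  by apply: measurable_funM => //; apply: measurable_indic; exact: measurable_cube.
have F0 x : 0 <= F x by rewrite mulr_ge0// powR_ge0.
have mK := measurable_far_kern.
have K0 := far_kern_ge0.
have mK2 : measurable_fun [set: V * V] (fun z => far_kern (z.1 - z.2)).
  exact: (measurableT_comp mK measurable_rV_sub_pair).
pose X z := 2 `^ p * (energy_density p a g z + near_energy (r + 1) z).
pose Y (z : V * V) := F z.1 * far_kern (z.1 - z.2).
pose Z (z : V * V) := F z.2 * far_kern (z.1 - z.2).
have mX0 : measurable_fun [set: V * V] (fun z => energy_density p a g z + near_energy (r + 1) z).
  by apply: measurable_funD; [exact: measurable_energy_density|exact: measurable_near_energy].
have mX : measurable_fun [set: V * V] X by apply: measurable_funM.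
have mY : measurable_fun [set: V * V] Y.
  by apply: measurable_funM => //; exact: (measurableT_comp mF measurable_fst).
have mZ : measurable_fun [set: V * V] Z.
  by apply: measurable_funM => //; exact: (measurableT_comp mF measurable_snd).
have X00 z : 0 <= energy_density p a g z + near_energy (r + 1) z.
  by rewrite addr_ge0 ?energy_density_ge0 ?near_energy_ge0.
have X0 z : 0 <= X z by rewrite mulr_ge0 ?powR_ge0.
have Y0 z : 0 <= Y z by rewrite mulr_ge0.
have Z0 z : 0 <= Z z by rewrite mulr_ge0.
have FF : (\int[leb]_x (F x)%:E < +oo)%E.
  rewrite integral_indicZ ?powR_ge0//; last exact: measurable_cube.
  by have /= -> := @lebesgue_rV_cube R n r (ltW r0); rewrite -EFinM ltry.
have FK : (\int[leb]_x (F x)%:E * \int[leb]_x (far_kern x)%:E < +oo)%E.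
  apply: lte_mul_pinfty; first by apply: integral_ge0 => x _; rewrite lee_fin.
    by rewrite ge0_fin_numE//; apply: integral_ge0 => x _; rewrite lee_fin.
  exact: far_kern_integral.
apply: (@le_lt_trans _ _ (\int[leb \x leb]_z (X z + (Y z + Z z))%:E)%E).
  apply: ge0_le_integral_EFin.
  - exact: measurable_energy_density.
  - by apply: measurable_funD => //; exact: measurable_funD.
  - by move=> z; exact: energy_density_ge0.
  - move=> [x y]; rewrite /X /Y /Z /F /energy_density /near_energy /far_kern/= !indic_cubeE.
    rewrite (_ : \1_[set x | 1 <= `|x|] (x - y) = (1 <= `|x - y|)%R%:R); last first.
      by rewrite indicE; congr (_%:R); congr nat_of_bool; apply/idP/idP; rewrite inE.
    set wd := `|w x - w y|; set gd := `|g x - g y|; set d := `|u x - u y|.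
    pose BX : R := (`|x| <= r)%R%:R; pose BY : R := (`|y| <= r)%R%:R.
    pose BX1 : R := (`|x| <= r + 1)%R%:R; pose BY1 : R := (`|y| <= r + 1)%R%:R.
    pose Far : R := (1 <= `|x - y|)%R%:R.
    have p0 := ltW p_gt0.
    suff key : wd `^ p <= 2 `^ p * (gd `^ p + BX1 * BY1 * d `^ p) + M `^ p * (BX + BY) * Far.
      apply: le_trans (ler_wpM2r (kern_ge0 a (x - y)) key) _.
      by rewrite /energy_density/= -/d -/BX -/BY -/BX1 -/BY1 -/Far le_eqVlt; apply/orP; left; apply/eqP; ring.
    have wd0 : 0 <= wd by exact: normr_ge0.
    have gd0 : 0 <= gd by exact: normr_ge0.
    have d0 : 0 <= d by exact: normr_ge0.
    have wdM : wd `^ p <= M `^ p.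
      apply: ge0_ler_powR; rewrite ?nnegrE//.
      have /andP[x0 xM] := trunc_bnd k x M0; have /andP[y0 yM] := trunc_bnd k y M0.
      by rewrite /wd ler_norml; apply/andP; split; rewrite /w; lra.
    have dp0 : 0 <= d `^ p by exact: powR_ge0.
    have gp0 : 0 <= gd `^ p by exact: powR_ge0.
    have Mp0 : 0 <= M `^ p by exact: powR_ge0.
    have P20 : 0 <= (2 : R) `^ p by exact: powR_ge0.
    have near_case : wd `^ p <= 2 `^ p * (gd `^ p + d `^ p).
      apply: le_trans _ (powR_add_le p_gt0 gd0 d0).
      apply: ge0_ler_powR; rewrite ?nnegrE ?addr_ge0//.
      rewrite /wd /w /trunc; have [th /andP[th0 th1] ->] := max0_sub_theta (M * cutoff k x - u x) (M * cutoff k y - u y).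
      rewrite normrM (ger0_norm th0) (le_trans (_ : _ <= 1 * `|M * cutoff k x - u x - (M * cutoff k y - u y)|))//.
        by rewrite ler_wpM2r.
      rewrite mul1r (_ : _ - _ - _ = (g x - g y) - (u x - u y)) ?ler_normB//.
      by rewrite /g; ring.
    have mono (t : V) : `|t| <= r -> `|t| <= r + 1.
      by move=> tr; rewrite (le_trans tr)// lerDl.
    have dist1 (t t' : V) : `|t| <= r -> ~~ (`|t'| <= r + 1) -> 1 <= `|t - t'|.
      rewrite -ltNge => tr tr'; rewrite distrC (le_trans _ (lerB_dist _ _))//; lra.
    rewrite /BX /BY /BX1 /BY1 /Far.
    have [xr|xr] := boolP (`|x| <= r).
      rewrite (mono _ xr); have [yr1|yr1] := boolP (`|y| <= r + 1).
        by apply: le_trans near_case _; rewrite !mul1r lerDl !mulr_ge0.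
      rewrite (dist1 x y)//; apply: le_trans wdM _; rewrite /= !mulr1 mulr0 mul0r addr0.
      by rewrite -[leLHS]add0r lerD ?mulr_ge0// mulrDr mulr1 lerDl mulr_ge0.
    have [yr|yr] := boolP (`|y| <= r).
      rewrite (mono _ yr); have [xr1|xr1] := boolP (`|x| <= r + 1).
        by apply: le_trans near_case _; rewrite !mul1r lerDl !mulr_ge0.
      rewrite (distrC x) (dist1 y x)//; apply: le_trans wdM _.
      apply: (@le_trans _ _ (2 `^ p * gd `^ p + M `^ p)); first by rewrite lerDr mulr_ge0.
      by rewrite le_eqVlt; apply/orP; left; apply/eqP; rewrite /=; ring.
    rewrite /wd /w !trunc_supp ?subrr ?normr0 ?powR0 ?gt_eqF// ?ltNge//.
    by rewrite addr_ge0// !mulr_ge0 ?addr_ge0// !mulr_ge0.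
rewrite ge0_integralD_EFin//; last 2 first.
- exact: measurable_funD.
- by move=> z; rewrite addr_ge0.
rewrite ge0_integralD_EFin//; apply: lte_add_pinfty.
  rewrite ge0_integral_cstM ?powR_ge0//.
  rewrite lte_mul_pinfty ?lee_fin ?powR_ge0//.
  rewrite ge0_integralD_EFin.
  - by apply: lte_add_pinfty => //; apply: u_Wloc; rewrite addr_gt0.
  - exact: measurable_energy_density.
  - exact: measurable_near_energy.
  - by move=> z; exact: energy_density_ge0.
  - by move=> z; exact: near_energy_ge0.
apply: lte_add_pinfty.
  by rewrite (ge0_integral_conv mF mK F0 K0 far_kernN).
by rewrite (ge0_integral_conv2 mF mK F0 K0 far_kernN).
Qed.

(** The energy at scale [k + 1] is bounded by a multiple of [(k + 1)^(n - b)]; the comparison of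
    dimension and order makes this bounded. *)
Lemma cutoff_energy_le M : 0 <= M -> exists2 C : R, 0 <= C & forall k,
  (energy p a (fun x : V => (M * cutoff k x)%R) <= C%:E)%E.
Proof.
move=> M0; have [C C0 HC] := @lipschitz_energy_le R n p b b_gt0 b_lt_p.
exists (C * (M `^ p * 2 ^+ n)) => [|k]; first by rewrite !mulr_ge0 ?powR_ge0.
have k0 : 0 < k.+1%:R :> R by [].
have r0 : 0 <= 2 * k.+1%:R :> R by rewrite mulr_ge0.
have mg : measurable_fun [set: V] (fun x : V => (M * cutoff k x)%R).
  by apply: measurable_funM => //; exact: measurable_cutoff.
have gs (x : V) : 2 * k.+1%:R < `|x| -> M * cutoff k x = 0.
  by move=> xr; rewrite cutoff_eq0// mulr0.
have gl (x y : V) : `|M * cutoff k x - M * cutoff k y| <= M * Num.min 1 (`|x - y| / k.+1%:R).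
  by rewrite -mulrBr normrM (ger0_norm M0) ler_wpM2l// cutoff_lipschitz.
apply: le_trans (HC _ M k.+1%:R _ k0 r0 M0 mg gs gl) _.
rewrite lee_fin ler_wpM2l// -mulrA ler_wpM2l ?powR_ge0// exprMn -mulrA ler_piMr//.
rewrite powRN ler_pdivrMr ?powR_gt0// mul1r -powR_mulrn ?(ltW k0)//.
by apply: ler_powR n_le_b; rewrite ler1n.
Qed.

Let mflux (f : V -> R) : measurable_fun [set: V] f -> measurable_fun [set: V * V] (flux f).
Proof. exact: measurable_flux. Qed.

Let mtk M k : measurable_fun [set: V] (trunc M (cutoff k)).
Proof. by apply: measurable_trunc; exact: measurable_cutoff. Qed.

Let mgk M k : measurable_fun [set: V] (fun x : V => (M * cutoff k x)%R).
Proof. by apply: measurable_funM => //; exact: measurable_cutoff. Qed.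

Let r_gt0 k : 0 < 2 * k.+1%:R :> R. Proof. by rewrite mulr_gt0. Qed.

Let trunc_flux_ge0 M k : 0 <= M ->
  (0 <= \int[leb \x leb]_z (flux (trunc M (cutoff k)) z)%:E)%E.
Proof.
move=> M0; apply: (usc_flux_ge0 M0 (r_gt0 k)).
- exact: mtk.
- by move=> x; exact: trunc_bnd.
- by move=> x; exact: trunc_supp.
- exact: trunc_energy_lty.
- by move=> x c; exact: trunc_usc.
Qed.

Let trunc_flux_int M k : 0 <= M ->
  (leb \x leb)%E.-integrable [set: V * V] (EFin \o flux (trunc M (cutoff k))).
Proof.
move=> M0; apply: (integrable_flux M0 (r_gt0 k)).
- exact: mtk.
- by move=> x; exact: trunc_bnd.
- by move=> x; exact: trunc_supp.
- exact: trunc_energy_lty.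
Qed.

Let energy_int (f : V -> R) : measurable_fun [set: V] f -> (energy p a f < +oo)%E ->
  (leb \x leb)%E.-integrable [set: V * V] (EFin \o energy_density p a f).
Proof.
move=> mf ef; apply: (@integrable_le_EFin _ _ _ _ _ (energy_density p a f)) => //.
- exact: measurable_energy_density.
- exact: measurable_energy_density.
- by move=> z; rewrite ger0_norm ?energy_density_ge0.
Qed.

Let energy_ge0 (f : V -> R) : (0 <= energy p a f)%E.
Proof. by apply: integral_ge0 => z _; rewrite lee_fin energy_density_ge0. Qed.

(** [Psi_truncation_energy] is integrated against the kernel; the flux term has the good sign and is
    discarded. *)
Lemma trunc_energy_le M : 0 <= M -> exists2 C : R, 0 <= C & forall k,
  (energy p a (trunc M (cutoff k)) <= C%:E)%E.
Proof.
move=> M0; have [C C0 HC] := cutoff_energy_le M0.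
have c0 : 0 < (2 * 2 `^ p : R)^-1 by rewrite invr_gt0 mulr_gt0// powR_gt0.
set c := (2 * 2 `^ p)^-1 in c0; pose K : R := 2 `^ p + 4 `^ p.
have K0 : 0 <= K by rewrite addr_ge0 ?powR_ge0.
exists (K * C / c) => [|k]; first by rewrite divr_ge0 ?mulr_ge0 ?(ltW c0).
have eg : (energy p a (fun x : V => (M * cutoff k x)%R) < +oo)%E.
  by apply: le_lt_trans (HC k) _; rewrite ltry.
have Iw := energy_int (mtk M k) (trunc_energy_lty k M0).
have Ig := energy_int (mgk M k) eg.
have If := trunc_flux_int k M0.
have : (c%:E * energy p a (trunc M (cutoff k)) <= K%:E * C%:E)%E.
  apply: (@le_trans _ _ (K%:E * energy p a (fun x : V => (M * cutoff k x)%R))%E); last first.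
    by apply: lee_wpmul2l; rewrite ?lee_fin.
  rewrite /energy -(integralZl measurableT Iw c) -(integralZl measurableT Ig K).
  apply: (@le_trans _ _ (\int[leb \x leb]_z (c%:E * (energy_density p a (trunc M (cutoff k)) z)%:E)
      + \int[leb \x leb]_z (flux (trunc M (cutoff k)) z)%:E)%E).
    by rewrite leeDl// trunc_flux_ge0.
  have Icw := integrableZl measurableT c Iw.
  rewrite -(integralD measurableT Icw If); apply: le_integral => //.
  - exact: integrableD.
  - exact: integrableZl.
  - move=> [x y] _; rewrite /= -!EFinM -EFinD lee_fin /energy_density /flux/= !mulrA -mulrDl.
    by rewrite ler_wpM2r ?kern_ge0// addrC; exact: Psi_truncation_energy.
have efin : energy p a (trunc M (cutoff k)) \is a fin_num.
  by rewrite ge0_fin_numE; [exact: trunc_energy_lty|exact: energy_ge0].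
rewrite -(fineK efin) -!EFinM !lee_fin => H.
by rewrite ler_pdivlMr// mulrC.
Qed.

Let cutoff_near1 (x : V) : \forall k \near \oo, cutoff k x = 1.
Proof.
exists (Num.bound `|x|) => // k /= bk; apply: cutoff_eq1.
rewrite ltW// (lt_le_trans (archi_boundP (normr_ge0 x)))// ler_nat.
exact: leq_trans bk (leqnSn k).
Qed.

Let full M : V -> R := fun x => Num.max 0 (M - u x).

Let mfull M : measurable_fun [set: V] (full M).
Proof.
apply: measurable_maxr; first exact: measurable_cst.
by apply: measurable_funB => //; exact: measurable_cst.
Qed.

Let trunc_near_full M (z : V * V) : \forall k \near \oo,
  [/\ cutoff k z.1 = 1, cutoff k z.2 = 1,
    trunc M (cutoff k) z.1 = full M z.1 & trunc M (cutoff k) z.2 = full M z.2].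
Proof.
apply: filterS2 (cutoff_near1 z.1) (cutoff_near1 z.2) => k k1 k2.
by split => //; rewrite /trunc /full ?k1 ?k2 mulr1.
Qed.

(** At a given pair of points the cutoffs are eventually 1, so the densities are eventually equal to
    the limit one and Fatou's lemma carries over the uniform bound. *)
Let full_energy_lty M : 0 <= M -> (energy p a (full M) < +oo)%E.
Proof.
move=> M0; have [C C0 HC] := trunc_energy_le M0.
apply: (@le_lt_trans _ _ C%:E); last exact: ltry.
apply: (@fatou_ae_le _ _ _ _ (fun k => energy_density p a (trunc M (cutoff k)))) => //.
- by move=> k; exact: measurable_energy_density.
- by move=> k z; exact: energy_density_ge0.
- exact: measurable_energy_density.
- by move=> z; exact: energy_density_ge0.
- apply: aeW => z; apply: cvg_near_cst.
  apply: filterS (trunc_near_full M z) => k [_ _ e1 e2].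
  by rewrite /energy_density e1 e2.
Qed.

Let full_energy_small M : 0 <= M -> exists2 C : R, 0 <= C &
  forall A, 0 < A -> (energy p a (full M) <= (A `^ (1 - p) * C)%:E)%E.
Proof.
move=> M0; have [C C0 HC] := cutoff_energy_le M0.
exists (2 * C) => [|B B0]; first by rewrite mulr_ge0.
pose t k (x : V) := M * cutoff k x.
have B1 : 0 <= B `^ (1 - p) by exact: powR_ge0.
pose Y k z := 2 * B * energy_density p a (full M) z +
  2 * B `^ (1 - p) * energy_density p a (t k) z - flux (trunc M (cutoff k)) z.
pose L z := 2 * B * energy_density p a (full M) z - flux (full M) z.
have eg k : (energy p a (t k) < +oo)%E by apply: le_lt_trans (HC k) _; rewrite ltry.
have I1 := energy_int (mfull M) (full_energy_lty M0).
have I2 k := energy_int (mgk M k) (eg k).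
have I3 k := trunc_flux_int k M0.
have J1 := integrableZl measurableT (2 * B) I1.
have J2 k := integrableZl measurableT (2 * B `^ (1 - p)) (I2 k).
have efull : energy p a (full M) \is a fin_num by rewrite ge0_fin_numE// full_energy_lty.
have mE1 := measurable_energy_density p a (mfull M).
have mE2 k : measurable_fun [set: V * V] (energy_density p a (t k)).
  by apply: measurable_energy_density; exact: mgk.
have mL : measurable_fun [set: V * V] L.
  by apply: measurable_funB; [exact: measurable_funM|exact: mflux].
(* Without a cutoff, that is for [g1 = g2 = M], [Psi_truncation_le] bounds the flux by minus the
   energy density; this is the additional 1. *)
have Lge z : (2 * B + 1) * energy_density p a (full M) z <= L z.
  rewrite mulrDl mul1r lerD2l lerNr; case: z => x y.
  rewrite /flux /energy_density/= -mulNr ler_wpM2r ?kern_ge0//.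
  have := Psi_truncation_le (u x) (u y) p_gt1 (lexx M) (lexx M).
  rewrite subrr normr0 mulr0 sub0r mulrN [in X in _ <= X -> _]mulrC mulr_powRB1//.
have L0 z : 0 <= L z.
  by apply: le_trans (Lge z); rewrite mulr_ge0 ?energy_density_ge0// addr_ge0// mulr_ge0// ltW.
have YL : (\int[leb \x leb]_z (L z)%:E <=
    (2 * B)%:E * energy p a (full M) + (2 * B `^ (1 - p) * C)%:E)%E.
  apply: (@fatou_ae_le _ _ _ _ Y).
  - move=> k; apply: measurable_funB; last exact: mflux.
    by apply: measurable_funD; apply: measurable_funM.
  - move=> k [x y]; rewrite subr_ge0 /energy_density /flux/= !mulrA -mulrDl ler_wpM2r ?kern_ge0//.
    have gM (w : V) : t k w <= M by rewrite /t ler_piMr// cutoff_le1.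
    apply: le_trans (Psi_truncation_le (u x) (u y) p_gt1 (gM x) (gM y)) _.
    have := powR_young_scaled p_gt1 B0 (normr_ge0 (full M x - full M y)) (normr_ge0 (t k x - t k y)).
    set D := _ `^ (p - 1); set tt := `|_ - _|; rewrite -/(full M x) -/(full M y) => H.
    rewrite mulrBr; have : 0 <= D * `|trunc M (cutoff k) x - trunc M (cutoff k) y| by rewrite mulr_ge0 ?powR_ge0.
    rewrite /trunc -/(t k x) -/(t k y); lra.
  - exact: mL.
  - exact: L0.
  - apply: aeW => z; apply: cvg_near_cst.
    apply: filterS (trunc_near_full M z) => k [c1 c2 e1 e2].
    rewrite /Y /L /flux e1 e2 {2}/energy_density /t c1 c2 subrr normr0 powR0 ?gt_eqF//.
    by rewrite mul0r mulr0 addr0.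
  - move=> k.
    have -> : (\int[leb \x leb]_z (Y k z)%:E = (2 * B)%:E * energy p a (full M) +
        (2 * B `^ (1 - p))%:E * energy p a (t k) -
        \int[leb \x leb]_z (flux (trunc M (cutoff k)) z)%:E)%E.
      rewrite /energy -(integralZl measurableT I1) -(integralZl measurableT (I2 k)).
      rewrite -(integralD measurableT J1 (J2 k)).
      by rewrite -(integralB measurableT (integrableD measurableT J1 (J2 k)) (I3 k)).
    rewrite -[leRHS]sube0; apply: leeB; last exact: trunc_flux_ge0.
    apply: leeD => //; rewrite [X in (_ <= X)%E]EFinM.
    by apply: lee_wpmul2l; [rewrite lee_fin mulr_ge0|exact: HC].
have B2 : 0 <= 2 * B + 1 by rewrite addr_ge0// mulr_ge0// ltW.
have : ((2 * B + 1)%:E * energy p a (full M) <= \int[leb \x leb]_z (L z)%:E)%E.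
  rewrite /energy -ge0_integral_cstM//; last by move=> z; exact: energy_density_ge0.
  apply: ge0_le_integral_EFin => //; first exact: measurable_funM.
  by move=> z; rewrite mulr_ge0 ?energy_density_ge0.
(* Finiteness of the energy allows the term [2 * B] times it to be subtracted from both sides. *)
move=> /le_trans /(_ YL); rewrite -(fineK efull) -!EFinM -EFinD !lee_fin; lra.
Qed.

Lemma trunc_energy_eq0 M : 0 <= M ->
  energy p a (fun x => Num.max 0 (M - u x)) = 0%E.
Proof.
move=> M0; have [C C0 HC] := full_energy_small M0.
have efull : energy p a (full M) \is a fin_num by rewrite ge0_fin_numE// full_energy_lty.
suff H : fine (energy p a (full M)) <= 0.
  apply/eqP; rewrite eq_le energy_ge0 andbT -/(full M) -(fineK efull) lee_fin H//.
rewrite leNgt; apply/negP; set E := fine _ => E0.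
(* With this choice [B^(1 - p) * C = E * C / (C + 1) < E]; the [+ 1] keeps [B] positive even if
   [C = 0]. *)
pose B : R := ((C + 1) / E) `^ (p - 1)^-1.
have CE : 0 < (C + 1) / E by rewrite divr_gt0// ltr_wpDl.
have := HC B (powR_gt0 _ CE); rewrite -(fineK efull) lee_fin -/E.
have -> : 1 - p = - (p - 1) by ring.
rewrite powRN -powRrM mulVf ?gt_eqF ?subr_gt0// powRr1 ?(ltW CE)//.
rewrite invf_div mulrAC ler_pdivlMr ?ltr_wpDl// ler_pM2l//; lra.
Qed.

End supersolution.

(** * From vanishing energy to constancy almost everywhere *)

Section conclusion.
Context {R : realType} {n : nat}.
Local Notation V := 'rV[R]_n.
Local Notation leb := (@lebesgue_rV R n).
Local Notation cube r := [set x : V | `|x| <= r].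

Lemma compact_cube (r : R) : 0 < r -> compact (cube r).
Proof.
move=> r0; apply: bounded_closed_compact.
  by exists r; split; [exact: num_real|move=> M rM x /= xr; rewrite (le_trans xr)// ltW].
rewrite (_ : cube r = closed_ball 0 r); first exact: closed_ball_closed.
by rewrite closed_ballE//; apply/seteqP; split => x; rewrite /closed_ball_/= sub0r normrN.
Qed.

(** By Tonelli almost every section of the exceptional set is null; the value of u at one such base
    point is the constant. A base point exists because a cube has positive measure. *)
Lemma ae_eq_cst (u : V -> R) :
  {ae (leb \x leb)%E, forall z, u z.1 = u z.2} ->
  exists c : R, {ae leb, forall x, u x = c}.
Proof.
move=> [N [mN N0 PN]].
have : ae_eq leb setT (fun x => leb (xsection N x)) (cst 0%E).
  apply/ae_eq_integral_abs => //; first exact: measurable_fun_xsection.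
  by under eq_integral do rewrite gee0_abs//.
move=> [A [mA A0 PA]].
have [x xA] : exists x, ~ A x.
  apply/existsNP => AT.
  have : (leb (cube 1%R) <= leb A)%E.
    by apply: le_measure; rewrite ?inE//; exact: measurable_cube.
  have /= -> := @lebesgue_rV_cube R n 1 ler01.
  by rewrite A0 lee_fin leNgt exprn_gt0// mulr1.
exists (u x), (xsection N x); split.
- exact: measurable_xsection.
- have : ~ ~ (leb (xsection N x) = 0%E) by move=> H; apply: xA; apply: PA => /= /(_ Logic.I).
  by move/contrapT.
- by move=> y /= yx; rewrite xsectionE; apply: PN => /= xy; apply: yx; rewrite xy.
Qed.

(** The kernel is positive off the diagonal, and on the diagonal the two values agree trivially. *)
Lemma energy_eq0_ae (p a : R) (f : V -> R) : 0 < p -> measurable_fun [set: V] f ->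
  energy p a f = 0%E -> {ae (leb \x leb)%E, forall z, f z.1 = f z.2}.
Proof.
move=> p0 mf ef.
have : ae_eq (leb \x leb)%E setT (EFin \o energy_density p a f) (cst 0%E).
  apply/ae_eq_integral_abs => //.
    by apply/measurable_EFinP; exact: measurable_energy_density.
  rewrite -[RHS]ef; apply: eq_integral => z _.
  by rewrite gee0_abs// lee_fin energy_density_ge0.
apply: filterS => -[x y] /= /(_ Logic.I) [] /eqP.
have [->//|xy] := eqVneq x y.
rewrite mulf_eq0 [X in _ || X]gt_eqF ?kern_gt0 ?subr_eq0// orbF.
by rewrite powR_eq0 (gt_eqF p0) andbT normr_eq0 subr_eq0 => /eqP.
Qed.

End conclusion.

Theorem theorem1p2 (R : realType) (N : nat) (s p : R) (u : 'rV[R]_N -> R)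
  (hN : (2 <= N)%N) (hs0 : 0 < s) (hs1 : s < 1) (hp : 1 < p)
  (hNps : N%:R <= p * s)
  (u_ge0 : forall x, 0 <= u x)
  (u_lsc : lower_semicontinuous (EFin \o u))
  (u_super : weak_supersolution s p [set: 'rV[R]_N] u) :
  exists c : R, {ae lebesgue_rV N, forall x, u x = c}.
Proof.
have p0 : 0 < p by rewrite (lt_trans _ hp).
have b0 : 0 < s * p by rewrite mulr_gt0.
have bp : s * p < p by rewrite gtr_pMl.
have Nb : N%:R <= s * p by rewrite mulrC.
have [[uloc utail] usol] := u_super.
pose cube (r : R) := [set x : 'rV[R]_N | `|x| <= r].
have mcube r : measurable (cube r) by exact: measurable_cube.
have mu : measurable_fun [set: 'rV[R]_N] u.
  (* Measurability is provided on compact sets only, so the space is covered by countably many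
     cubes. *)
  rewrite (_ : setT = \bigcup_k cube k.+1%:R).
    apply/measurable_fun_bigcup => // k.
    by have [] := uloc (cube k.+1%:R) (compact_cube (ltr0Sn _ k)).
  apply/seteqP; split => // x _; exists (Num.bound `|x|) => //; rewrite /cube/=.
  rewrite ltW// (lt_le_trans (archi_boundP (normr_ge0 x)))// ler_nat.
  exact: leqnSn.
have lsc x c : c < u x -> \forall y \near x, c < u y.
  move=> cx; have [W xW WP] := u_lsc x c cx.
  by apply: filterS xW => y /WP; rewrite lte_fin.
have Lloc r : 0 < r ->
    (\int[lebesgue_rV N]_x (\1_(cube r) x * u x `^ (p - 1))%:E < +oo)%E.
  move=> r0; have [_] := uloc (cube r) (compact_cube r0).
  rewrite integral_mkcond; congr (_ < _)%E; apply: eq_integral => x _.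
  rewrite patchE indicE; case: ifP => _; rewrite ?mul1r ?mul0r//.
  by rewrite ger0_norm.
have tail : (\int[lebesgue_rV N]_x
    (u x `^ (p - 1) / (1 + enorm x) `^ (N%:R + s * p))%:E < +oo)%E.
  by under eq_integral => x _ do rewrite -(ger0_norm (u_ge0 x)).
have ball_open r : open (ball (0 : 'rV[R]_N) r) by exact: ball_open.
have ball_bounded r : bounded_set (ball (0 : 'rV[R]_N) r).
  exists r; split; first exact: num_real.
  move=> M rM x; rewrite -ball_normE/= sub0r normrN => xr.
  by rewrite ltW// (lt_trans xr).
have Wloc r : 0 < r -> (\int[lebesgue_rV N \x lebesgue_rV N]_z
    (\1_(cube r) z.1 * \1_(cube r) z.2 * energy_density p (N%:R + s * p) u z)%:E < +oo)%E.
  (* The closed cube of radius [r] lies in the open ball of radius [r + 1], whose compact closure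
     lies in the ball of radius [r + 2], a bounded open set as the definition requires. *)
  move=> r0; have r1 : 0 < r + 1 by rewrite addr_gt0.
  have [/(_ (ball 0 (r + 1)))] := usol (ball 0 (r + 2)) (ball_open _) (ball_bounded _) (@subsetT _ _).
  have cl : closure (ball (0 : 'rV[R]_N) (r + 1)) `<=` cube (r + 1).
    rewrite (_ : cube (r + 1) = closed_ball 0 (r + 1))//.
    by rewrite closed_ballE//; apply/seteqP; split => x; rewrite /closed_ball_/cube/= sub0r normrN.
  have ballE t : ball (0 : 'rV[R]_N) t = [set x | `|x| < t].
    by rewrite -ball_normE; apply/seteqP; split => x; rewrite /ball_/= sub0r normrN.
  case=> [//||x /cl|_ H _]; last first.
    apply: le_lt_trans H; rewrite [leRHS]integral_mkcond; set W := _ `*` _.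
    have mW : measurable W by apply: measurableX; rewrite ballE; exact: measurable_near.
    have mED := measurable_energy_density p (N%:R + s * p) mu.
    apply: ge0_le_integral => //.
    - by move=> z _; rewrite lee_fin mulr_ge0 ?energy_density_ge0.
    - apply/measurable_EFinP; apply: measurable_funM => //.
      by apply: measurable_funM; [exact: (measurableT_comp (measurable_indic (mcube r)) measurable_fst)|
        exact: (measurableT_comp (measurable_indic (mcube r)) measurable_snd)].
    - apply/(measurable_restrictT _ mW); apply: measurable_funTS; exact/measurable_EFinP.
    - move=> z _; rewrite patchE; case: ifPn => zW.
        by rewrite lee_fin ler_piMl ?energy_density_ge0.
      rewrite lee_fin /cube !indic_cubeE; move: zW; rewrite notin_setE /W ballE => zW.
      have [z1|z1] := boolP (`|z.1| <= r); last by rewrite mul0r mul0r.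
      have [z2|z2] := boolP (`|z.2| <= r); last by rewrite mulr0 mul0r.
      by exfalso; apply: zW; split => /=; [rewrite (le_lt_trans z1)// ltrDl|rewrite (le_lt_trans z2)// ltrDl].
  - by rewrite ballE /cube/= => xr; apply: le_lt_trans xr _; rewrite ltrD2l; lra.
  - by apply: (subclosed_compact _ (compact_cube r1) cl); exact: closed_closure.
have super e c : 0 < e -> (0 <= \int[lebesgue_rV N \x lebesgue_rV N]_z
    (flux (s * p) p u (fun x => bump e (x - c)) z)%:E)%E.
  move=> e0; have [_] := usol (ball 0 (`|c| + e + 1)) (ball_open _) (ball_bounded _) (@subsetT _ _).
  apply; last by move=> x; exact: bump_ge0.
  apply: bump_Cc_infty => // x /= xc; rewrite -ball_normE/= sub0r normrN.
  have := lerB_dist x c; lra.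
apply: ae_eq_cst.
(* Natural levels are enough and keep the union of the exceptional sets countable. *)
have H (k : nat) : {ae (lebesgue_rV N \x lebesgue_rV N)%E, forall z,
    Num.max 0 (k%:R - u z.1) = Num.max 0 (k%:R - u z.2)}.
  apply: (@energy_eq0_ae _ _ p (N%:R + s * p) (fun x => Num.max 0 (k%:R - u x))) => //.
    apply: measurable_maxr; first exact: measurable_cst.
    by apply: measurable_funB => //; exact: measurable_cst.
  exact: (trunc_energy_eq0 b0 bp hp mu u_ge0 Wloc Lloc tail super Nb lsc).
have : {ae (lebesgue_rV N \x lebesgue_rV N)%E, forall z, forall k : nat,
    Num.max 0 (k%:R - u z.1) = Num.max 0 (k%:R - u z.2)} by exact/ae_foralln.
apply: filterS => z zk.
(* At a level above both values the positive parts are plain differences, so the two values of u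
   coincide. *)
have := zk (Num.bound (u z.1) + Num.bound (u z.2))%N.
rewrite natrD; have := archi_boundP (u_ge0 z.1); have := archi_boundP (u_ge0 z.2).
by move=> h2 h1; rewrite !max_r; have := u_ge0 z.1; have := u_ge0 z.2; lra.
Qed.
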